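(* Consider the two-term model $\bm Y=\lambda_1\bm A_1\otimes\bm B_1+\lambda_2\bm A_2\otimes\bm B_2+\sigma2^{-(M+N)/2}\bm E$ with deterministic $\lambda_k,\bm A_k,\bm B_k$, along a sequence with $M+N\to\infty$. Assume: (A1) $\frac{m_0+n_0}{\ln\ln(MN)}\to\infty$, $\frac{m_0^\dagger+n_0^\dagger}{\ln\ln(MN)}\to\infty$; (A2) $\bm E$ has i.i.d. standard normal entries; (A4) there is $0<\xi<1$ with $$\max_{(m,n)\in\mathcal W_A}\cos\Theta(\mathcal R_{m,n}[\bm A_1\otimes\bm B_1],\mathcal R_{m,n}[\bm A_2\otimes\bm B_2])\le\xi,\quad \max_{(m,n)\in\mathcal W_B}\cos\Theta(\mathcal R_{m,n}[\bm A_1\otimes\bm B_1]',\mathcal R_{m,n}[\bm A_2\otimes\bm B_2]')\le\xi;$$ (A6) with $G=\lambda_1^2\psi_1^2-\lambda_2^2\phi_2^2-2\lambda_1\lambda_2\phi_1\phi_2\xi$, $$\frac{2^{M+N}}{2^{m_0+n_0}+2^{m_0^\dagger+n_0^\dagger}}\cdot\frac{G}{\sigma^2+\lambda_2^2}\to\infty,\qquad 2^{(M+N)/4}\frac{G}{(\lambda_1+\lambda_2)\sigma}\to\infty.$$ Let $\alpha=\ln\big(1+\frac{G}{\sigma^2+\lambda_2^2}\big)$. If $\kappa\ge 2\ln 2$ and $\kappa=o\big(\frac{2^{M+N}\alpha}{2^{m_0+n_0}+2^{M+N-m_0-n_0}}\big)$, then $$\min_{(m,n)\in\mathcal W}\mathbb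 E[\mathrm{IC}_\kappa(m,n)]-\mathbb E[\mathrm{IC}_\kappa(m_0,n_0)]\ge 2^{M+N}\alpha(1+o(1)),$$ and $\lim_{M+N\to\infty}P\big[\mathrm{IC}_\kappa(m_0,n_0)<\min_{(m,n)\in\mathcal W}\mathrm{IC}_\kappa(m,n)\big]=1$.
   Context: Two-term model: $\lambda_1\ge\lambda_2>0$, $\sigma>0$; $\bm A_k$ are $2^{m_0}\times 2^{n_0}$, $\bm B_k$ are $2^{M-m_0}\times2^{N-n_0}$, with $\mathrm{tr}(\bm A_k\bm A_l')=\mathrm{tr}(\bm B_k\bm B_l')=\delta_{kl}$ for $k,l\in\{1,2\}$. $m_0^\dagger=M-m_0$, $n_0^\dagger=N-n_0$. All quantities may depend on the sequence index. ''$a_k\ge o(1)$'' means $\max\{-a_k,0\}=o(1)$. Rearrangement: for a $2^a\times 2^b$ matrix $\bm C$ and $0\le m\le a,0\le n\le b$, view $\bm C$ as a $2^m\times 2^n$ array of $2^{a-m}\times 2^{b-n}$ blocks $\bm C_{i,j}$; $\mathcal R_{m,n}[\bm C]$ is the $2^{m+n}\times 2^{a+b-m-n}$ matrix with rows $\mathrm{vec}(\bm C_{i,j})'$ (row-major in $(i,j)$), $\mathrm{vec}$ stacking rows. Even for the two-term model, the one-term fit is used: for configuration $(m,n)$, $\hat{\bm Y}^{(m,n)}=\hat\lambda\hat{\bm A}\otimes\hat{\bm B}$ where $\hat\lambda=\|\mathcal R_{m,n}[\bm Y]\|_S$ and $\hat{\bm A}$ ($2^m\times2^n$), $\hat{\bm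 B}$ are obtained by un-vectorizing the leading left/right singular vectors of $\mathcal R_{m,n}[\bm Y]$; $\mathrm{IC}_\kappa(m,n)=2^{M+N}\ln\|\bm Y-\hat{\bm Y}^{(m,n)}\|_F^2+\kappa(2^{m+n}+2^{M+N-m-n})$. $\mathcal C=\{0,\dots,M\}\times\{0,\dots,N\}\setminus\{(0,0),(M,N)\}$, $\mathcal W=\mathcal C\setminus\{(m_0,n_0)\}$, $\mathcal W_A=\{(m,n)\in\mathcal W: m+n\ge (M-m)+(N-n)\}$, $\mathcal W_B=\{(m,n)\in\mathcal W: m+n<(M-m)+(N-n)\}$. $\phi_k=\max_{(m,n)\in\mathcal W}\|\mathcal R_{m,n}[\bm A_k\otimes\bm B_k]\|_S$, $\psi_k^2=1-\phi_k^2$. For matrices $\bm M_1,\bm M_2$ with the same number of rows, $\cos\Theta(\bm M_1,\bm M_2)=\sup\frac{u_1'\bm M_1'\bm M_2u_2}{\|\bm M_1u_1\|\|\bm M_2u_2\|}$ over $u_1,u_2$ with $\bm M_1u_1\ne0\ne\bm M_2u_2$ (smallest principal angle between column spaces). *)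

(* Defs.v *)
From HB Require Import structures.
From mathcomp Require Import all_boot all_order all_algebra.
From mathcomp Require Import all_classical all_reals all_analysis.
Set Implicit Arguments. Unset Strict Implicit. Unset Printing Implicit Defensive.
Import Order.TTheory GRing.Theory Num.Theory.
Import numFieldNormedType.Exports.
Local Open Scope classical_set_scope.
Local Open Scope ring_scope.

Section Defs.
Variable R : realType.

Definition getm p q (A : 'M[R]_(p, q)) (i j : nat) : R :=
  match (insub i : option 'I_p), (insub j : option 'I_q) with
  | Some i', Some j' => A i' j'
  | _, _ => 0
  end.

(* Kronecker product A (p1 x q1) (x) B (p2 x q2), viewed as a P x Q matrix,
   where P = p1 * p2 and Q = q1 * q2 (row-major block convention) *)
Definition kron P Q p1 q1 p2 q2 (A : 'M[R]_(p1, q1)) (B : 'M[R]_(p2, q2))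
  : 'M[R]_(P, Q) :=
  \matrix_(i < P, j < Q)
     (getm A (i %/ p2) (j %/ q2) * getm B (i %% p2) (j %% q2)).

(* Rearrangement R_{m,n}[C] of a 2^a x 2^b matrix C: row (i * 2^n + j) is
   vec(C_{i,j})', vec stacking rows; C_{i,j} is the (i,j) block of size
   2^(a-m) x 2^(b-n). *)
Definition rearr (a b m n : nat) (C : 'M[R]_(2 ^ a, 2 ^ b))
  : 'M[R]_(2 ^ (m + n), 2 ^ (a + b - m - n)) :=
  \matrix_(r < 2 ^ (m + n), c < 2 ^ (a + b - m - n))
    getm C ((r %/ 2 ^ n) * 2 ^ (a - m) + c %/ 2 ^ (b - n))
           ((r %% 2 ^ n) * 2 ^ (b - n) + c %% 2 ^ (b - n)).

Definition vnorm n (v : 'cV[R]_n) : R := Num.sqrt (\sum_(i < n) v i 0 ^+ 2).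

Definition frob2 p q (C : 'M[R]_(p, q)) : R := \sum_(i < p) \sum_(j < q) C i j ^+ 2.

Definition specnorm p q (C : 'M[R]_(p, q)) : R :=
  sup [set vnorm (C *m v) | v in [set v : 'cV[R]_q | vnorm v = 1]].

(* (u, v) is a pair of leading left/right singular vectors of C *)
Definition is_leading_pair p q (C : 'M[R]_(p, q)) (uv : 'cV[R]_p * 'cV[R]_q) : Prop :=
  [/\ vnorm uv.1 = 1, vnorm uv.2 = 1 & (uv.1^T *m C *m uv.2) 0 0 = specnorm C].

Definition lead_pair p q (C : 'M[R]_(p, q)) : 'cV[R]_p * 'cV[R]_q :=
  xget (0, 0) (is_leading_pair C).

Definition fit (M N m n : nat) (Y : 'M[R]_(2 ^ M, 2 ^ N)) : 'M[R]_(2 ^ M, 2 ^ N) :=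
  let C := rearr m n Y in
  let uv := lead_pair C in
  let Ahat : 'M[R]_(2 ^ m, 2 ^ n) :=
    \matrix_(i < 2 ^ m, j < 2 ^ n) getm uv.1 (i * 2 ^ n + j) 0 in
  let Bhat : 'M[R]_(2 ^ (M - m), 2 ^ (N - n)) :=
    \matrix_(i < 2 ^ (M - m), j < 2 ^ (N - n)) getm uv.2 (i * 2 ^ (N - n) + j) 0 in
  specnorm C *: kron (2 ^ M) (2 ^ N) Ahat Bhat.

Definition IC (kappa : R) (M N m n : nat) (Y : 'M[R]_(2 ^ M, 2 ^ N)) : R :=
  (2 ^ (M + N))%:R * ln (frob2 (Y - fit m n Y))
  + kappa * ((2 ^ (m + n))%:R + (2 ^ (M + N - m - n))%:R).

(* cosine of the smallest principal angle between column spaces *)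
Definition cosTheta r c1 c2 (M1 : 'M[R]_(r, c1)) (M2 : 'M[R]_(r, c2)) : R :=
  sup [set x | exists (u1 : 'cV[R]_c1) (u2 : 'cV[R]_c2),
          [/\ M1 *m u1 != 0, M2 *m u2 != 0 &
              x = (u1^T *m M1^T *m M2 *m u2) 0 0 / (vnorm (M1 *m u1) * vnorm (M2 *m u2))]].

Definition rearrT (a b m n : nat) (C : 'M[R]_(2 ^ a, 2 ^ b)) := (rearr m n C)^T.

Definition iid_std_normal d (T : measurableType d) (P : probability T R) p q
    (E : T -> 'M[R]_(p, q)) : Prop :=
  [/\ (forall i j, measurable_fun setT (fun w => E w i j)),
      (forall i j (B : set R), measurable B ->
          P ((fun w => E w i j) @^-1` B) = normal_prob 0 1 B) &
      (forall B : 'I_p -> 'I_q -> set R, (forall i j, measurable (B i j)) ->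
          P [set w | forall i j, B i j (E w i j)] =
          (\prod_(i < p) \prod_(j < q) P ((fun w => E w i j) @^-1` B i j))%E)].

End Defs.

Definition inC (M N m n : nat) : bool :=
  [&& (m <= M)%N, (n <= N)%N, ~~ ((m == 0) && (n == 0)) & ~~ ((m == M) && (n == N))].
Definition inW (M N m0 n0 m n : nat) : bool :=
  inC M N m n && ~~ ((m == m0) && (n == n0)).
Definition inWA (M N m0 n0 m n : nat) : bool :=
  inW M N m0 n0 m n && ((M - m) + (N - n) <= m + n)%N.
Definition inWB (M N m0 n0 m n : nat) : bool :=
  inW M N m0 n0 m n && (m + n < (M - m) + (N - n))%N.

Definition phiW (R : realType) (M N m0 n0 : nat) (X : 'M[R]_(2 ^ M, 2 ^ N)) : R :=
  \big[Num.max/0]_(m < M.+1) \big[Num.max/0]_(n < N.+1)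
     (if inW M N m0 n0 m n then specnorm (rearr m n X) else 0).

(* Main.v *)
Require Import Defs.
From HB Require Import structures.
From mathcomp Require Import all_boot all_order all_algebra.
From mathcomp Require Import all_classical all_reals all_analysis.
From mathcomp Require Import measurable_realfun.
From mathcomp Require Import zify ring lra.
Set Implicit Arguments. Unset Strict Implicit. Unset Printing Implicit Defensive.
Import Order.TTheory GRing.Theory Num.Theory.
Import numFieldNormedType.Exports.
Local Open Scope classical_set_scope.
Local Open Scope ring_scope.

(** For a configuration (m, n) the squared residual of the fit is ||R Y||_F^2 - ||R Y||_S^2,
    where R Y is the rearrangement.  A union bound over a lattice net, applied to Gaussian quadratic
    forms and their exponential moments, shows that for a p x q unfolding (p <= q, p q = 2^(M+N)) the
    spectral norm squared of R Y exceeds that of the signal part by at most sigma^2 / p plus an error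
    of order sigma^2 2^(-(M+N)/2) + (lambda1 + lambda2) sigma 2^(-(M+N)/4), up to a factor
    1 + ln(1 + U) / p with E U <= 1.  By the principal angle condition the signal part is at most
    lambda1^2 - G, so a wrong residual is at least G + lambda2^2 + sigma^2 (1 - 1/p) minus the error,
    whereas the true one is at most (lambda2^2 + sigma^2) (1 + o(1)).  The loss ln(1 - 1/p) is
    absorbed by the penalty, since kappa >= 2 ln 2.  Taking expectations of logarithms needs a
    small-ball estimate: splitting the unfolding into 2 x 2 blocks, a block minus a rank one matrix
    has an entry at a distance at least comparable to that of one noisy entry from a function of
    the other entries.  For the probability statement the bad events have total mass O(1/x), because
    the sum of 1/p over all configurations is bounded. *)

(** The gap [alpha] may tend to 0, so it is not enough that the errors in the expected logarithms
    vanish: each of them must be a vanishing multiple of [alpha]. This is why a rare event is not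
    simply given a crude bound there, since a logarithm may be very negative on it. The crude bound
    is multiplied by the relative error, which is of order one whenever the sharp estimate fails,
    and the product has a small mean. Each deviation is carried by one nonnegative variable of mean
    at most 1 that enters through a logarithm. In expectation this needs no independence between the
    variables, and Markov's inequality turns the same variables into tail bounds. *)

(** * Integrals against the standard normal law *)

Section NormalIntegral.
Context {R : realType}.
Notation N01 := (normal_prob (0 : R) 1).
Import HBNNSimple.

Let density_nnsfun (f : {nnsfun measurableTypeR R >-> R}) :
  (\int[N01]_y (f y)%:E =
   \int[lebesgue_measure]_y ((f y)%:E * (normal_pdf 0 1 y)%:E))%E.
Proof.
under [LHS]eq_integral do rewrite fimfunE -fsumEFin//.
rewrite [LHS]ge0_integral_fsum//; last 2 first.
  - by move=> r; exact/measurable_EFinP/measurableT_comp.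
  - by move=> n x _; rewrite EFinM nnfun_muleindic_ge0.
under [RHS]eq_integral.
  move=> x xD; rewrite fimfunE -fsumEFin// ge0_mule_fsuml; last first.
    by move=> r; rewrite EFinM nnfun_muleindic_ge0.
  over.
rewrite [RHS]ge0_integral_fsum//; last 2 first.
  - move=> r; apply: emeasurable_funM.
      by apply/measurable_EFinP; do 2 apply/measurableT_comp => //.
    by apply/measurable_EFinP; exact: measurable_normal_pdf.
  - move=> n x _; rewrite mule_ge0//; last by rewrite lee_fin normal_pdf_ge0.
    by rewrite EFinM nnfun_muleindic_ge0.
apply: eq_fsbigr => r _.
(* A negative value is not attained, so both integrals vanish; otherwise the constant can be taken
   out of each. *)
have [r0|r0] := ltP r 0.
  have fr0 : f @^-1` [set r] = set0.
    by rewrite -subset0 => x /= fx; move: r0; rewrite -fx ltNge fun_ge0.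
  rewrite fr0; under eq_integral do rewrite indic0 mulr0.
  under [RHS]eq_integral do rewrite indic0 mulr0 mul0e.
  by rewrite !integral0.
under eq_integral do rewrite EFinM.
under [RHS]eq_integral do rewrite EFinM -muleA.
rewrite ge0_integralZl//; [|exact/measurable_EFinP].
rewrite [RHS]ge0_integralZl//; last first.
  - by move=> x _; rewrite mule_ge0// lee_fin normal_pdf_ge0.
  - apply: emeasurable_funM; first exact/measurable_EFinP.
    by apply/measurable_EFinP; exact: measurable_normal_pdf.
congr (_ * _)%E; rewrite integral_indic//= setIT /normal_prob.
rewrite [LHS]integral_mkcond/=; apply: eq_integral => x _.
by rewrite patchE indicE; case: ifPn; rewrite ?mul1e ?mul0e.
Qed.

(** Monotone convergence carries the density formula from simple functions to nonnegative measurable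
    ones. *)
Lemma integral_normal_prob (f : R -> \bar R) :
  measurable_fun [set: measurableTypeR R] f -> (forall y, (0 <= f y)%E) ->
  (\int[N01]_y f y = \int[lebesgue_measure]_y (f y * (normal_pdf 0 1 y)%:E))%E.
Proof.
move=> mf f0; pose f_ := nnsfun_approx measurableT mf.
have cf x : EFin \o f_ ^~ x @ \oo --> f x by exact: cvg_nnsfun_approx.
have mf_ n : measurable_fun [set: measurableTypeR R] (fun x => (f_ n x)%:E).
  by apply/measurable_EFinP; apply: measurable_funPT.
transitivity (limn (fun n => \int[N01]_x (f_ n x)%:E)%E).
  rewrite -monotone_convergence//.
  - by apply: eq_integral => y _; apply/esym/cvg_lim => //; exact: cf.
  - by move=> n y _; rewrite lee_fin.
  - by move=> y _ m n mn; rewrite lee_fin; exact/lefP/nd_nnsfun_approx.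
transitivity (limn (fun n => \int[lebesgue_measure]_x
    ((f_ n x)%:E * (normal_pdf 0 1 x)%:E))%E).
  by congr (limn _); apply/funext => n; exact: density_nnsfun.
rewrite -monotone_convergence//.
- apply: eq_integral => y _; apply/cvg_lim => //.
  apply: cvgeZr => //; exact: cf.
- move=> n; apply: emeasurable_funM.
    exact: mf_.
  by apply/measurable_EFinP; exact: measurable_normal_pdf.
- by move=> n y _; rewrite mule_ge0// lee_fin// normal_pdf_ge0.
- move=> y _ m n mn; rewrite lee_wpmul2r ?lee_fin ?normal_pdf_ge0//.
  exact/lefP/nd_nnsfun_approx.
Qed.

Lemma normal_interval_le (w e : R) : 0 <= e ->
  (N01 [set y | `|y - w| <= e]%R <= e%:E)%E.
Proof.
move=> e0; have -> : [set y : R | `|y - w| <= e] = `[(w - e)%R, (w + e)%R]%classic.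
  by apply/seteqP; split => y /=; rewrite in_itv/= ler_distl.
(* Since pi >= 2, sqrt (2 pi) >= 2; the interval has length 2 e. *)
have p2 : normal_peak (1 : R) <= 1 / 2.
  rewrite /normal_peak expr1n mul1r -[1/2]invrK lef_pV2 ?posrE//; last first.
    by rewrite sqrtr_gt0 mulrn_wgt0// pi_gt0.
  rewrite invf_div divr1 -(@ler_sqr _ 2) ?nnegrE ?sqrtr_ge0//.
  rewrite sqr_sqrtr; last by rewrite mulrn_wge0// pi_ge0.
  by rewrite -mulr_natr; have := @pi_ge2 R; lra.
rewrite /normal_prob/=; set I := [set` _].
apply: (@le_trans _ _ (\int[lebesgue_measure]_(x in I) ((1 / 2)%R)%:E)%E).
  apply: ge0_le_integral => //=.
  - exact: measurable_itv.
  - by move=> x _; rewrite lee_fin normal_pdf_ge0.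
  - by apply/measurable_EFinP/measurable_funTS; exact: measurable_normal_pdf.
  - move=> x _; rewrite lee_fin; apply: le_trans p2; exact: normal_pdf_ub.
rewrite /I integral_cst//= lebesgue_measure_itv/= lte_fin.
case: ifPn => _; last by rewrite mule0 lee_fin.
by rewrite -EFinD -EFinM lee_fin; lra.
Qed.

(** Completing the square: with d = 1 - 2 tau z^2, the integrand times the density is a constant
    multiple of the normal density of mean 2 tau c z / d and variance 1 / d. *)
Lemma integral_normal_exp_sqr (tau c z : R) : 2 * tau * z ^+ 2 < 1 ->
  (\int[N01]_y (expR (tau * (c + z * y) ^+ 2))%:E =
   ((Num.sqrt (1 - 2 * tau * z ^+ 2))^-1
     * expR (tau * c ^+ 2 / (1 - 2 * tau * z ^+ 2)))%:E)%E.
Proof.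
move=> tz; set d := 1 - 2 * tau * z ^+ 2.
have d0 : 0 < d by rewrite /d; lra.
have s0 : Num.sqrt d != 0 by rewrite gt_eqF// sqrtr_gt0.
have sd : Num.sqrt d ^+ 2 = d by rewrite sqr_sqrtr// ltW.
rewrite integral_normal_prob; last 2 first.
  - apply/measurable_EFinP; apply: measurableT_comp => //.
    apply: measurable_funM => //; apply: measurable_funX.
    by apply: measurable_funD => //; apply: measurable_funM.
  - by move=> y; rewrite lee_fin expR_ge0.
pose K := (Num.sqrt d)^-1 * expR (tau * c ^+ 2 / d).
pose m := 2 * tau * c * z / d.
transitivity (\int[lebesgue_measure]_y (K%:E * (normal_pdf m (Num.sqrt d)^-1 y)%:E))%E.
  apply: eq_integral => y _; rewrite -!EFinM; congr (_%:E).
  rewrite !normal_pdfE ?invr_eq0 ?oner_eq0//.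
  have -> : normal_peak (Num.sqrt d)^-1 = Num.sqrt d * normal_peak 1.
    rewrite /normal_peak exprVn sd expr1n mul1r -mulrnAr sqrtrM ?invr_ge0 ?ltW//.
    by rewrite invfM sqrtrV ?ltW// invrK.
  rewrite /K /normal_fun mulrCA -expRD.
  set eA := expR (tau * c ^+ 2 / d); set eB := expR (_ / (_ *+ 2)).
  have -> : (Num.sqrt d)^-1 * eA * (Num.sqrt d * normal_peak 1 * eB)
     = normal_peak 1 * (eA * eB).
    by field.
  rewrite -expRD exprVn sd expr1n; congr (_ * expR _); rewrite /m.
  have dn0 : d != 0 by rewrite gt_eqF.
  apply: (mulIf dn0).
  have -> : (tau * (c + z * y) ^+ 2 + - (y - 0) ^+ 2 / (1 *+ 2)) * d =
    tau * c ^+ 2 + 2 * tau * c * z * y * d - tau * z ^+ 2 * 2 * tau * c ^+ 2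
     - (y * d) ^+ 2 / 2.
    by rewrite /d; field.
  have -> : (tau * c ^+ 2 / d + - (y - 2 * tau * c * z / d) ^+ 2 / (d^-1 *+ 2)) * d =
    tau * c ^+ 2 - (y * d - 2 * tau * c * z) ^+ 2 / 2.
    by field.
  by field.
rewrite ge0_integralZl//=.
- by rewrite integral_normal_pdf mule1.
- by apply/measurable_EFinP; exact: measurable_normal_pdf.
- by move=> y _; rewrite lee_fin normal_pdf_ge0.
- by rewrite lee_fin mulr_ge0 ?invr_ge0 ?sqrtr_ge0 ?expR_ge0.
Qed.

End NormalIntegral.

(** * Finite families of independent normal variables *)

(** [normal_prob] is a measure on [measurableTypeR R]; the same set function is declared a measure
    on [R] itself, where the matrix entries live. The identity map transfers integrals in
    [integral_gaussE]. *)
Definition gauss {R : realType} : set R -> \bar R := normal_prob 0 1.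

HB.instance Definition _ (R : realType) :=
  isMeasure.Build _ R R gauss (@measure0 _ _ _ (normal_prob (0 : R) 1))
    (@measure_ge0 _ _ _ (normal_prob (0 : R) 1))
    (@measure_semi_sigma_additive _ _ _ (normal_prob (0 : R) 1)).

HB.instance Definition _ (R : realType) :=
  Measure_isProbability.Build _ _ R gauss
    (@probability_setT _ _ _ (normal_prob (0 : R) 1)).

Definition rectangle {R : realType} {I : Type} (B : I -> set R) : set (I -> R) :=
  [set x | forall i, B i (x i)].

(** Generating class of the sigma-algebra of [famT], which for finite [I] is the product one. *)
Definition rectangles (R : realType) (I : Type) : set (set (I -> R)) :=
  [set rectangle B | B in [set B | forall i, measurable (B i)]].

Arguments rectangles : clear implicits.

Notation famT R I := (g_sigma_algebraType (rectangles R I)).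

Lemma measurable_rectangle {R : realType} {I : Type} (B : I -> set R) :
  (forall i, measurable (B i)) -> measurable (rectangle B : set (famT R I)).
Proof. by move=> mB; apply: sub_sigma_algebra; exists B. Qed.

Lemma measurable_coord {R : realType} {I : eqType} (i : I) :
  measurable_fun setT (fun x : famT R I => x i).
Proof.
move=> _ B mB; rewrite setTI.
have -> : (fun x : famT R I => x i) @^-1` B =
    rectangle (fun j => if j == i then B else setT).
  apply/seteqP; split=> x /=; last by move=> /(_ i); rewrite eqxx.
  by move=> Bx j; case: eqP => // ->.
by apply: measurable_rectangle => j; case: ifP.
Qed.

Lemma measurable_to_fam {R : realType} {I : finType} {d} {T : measurableType d}
    (f : T -> famT R I) :
  (forall i, measurable_fun setT (fun t => f t i)) -> measurable_fun setT f.
Proof.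
move=> mf. refine (@measurability _ _ T (famT R I) setT f (rectangles R I) (erefl _) _).
move=> _ [_ [B mB <-] <-]; rewrite setTI.
have -> : f @^-1` rectangle B = \bigcap_(i in [set: I]) ((fun t => f t i) @^-1` B i).
  by apply/seteqP; split=> t /= h i; [move=> _; exact: h|exact: h].
apply: fin_bigcap_measurable; first exact: finite_finset.
by move=> i _; rewrite -[X in measurable X]setTI; exact: mf.
Qed.

Definition setc {R : realType} {I : eqType} (i : I) (y : R) (x : I -> R) : I -> R :=
  fun j => if j == i then y else x j.

Definition iid_gauss {R : realType} {d} {T : measurableType d}
    (P : probability T R) {I : finType} (x : T -> I -> R) : Prop :=
  (forall i, measurable_fun setT (fun w => x w i)) /\
  forall B : I -> set R, (forall i, measurable (B i)) ->
    P [set w | forall i, B i (x w i)] = (\prod_i gauss (B i))%E.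

(* An independent copy may replace one coordinate; Fubini then integrates it out. *)
Lemma iid_gauss_resample {R : realType} {d} {T : measurableType d}
    (P : probability T R) {I : finType} (x : T -> I -> R) (i : I)
    (F : famT R I -> \bar R) :
  iid_gauss P x -> measurable_fun setT F -> (forall u, 0 <= F u)%E ->
  (\int[P]_w F (x w) = \int[P]_w \int[gauss]_y F (setc i y (x w)))%E.
Proof.
move=> [mx xP] mF F0.
pose psi (p : T * R) : famT R I := setc i p.2 (x p.1).
have mpsi : measurable_fun setT psi.
  apply: measurable_to_fam => j; rewrite /psi /setc.
  case: (j == i); first exact: measurable_snd.
  by apply: (measurableT_comp (mx j)); exact: measurable_fst.
have mphi : measurable_fun setT (x : T -> famT R I) by apply: measurable_to_fam.
have e1 : (\int[P]_w F (x w) = \int[pushforward P (x : T -> famT R I)]_u F u)%E.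
  by rewrite ge0_integral_pushforward.
transitivity (\int[(P \x gauss)%E]_p F (psi p))%E; last first.
  by rewrite fubini_tonelli1//; exact: measurableT_comp.
rewrite e1.
have e2 : (\int[(P \x gauss)%E]_p F (psi p) =
    \int[pushforward (P \x gauss)%E psi]_u F u)%E.
  by rewrite ge0_integral_pushforward.
rewrite e2; apply: eq_measure_integral => A mA _.
(* Both laws agree on rectangles, which are stable under intersection and generate the
   sigma-algebra. *)
apply: (@measure_unique _ _ (famT R I) (rectangles R I) (fun=> setT)) => //.
- move=> _ _ [B mB <-] [C mC <-]; exists (fun i => B i `&` C i).
    by move=> j; exact: measurableI.
  apply/seteqP; split => u /=.
    by move=> h; split=> j; have [] := h j.
  by move=> [h1 h2] j; split.
- move=> n; exists (fun=> setT) => //.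
  by apply/seteqP; split.
- by rewrite bigcup_const//; exists 0%N.
- move=> _ [B mB <-].
  (* The constraint on coordinate [i] is moved to the fresh copy. *)
  pose B' j := if j == i then setT else B j.
  have mB' j : measurable (B' j) by rewrite /B'; case: ifP.
  suff: P ((x : T -> famT R I) @^-1` rectangle B) =
    (P \x gauss)%E (psi @^-1` rectangle B) by [].
  have -> : (P \x gauss)%E (psi @^-1` rectangle B) =
      (P \x gauss)%E ([set w | forall j, B' j (x w j)] `*` B i).
    congr ((P \x gauss)%E _); apply/seteqP; split => -[w y] /=.
      move=> h; split; last by have := h i; rewrite /psi /setc eqxx.
      by move=> j; have := h j; rewrite /psi /setc /B' /=; case: ifP.
    move=> [h1 h2] j; rewrite /psi /setc/=; have := h1 j; rewrite /B'.
    by case: eqP => // ->.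
  have mR : measurable [set w | forall j, B' j (x w j)].
    have := mphi measurableT _ (measurable_rectangle mB').
    by rewrite setTI.
  rewrite product_measure1E//.
  transitivity (P [set w | forall j, B j (x w j)]) => //.
  rewrite xP// [X in (X * _)%E]xP// (bigD1 i)//= [in RHS](bigD1 i)//=.
  rewrite /B' eqxx probability_setT mul1e muleC; congr (_ * _)%E.
  by apply: eq_bigr => j /negbTE ->.
- move=> _; suff: (P ((x : T -> famT R I) @^-1` setT) < +oo)%E by [].
  by rewrite preimage_setT probability_setT ltry.
Qed.

Lemma integral_gaussE {R : realType} (f : R -> \bar R) :
  measurable_fun setT f -> (forall y, (0 <= f y)%E) ->
  (\int[gauss]_y f y = \int[normal_prob (0 : R) 1]_y f y)%E.
Proof.
move=> mf f0; pose idR : measurableTypeR R -> R := idfun.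
have mid : measurable_fun setT idR := @measurable_id _ _ setT.
transitivity (\int[pushforward (normal_prob (0 : R) 1) idR]_y f y)%E.
  by apply: eq_measure_integral => A _ _.
by rewrite ge0_integral_pushforward.
Qed.

Lemma integral_gauss_exp_sqr {R : realType} (tau c z : R) : 2 * tau * z ^+ 2 < 1 ->
  (\int[gauss]_y (expR (tau * (c + z * y) ^+ 2))%:E =
   ((Num.sqrt (1 - 2 * tau * z ^+ 2))^-1
     * expR (tau * c ^+ 2 / (1 - 2 * tau * z ^+ 2)))%:E)%E.
Proof.
move=> h; rewrite integral_gaussE ?integral_normal_exp_sqr//.
apply/measurable_EFinP; apply: measurableT_comp => //.
apply: measurable_funM => //; apply: measurable_funX.
by apply: measurable_funD => //; apply: measurable_funM.
Qed.

Lemma measurable_sum_cond {R : realType} {d} {T : measurableType d} {J : Type}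
    (s : seq J) (p : pred J) (f : J -> T -> R) :
  (forall j, measurable_fun setT (f j)) ->
  measurable_fun setT (fun u => \sum_(j <- s | p j) f j u).
Proof.
move=> mf; elim: s => [|j s IH].
  rewrite (_ : (fun _ => _) = cst 0); first exact: measurable_cst.
  by apply/funext => u; rewrite big_nil.
case pj : (p j).
  rewrite (_ : (fun _ => _) = f j \+ (fun u => \sum_(j <- s | p j) f j u)).
    exact: measurable_funD.
  by apply/funext => u; rewrite big_cons pj.
rewrite (_ : (fun _ => _) = (fun u => \sum_(j <- s | p j) f j u))//.
by apply/funext => u; rewrite big_cons pj.
Qed.

(** * Exponential moments of Gaussian quadratic forms *)

Section QuadraticMGF.
Context {R : realType} {d} {T : measurableType d} (P : probability T R).
Context {I J : finType} (x : T -> I -> R) (row : I -> J) (z : I -> R).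
Hypothesis iidx : iid_gauss P x.

Let Z (s : seq I) r := \sum_(i <- s | row i == r) z i ^+ 2.
Let L (s : seq I) r (u : I -> R) := \sum_(i <- s | row i == r) z i * u i.

(* Integrating out one coordinate of row [r] multiplies [tau r] by
   [1 / (1 - 2 tau z^2)] and keeps the shape of the integrand. *)
Lemma integral_exp_row_quadratic (s : seq I) (tau c : J -> R) : uniq s ->
  (forall r, 2 * tau r * Z s r < 1) ->
  (\int[P]_w (expR (\sum_r tau r * (c r + L s r (x w)) ^+ 2))%:E =
   (\prod_r ((Num.sqrt (1 - 2 * tau r * Z s r))^-1
     * expR (tau r * c r ^+ 2 / (1 - 2 * tau r * Z s r))))%:E)%E.
Proof.
elim: s tau => [|i s IH] tau /=.
  move=> _ _; under eq_integral do under eq_bigr do rewrite /L big_nil addr0.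
  rewrite integral_cst//= probability_setT mule1 expR_sum; congr EFin.
  by apply: eq_bigr => r _; rewrite /Z big_nil mulr0 subr0 sqrtr1 invr1 mul1r mulr1.
move=> /andP[iNs us] tauZ; set r0 := row i.
have ZE r : Z (i :: s) r = (if r == r0 then z i ^+ 2 else 0) + Z s r.
  by rewrite /Z big_cons [row i == r]eq_sym -/r0; case: ifP => //; rewrite add0r.
have Z0 r : 0 <= Z s r by apply: sumr_ge0 => j _; rewrite sqr_ge0.
have LE r u : L (i :: s) r u = (if r == r0 then z i * u i else 0) + L s r u.
  by rewrite /L big_cons [row i == r]eq_sym -/r0; case: ifP => //; rewrite add0r.
have Lc r y u : L s r (setc i y u) = L s r u.
  rewrite /L big_seq_cond [RHS]big_seq_cond; apply: eq_bigr => j /andP[js _]; rewrite /setc.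
  by case: eqP => // ji; rewrite -ji js in iNs.
set D := 1 - 2 * tau r0 * z i ^+ 2.
have tz : 2 * tau r0 * z i ^+ 2 < 1.
  have := tauZ r0; rewrite ZE eqxx => h.
  have [t0|t0] := leP (tau r0) 0.
    by apply: le_lt_trans ltr01; rewrite mulr_le0_ge0 ?sqr_ge0//; lra.
  by apply: le_lt_trans h; rewrite ler_pM2l ?lerDl//; lra.
have D0 : 0 < D by rewrite /D; lra.
pose tau' r := if r == r0 then tau r0 / D else tau r.
have tauZ' r : 2 * tau' r * Z s r < 1.
  rewrite /tau'; case: eqP => [->|/eqP rr0]; last first.
    by have := tauZ r; rewrite ZE (negbTE rr0) add0r.
  have := tauZ r0; rewrite ZE eqxx => h.
  rewrite mulrA mulrAC ltr_pdivrMr// mul1r /D; lra.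
pose F (u : famT R I) := (expR (\sum_r tau r * (c r + L (i :: s) r u) ^+ 2))%:E.
have mF : measurable_fun setT F.
  apply/measurable_EFinP; apply: measurableT_comp => //.
  apply: measurable_sum_cond => r; apply: measurable_funM => //.
  apply: measurable_funX; apply: measurable_funD => //.
  apply: measurable_sum_cond => j; apply: measurable_funM => //.
  exact: measurable_coord.
rewrite (_ : integral _ _ _ = \int[P]_w F (x w))%E//.
rewrite (iid_gauss_resample i) //; last by move=> u; rewrite lee_fin expR_ge0.
transitivity (\int[P]_w (((Num.sqrt D)^-1)%:E *
    (expR (\sum_r tau' r * (c r + L s r (x w)) ^+ 2))%:E))%E.
  apply: eq_integral => w _.
  pose A := \sum_(r | r != r0) tau r * (c r + L s r (x w)) ^+ 2.
  transitivity (\int[gauss]_y ((expR A)%:E *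
      (expR (tau r0 * ((c r0 + L s r0 (x w)) + z i * y) ^+ 2))%:E))%E.
    apply: eq_integral => y _; rewrite -EFinM -expRD /F; congr (expR _)%:E.
    rewrite (bigD1 r0)//= addrC; congr (_ + _).
      by apply: eq_bigr => r rr0; rewrite LE (negbTE rr0) add0r Lc.
    by rewrite LE eqxx Lc /setc eqxx; congr (_ * _ ^+ 2); rewrite addrCA addrC.
  rewrite ge0_integralZl//; last first.
    apply/measurable_EFinP; apply: measurableT_comp => //.
    apply: measurable_funM => //; apply: measurable_funX.
    by apply: measurable_funD => //; apply: measurable_funM.
  rewrite integral_gauss_exp_sqr// -/D -!EFinM mulrCA -expRD; congr (_ * expR _)%:E.
  rewrite [in RHS](bigD1 r0)//= addrC; congr (_ + _).
    by apply: eq_bigr => r rr0; rewrite /tau' (negbTE rr0).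
  by rewrite /tau' eqxx mulrAC.
rewrite ge0_integralZl//; last first.
  apply/measurable_EFinP.
  apply: (@measurableT_comp _ _ _ _ _ _ (fun u : famT R I =>
     expR (\sum_r tau' r * (c r + L s r u) ^+ 2))).
    apply: measurableT_comp => //.
    apply: measurable_sum_cond => r; apply: measurable_funM => //.
    apply: measurable_funX; apply: measurable_funD => //.
    apply: measurable_sum_cond => j; apply: measurable_funM => //.
    exact: measurable_coord.
  by apply: measurable_to_fam => j; exact: iidx.1.
rewrite IH// -EFinM; congr EFin.
rewrite (bigD1 r0)//= [RHS](bigD1 r0)//= mulrA; congr (_ * _); last first.
  by apply: eq_bigr => r rr0; rewrite /tau' ZE (negbTE rr0) add0r.
rewrite ZE eqxx /tau' eqxx.
(* The normalizing factors telescope: the factor of coordinate [i] times that of the remaining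
   coordinates, computed with the updated tilt, is the factor of the whole row. *)
have DD : 1 - 2 * tau r0 * (z i ^+ 2 + Z s r0) = D * (1 - 2 * (tau r0 / D) * Z s r0).
  by rewrite /D; field; rewrite -/D gt_eqF.
have D1 : 0 < 1 - 2 * (tau r0 / D) * Z s r0.
  by have := tauZ' r0; rewrite /tau' eqxx subr_gt0.
rewrite DD sqrtrM ?ltW//; move: (1 - _ * _ * _) D1 => X X0.
rewrite [(_ * _ : R)^-1]invfM -!mulrA; do 2 congr (_ * _); congr expR.
by field; rewrite (gt_eqF D0) (gt_eqF X0).
Qed.

End QuadraticMGF.

(** * Squared norms and a lattice net for quadratic forms *)

Definition sqn {R : realType} {n} (v : 'cV[R]_n) : R := \sum_(i < n) v i 0 ^+ 2.

Section SquaredNorm.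
Context {R : realType}.

Lemma sqn_ge0 n (v : 'cV[R]_n) : 0 <= sqn v.
Proof. by apply: sumr_ge0 => i _; exact: sqr_ge0. Qed.

Lemma sqnZ n (a : R) (v : 'cV[R]_n) : sqn (a *: v) = a ^+ 2 * sqn v.
Proof. by rewrite /sqn mulr_sumr; apply: eq_bigr => i _; rewrite mxE exprMn. Qed.

(** Lagrange's identity: the defect is half the sum of the squared 2 x 2 minors. *)
Lemma cauchy_schwarz (I : finType) (a b : I -> R) :
  (\sum_i a i * b i) ^+ 2 <= (\sum_i a i ^+ 2) * \sum_i b i ^+ 2.
Proof.
have H : 0 <= \sum_i \sum_j (a i * b j - a j * b i) ^+ 2.
  by apply: sumr_ge0 => i _; apply: sumr_ge0 => j _; exact: sqr_ge0.
have E1 : \sum_i \sum_j a i ^+ 2 * b j ^+ 2 = (\sum_i a i ^+ 2) * \sum_i b i ^+ 2.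
  by rewrite mulr_suml; apply: eq_bigr => i _; rewrite mulr_sumr.
have E2 : \sum_i \sum_j 2 * ((a i * b i) * (a j * b j)) = 2 * (\sum_i a i * b i) ^+ 2.
  rewrite expr2 mulr_suml mulr_sumr; apply: eq_bigr => i _.
  by rewrite !mulr_sumr.
have E3 : \sum_i \sum_j a j ^+ 2 * b i ^+ 2 = (\sum_i a i ^+ 2) * \sum_i b i ^+ 2.
  by rewrite exchange_big.
suff HE : \sum_i \sum_j (a i * b j - a j * b i) ^+ 2 =
  2 * ((\sum_i a i ^+ 2) * \sum_i b i ^+ 2) - 2 * (\sum_i a i * b i) ^+ 2.
  by move: H; rewrite HE; lra.
transitivity (\sum_i \sum_j (a i ^+ 2 * b j ^+ 2 + a j ^+ 2 * b i ^+ 2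
    - 2 * ((a i * b i) * (a j * b j)))).
  by apply: eq_bigr => i _; apply: eq_bigr => j _; ring.
under eq_bigr do rewrite sumrB big_split/=.
by rewrite sumrB big_split/= E1 E2 E3; ring.
Qed.

Lemma frob2_ge0 p q (A : 'M[R]_(p, q)) : 0 <= frob2 A.
Proof. by apply: sumr_ge0 => i _; apply: sumr_ge0 => j _; exact: sqr_ge0. Qed.

Lemma sqn_mulmx_le p q (A : 'M[R]_(p, q)) v : sqn (A *m v) <= frob2 A * sqn v.
Proof.
rewrite /sqn /frob2 mulr_suml; apply: ler_sum => i _; rewrite mxE.
exact: cauchy_schwarz.
Qed.

(* Difference of two values of a quadratic form, polarized with weights 4 and 1/4. *)
Definition polarized n (Q : 'cV[R]_n -> R) := forall x y,
  Q x - Q y = (Q (4 *: (x - y) + 4^-1 *: (x + y)) -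
               Q (4 *: (x - y) - 4^-1 *: (x + y))) / 4.

Lemma polarized_sqn p q (A : 'M[R]_(p, q)) : polarized (fun v => sqn (A *m v)).
Proof.
move=> x y /=; rewrite !(mulmxDr, mulmxN, =^~ scalemxAr).
rewrite /sqn -!sumrB mulr_suml; apply: eq_bigr => i _; rewrite !mxE.
by field.
Qed.

Lemma polarized_scale_sqn n (a : R) : polarized (fun v : 'cV_n => a * sqn v).
Proof.
move=> x y /=; rewrite -!mulrBr -mulrA; congr (_ * _).
by have := @polarized_sqn n n 1%:M x y; rewrite !mul1mx.
Qed.

Lemma polarizedB n (Q1 Q2 : 'cV[R]_n -> R) :
  polarized Q1 -> polarized Q2 -> polarized (fun v => Q1 v - Q2 v).
Proof. by move=> h1 h2 x y; have := h1 x y; have := h2 x y; lra. Qed.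

(** Mesh 1 / (8 sqrt p), so rounding all [p] coordinates costs at most 1/64 in squared norm. The
    shift by 9 p centers the grid, and 9 p >= 8 sqrt p makes it cover [-1, 1]. *)
Definition grid_point p (f : {ffun 'I_p -> 'I_(18 * p).+1}) : 'cV[R]_p :=
  \col_i (((f i)%:R - (9 * p)%:R) / (8 * Num.sqrt p%:R)).

Lemma grid_approx p (v : 'cV[R]_p) : (0 < p)%N -> sqn v = 1 ->
  exists f, sqn (v - grid_point f) <= 1 / 64.
Proof.
move=> p0 v1; have pR : 1 <= p%:R :> R by rewrite ler1n.
pose s : R := Num.sqrt p%:R.
have s2 : s ^+ 2 = p%:R by rewrite sqr_sqrtr; lra.
have s1 : 1 <= s by rewrite -sqrtr1 ler_sqrt; lra.
have sp : s <= p%:R by rewrite -s2 expr2 ler_pMl; lra.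
have vi i : `|v i 0| <= 1.
  rewrite -(@ler_sqr _ _ 1) ?nnegrE// expr1n real_normK ?num_real// -v1.
  by rewrite /sqn (bigD1 i)//= lerDl sumr_ge0// => j _; exact: sqr_ge0.
pose y i := 8 * s * v i 0 + (9 * p)%:R.
have y0 i : 0 <= y i.
  have := vi i; rewrite ler_norml => /andP[h _].
  by rewrite /y natrM; nra.
have ty i : (Num.truncn (y i) < (18 * p).+1)%N.
  have := vi i; rewrite ler_norml => /andP[_ h].
  rewrite ltnS -(ler_nat R); apply: le_trans (_ : y i <= _); first by rewrite truncn_le.
  by rewrite /y !natrM; nra.
exists [ffun i => Ordinal (ty i)].
rewrite /sqn; apply: le_trans (_ : \sum_(i < p) (1 / 64) * p%:R^-1 <= _); last first.
  rewrite sumr_const card_ord -mulr_natr.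
  by rewrite le_eqVlt; apply/orP; left; apply/eqP; field; rewrite gt_eqF//; lra.
apply: ler_sum => i _; rewrite !mxE ffunE /=.
have /andP[t1 t2] := truncn_itv (y0 i).
have E : v i 0 - ((Num.truncn (y i))%:R - (9 * p)%:R) / (8 * s)
    = (y i - (Num.truncn (y i))%:R) / (8 * s).
  by rewrite /y; field; rewrite gt_eqF; lra.
have E2 : (1 / 64) * p%:R^-1 = (8 * s)^-1 ^+ 2 :> R.
  by rewrite -s2; field; rewrite gt_eqF; lra.
rewrite E E2 exprMn ler_piMl ?sqr_ge0//.
rewrite -natr1 in t2.
by rewrite expr_le1//; lra.
Qed.

(** The weights 1 + 1/8 and 1 + 8 give 9/8 + 9/64 = 81/64, the square of the bound 1 + 1/8 of the
    triangle inequality. *)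
Lemma sqn_near p (v y : 'cV[R]_p) : sqn v = 1 -> sqn (v - y) <= 1 / 64 ->
  sqn y <= 81 / 64.
Proof.
move=> v1 vy; have : sqn y <= 9 / 8 * sqn v + 9 * sqn (v - y).
  rewrite /sqn !mulr_sumr -big_split; apply: ler_sum => i _; rewrite !mxE /=.
  have := sqr_ge0 (v i 0 / 8 + (v i 0 - y i 0)); nra.
by rewrite v1; lra.
Qed.

(** Net argument for a form that need not be positive. For a unit vector v and its grid point y,
    polarization writes Q v - Q y through two vectors whose squared norms sum to at most 2; the
    weights balance the short v - y against the long v + y. Hence |Q v| <= m + sup / 2 on the sphere
    and sup <= 2 m. The bound by [C] makes this supremum finite. *)
Lemma quadratic_form_le_grid p (Q : 'cV[R]_p -> R) (C m : R) : (0 < p)%N ->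
  polarized Q -> (forall a v, Q (a *: v) = a ^+ 2 * Q v) ->
  (forall v, `|Q v| <= C * sqn v) ->
  (forall f, sqn (grid_point f) <= 81 / 64 -> `|Q (grid_point f)| <= m) ->
  forall v, `|Q v| <= 2 * m * sqn v.
Proof.
move=> p0 QP QZ QC Qm.
pose S : set R := [set `|Q v| | v in [set v : 'cV[R]_p | sqn v = 1]].
have unitP (v : 'cV[R]_p) : 0 < sqn v -> sqn ((Num.sqrt (sqn v))^-1 *: v) = 1.
  move=> v0; rewrite sqnZ exprVn sqr_sqrtr ?ltW// mulVf// gt_eqF//.
have S0 : S !=set0.
  pose e := delta_mx (Ordinal p0) 0 : 'cV[R]_p.
  exists `|Q e|; exists e => //=; rewrite /sqn (bigD1 (Ordinal p0))//= big1.
    by rewrite mxE !eqxx/= expr1n addr0.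
  by move=> i /negbTE h; rewrite mxE h /= expr0n.
have Sub : has_ubound S by exists C => _ [v /= v1 <-]; have := QC v; rewrite v1 mulr1.
have hS : has_sup S by [].
have Lb (v : 'cV[R]_p) : `|Q v| <= sup S * sqn v.
  have [v0|] := ltP 0 (sqn v); last first.
    move=> h; have -> : sqn v = 0 by apply: le_anti; rewrite h sqn_ge0.
    have := QC v; have -> : sqn v = 0 by apply: le_anti; rewrite h sqn_ge0.
    by rewrite !mulr0.
  have : `|Q ((Num.sqrt (sqn v))^-1 *: v)| <= sup S.
    by apply: sup_upper_bound => //; exists ((Num.sqrt (sqn v))^-1 *: v) => //; exact: unitP.
  rewrite QZ normrM (ger0_norm (sqr_ge0 _)) exprVn sqr_sqrtr ?sqn_ge0//.
  by move=> h; rewrite -ler_pdivrMr// [leLHS]mulrC.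
have key (v : 'cV[R]_p) : sqn v = 1 -> `|Q v| <= m + sup S / 2.
  move=> v1; have [f hf] := grid_approx p0 v1; have h81 := sqn_near v1 hf.
  have hQ := Qm _ h81; move: (grid_point f) hf h81 hQ => y hf h81 hQ.
  have h1 := Lb (4 *: (v - y) + 4^-1 *: (v + y)).
  have h2 := Lb (4 *: (v - y) - 4^-1 *: (v + y)).
  have hs : sqn (4 *: (v - y) + 4^-1 *: (v + y)) + sqn (4 *: (v - y) - 4^-1 *: (v + y))
    = 2 * (16 * sqn (v - y)) + (2 / 16) * (2 * sqn v + 2 * sqn y - sqn (v - y)).
    rewrite /sqn -big_split/=.
    rewrite (eq_bigr (fun i => 32 * ((v - y) i 0 ^+ 2) + (4^-1 * (v i 0 ^+ 2) +
      (4^-1 * (y i 0 ^+ 2) - 8^-1 * ((v - y) i 0 ^+ 2))))); last first.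
      by move=> i _; rewrite !mxE; field.
    by rewrite !big_split/= sumrN -!mulr_sumr; field.
  have L0 : 0 <= sup S by have := Lb v; rewrite v1 mulr1; apply: le_trans.
  have := QP v y.
  set a := Q (_ + _) in h1 *; set b := Q (_ - _) in h2 *.
  set sa := sqn _ in h1 hs; set sb := sqn _ in h2 hs.
  move=> hp; have : `|Q v - Q y| <= sup S / 4 * (sa + sb).
    rewrite hp normrM [`|4^-1|]ger0_norm//.
    have := ler_normB a b; nra.
  rewrite hs v1 => h3.
  have h4 : `|Q v| <= `|Q y| + `|Q v - Q y|.
    by rewrite -[X in `|X| <= _](subrKC (Q y)) addrC; have := ler_normD (Q v - Q y) (Q y); rewrite addrC subrKC addrC.
  have h5 : 2 * (16 * sqn (v - y)) + 2 / 16 * (2 * 1 + 2 * sqn y - sqn (v - y)) <= 2.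
    have := sqn_ge0 (v - y); lra.
  have : sup S / 4 * (2 * (16 * sqn (v - y)) + 2 / 16 * (2 * 1 + 2 * sqn y - sqn (v - y)))
      <= sup S / 4 * 2 by rewrite ler_wpM2l//; lra.
  lra.
have supm : sup S <= 2 * m.
  have : sup S <= m + sup S / 2.
    by apply: ge_sup => // _ [v /= v1 <-]; exact: key.
  lra.
by move=> v; apply: le_trans (Lb v) _; rewrite ler_wpM2r ?sqn_ge0.
Qed.

(** Since exp (- k^2) <= 2^(-k), a two-sided geometric series bounds the sum; the subtracted term
    makes the induction close. *)
Lemma sum_gaussian_weights n :
  \sum_(j < (2 * n).+1) expR (- ((j%:R : R) - n%:R) ^+ 2) <= 3 - 2 * (1 / 2) ^+ n.
Proof.
have weight k : expR (- (k%:R : R) ^+ 2) <= (1 / 2) ^+ k.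
  have e2 : 2 <= expR (1 : R) by have := expR_ge1Dx (1 : R); lra.
  rewrite expRN div1r exprVn lef_pV2 ?posrE ?exprn_gt0 ?expR_gt0//.
  apply: le_trans (_ : expR k%:R <= _).
    by rewrite -[k%:R]mulr1 expRM_natl; apply: lerXn2r; rewrite ?nnegrE//; lra.
  rewrite ler_expR; case: k => [|k]; first by rewrite expr0n.
  by rewrite expr2 ler_peMr// ler1n.
elim: n => [|n IH].
  by rewrite muln0 big_ord1 subrr expr0n oppr0 expR0 expr0; lra.
rewrite (_ : (2 * n.+1).+1 = (2 * n).+3)%N; last by rewrite mulnS.
rewrite big_ord_recl big_ord_recr /=.
have -> : \sum_(i < (2 * n).+1) expR (- ((lift ord0 (widen_ord (leqnSn _) i))%:R - n.+1%:R) ^+ 2)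
   = \sum_(j < (2 * n).+1) expR (- ((j%:R : R) - n%:R) ^+ 2).
  apply: eq_bigr => i _ /=; rewrite /bump /= add1n -!natr1; congr (expR (- _ ^+ 2)); ring.
have := weight n.+1; have -> : (1 / 2) ^+ n.+1 = (1 / 2) * (1 / 2) ^+ n :> R by rewrite exprS.
have -> : (0%:R - n.+1%:R) ^+ 2 = n.+1%:R ^+ 2 :> R by rewrite sub0r sqrrN.
have -> : ((bump 0 (2 * n).+1)%:R - n.+1%:R) ^+ 2 = n.+1%:R ^+ 2 :> R.
  by congr (_ ^+ 2); rewrite /bump/= add1n -!natr1 natrM; ring.
lra.
Qed.

(** Exponential counting: on the points counted, the integer coordinates have squared sum at most 81
    p, so exp (81 p) times the product of the weights exp (- j^2) is at least 1. Summed over the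
    whole grid the product factorizes, each factor being at most 3. *)
Lemma card_grid_le p : (0 < p)%N ->
  \sum_(f : {ffun 'I_p -> 'I_(18 * p).+1} | sqn (grid_point f) <= 81 / 64) 1
    <= expR (81 * p%:R) * 3 ^+ p :> R.
Proof.
case: p => // p _.
pose s : R := Num.sqrt p.+1%:R.
have s2 : s ^+ 2 = p.+1%:R by rewrite sqr_sqrtr.
have s0 : 0 < s by rewrite sqrtr_gt0.
pose h (j : 'I_(18 * p.+1).+1) : R := expR (- ((j%:R : R) - (9 * p.+1)%:R) ^+ 2).
apply: le_trans (_ : \sum_(f : {ffun 'I_p.+1 -> 'I_(18 * p.+1).+1})
    expR (81 * p.+1%:R) * \prod_i h (f i) <= _).
  rewrite [leRHS](bigID (fun f => sqn (grid_point f) <= 81 / 64))/=.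
  rewrite -[leLHS]addr0 lerD//; last first.
    by apply: sumr_ge0 => f _; rewrite mulr_ge0 ?expR_ge0// prodr_ge0// => i _; exact: expR_ge0.
  apply: ler_sum => f hf; rewrite -expR_sum -expRD -[leLHS]expR0 ler_expR.
  have : sqn (grid_point f) = (\sum_i ((f i)%:R - (9 * p.+1)%:R) ^+ 2) / (64 * p.+1%:R).
    rewrite /sqn mulr_suml; apply: eq_bigr => i _; rewrite mxE -/s -[X in 64 * X]s2.
    by field; rewrite gt_eqF.
  move: hf => /[swap] ->; rewrite ler_pdivrMr ?mulr_gt0// sumrN; lra.
rewrite -mulr_sumr ler_wpM2l ?expR_ge0// -(bigA_distr_bigA (fun _ j => h j))/=.
rewrite prodr_const card_ord; apply: lerXn2r; rewrite ?nnegrE//.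
  by apply: sumr_ge0 => i _; exact: expR_ge0.
have := sum_gaussian_weights (9 * p.+1); rewrite mulnA.
have : 0 <= 2 * (1 / 2) ^+ (9 * p.+1) :> R by rewrite mulr_ge0// exprn_ge0.
rewrite /h; lra.
Qed.

End SquaredNorm.

(** * Concentration of the quadratic form, uniform over all vectors *)

Definition iid_gauss_mx {R : realType} {d} {T : measurableType d}
    (P : probability T R) q p (E : T -> 'M[R]_(q, p)) : Prop :=
  iid_gauss P (fun w (k : 'I_q * 'I_p) => E w k.1 k.2).

Section QuadraticConcentration.
Context {R : realType} {d} {T : measurableType d} (P : probability T R).

(** Gives (1 - t)^(-1/2) <= exp ((t + t^2) / 2). With u = t + t^2, the bound exp u >= 1 + u suffices
    for t <= 0, as (1 + u) (1 - t) = 1 - t^3; for t >= 0 it falls short and exp u >= (1 + u / 2)^2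
    is used. *)
Lemma exp_sub_sqr_le (t : R) : `|t| <= 1 / 4 -> expR (- (t + t ^+ 2)) <= 1 - t.
Proof.
rewrite ler_norml => /andP[t1 t2]; set u := t + t ^+ 2.
rewrite expRN -[leRHS]invrK lef_pV2 ?posrE ?expR_gt0 ?invr_gt0//; last lra.
rewrite -div1r ler_pdivrMr; last lra.
have [t0|t0] := leP 0 t.
  have h : (1 + u / 2) ^+ 2 <= expR u.
    rewrite [in leRHS](splitr u) expRD -expr2; apply: lerXn2r; rewrite ?nnegrE ?expR_ge0//.
      by rewrite /u; have := sqr_ge0 t; lra.
    exact: expR_ge1Dx.
  apply: le_trans (_ : (1 + u / 2) ^+ 2 * (1 - t) <= _); last first.
    by rewrite ler_wpM2r//; lra.
  have -> : (1 + u / 2) ^+ 2 * (1 - t) =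
    1 + t ^+ 2 * (1 / 4 - 3 / 4 * t - 1 / 4 * t ^+ 2 - 1 / 4 * (t * t ^+ 2)).
    by rewrite /u; field.
  have tt : t ^+ 2 <= 1 / 16 by rewrite expr2; nra.
  rewrite lerDl mulr_ge0 ?sqr_ge0//.
  have : t * t ^+ 2 <= 1 / 64 by have := sqr_ge0 t; nra.
  lra.
apply: le_trans (_ : (1 + u) * (1 - t) <= _); last first.
  by rewrite ler_wpM2r ?expR_ge1Dx//; lra.
have -> : (1 + u) * (1 - t) = 1 - t * t ^+ 2 by rewrite /u; ring.
by have := sqr_ge0 t; nra.
Qed.

Lemma sum_row (I J : finType) (F : I * J -> R) r :
  \sum_(k <- enum {: I * J} | k.1 == r) F k = \sum_j F (r, j).
Proof.
rewrite big_enum_cond/=.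
rewrite (eq_bigl (fun k : I * J => (k.1 == r) && true)); last first.
  by move=> k; rewrite andbT.
rewrite (eq_bigr (fun k => F (k.1, k.2))); last by case.
by rewrite -(pair_big (pred1 r) predT (fun i j => F (i, j)))/= big_pred1_eq.
Qed.

Lemma measurable_sqn q p (S : 'M[R]_(q, p)) (E : T -> 'M[R]_(q, p)) (z : 'cV[R]_p) :
  (forall i j, measurable_fun setT (fun w => E w i j)) ->
  measurable_fun setT (fun w => sqn ((S + E w) *m z)).
Proof.
move=> mE; apply: measurable_sum_cond => i; apply: measurable_funX.
rewrite (_ : (fun _ => _) = fun w => \sum_j (S i j + E w i j) * z j 0).
  apply: measurable_sum_cond => j; apply: measurable_funM => //.
  exact: measurable_funD.
by apply/funext => w; rewrite mxE; apply: eq_bigr => j _; rewrite mxE.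
Qed.

(** The row identity is applied with the same tilt in every row and c = S z. The terms linear in
    [theta] cancel against the centering and only a multiple of theta^2 remains, as for a
    sub-exponential variable. *)
Lemma integral_exp_quadratic_le q p (S : 'M[R]_(q, p)) (E : T -> 'M[R]_(q, p))
    (theta : R) (z : 'cV[R]_p) : iid_gauss_mx P E ->
  `|2 * theta * sqn z| <= 1 / 4 ->
  (\int[P]_w (expR (theta * (sqn ((S + E w) *m z) - q%:R * sqn z - sqn (S *m z))))%:E
   <= (expR (theta ^+ 2 * sqn z * (2 * q%:R * sqn z + 3 * sqn (S *m z))))%:E)%E.
Proof.
move=> iidE tz; have mE i j : measurable_fun setT (fun w => E w i j).
  exact: iidE.1 (i, j).
set t := 2 * theta * sqn z in tz; set C := sqn (S *m z).
have /andP[t1 t2] : - (1 / 4) <= t <= 1 / 4 by rewrite -ler_norml.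
have main := @integral_exp_row_quadratic _ _ _ _ _ _ _
  (fun k => k.1) (fun k => z k.2 0) iidE (enum {: 'I_q * 'I_p}) (fun=> theta)
  (fun r => (S *m z) r 0) (enum_uniq _).
have Zr r : \sum_(k <- enum {: 'I_q * 'I_p} | k.1 == r) z k.2 0 ^+ 2 = sqn z.
  by rewrite sum_row.
have {}main := main _.
have hlt : forall r : 'I_q, 2 * theta *
    (\sum_(k <- enum {: 'I_q * 'I_p} | k.1 == r) z k.2 0 ^+ 2) < 1.
  by move=> r; rewrite Zr -/t; lra.
move: main => /(_ hlt) /= main.
pose k := - theta * (q%:R * sqn z + C).
have -> : (\int[P]_w (expR (theta * (sqn ((S + E w) *m z) - q%:R * sqn z - C)))%:E =
    \int[P]_w ((expR k)%:E * (expR (\sum_r theta *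
    ((S *m z) r 0 + \sum_(i <- enum {: 'I_q * 'I_p} | i.1 == r)
       z i.2 0 * E w i.1 i.2) ^+ 2))%:E))%E.
  apply: eq_integral => w _; rewrite -EFinM -expRD; congr (expR _)%:E.
  rewrite -mulr_sumr /k.
  have -> : \sum_r ((S *m z) r 0 + \sum_(i <- enum {: 'I_q * 'I_p} | i.1 == r)
       z i.2 0 * E w i.1 i.2) ^+ 2 = sqn ((S + E w) *m z).
    apply: eq_bigr => r _; congr (_ ^+ 2).
    rewrite (sum_row (fun i => z i.2 0 * E w i.1 i.2)) !mxE -big_split/=.
    by apply: eq_bigr => j _; rewrite !mxE; ring.
  ring.
rewrite ge0_integralZl ?lee_fin ?expR_ge0//; last first.
  apply/measurable_EFinP; apply: measurableT_comp => //.
  apply: measurable_sum_cond => r; apply: measurable_funM => //.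
  apply: measurable_funX; apply: measurable_funD => //.
  by apply: measurable_sum_cond => i; apply: measurable_funM.
rewrite main -EFinM lee_fin.
pose b r := (t + t ^+ 2) / 2 + (theta + 3 * theta ^+ 2 * sqn z) * (S *m z) r 0 ^+ 2.
apply: le_trans (_ : expR k * \prod_r expR (b r) <= _).
  rewrite ler_wpM2l ?expR_ge0//; apply: ler_prod => r _; rewrite Zr -/t.
  rewrite mulr_ge0 ?expR_ge0 ?invr_ge0 ?sqrtr_ge0//= /b expRD.
  apply: ler_pM; rewrite ?expR_ge0 ?invr_ge0 ?sqrtr_ge0//.
    have s0 : 0 < Num.sqrt (1 - t) by rewrite sqrtr_gt0; lra.
    rewrite -[leRHS]invrK -expRN lef_pV2 ?posrE ?expR_gt0//.
    rewrite -[leLHS](ger0_norm (expR_ge0 _)) -sqrtr_sqr ler_wsqrtr// -expRM_natl.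
    rewrite (_ : 2%:R * _ = - (t + t ^+ 2)); last by field.
    exact: exp_sub_sqr_le.
  rewrite ler_expR mulrAC ler_wpM2r ?sqr_ge0//.
  rewrite ler_pdivrMr; last lra.
  have -> : (theta + 3 * theta ^+ 2 * sqn z) * (1 - t) =
    theta + theta ^+ 2 * sqn z * (1 - 3 * t) by rewrite /t; ring.
  have t3 : 0 <= 1 - 3 * t by lra.
  by rewrite lerDl; apply: mulr_ge0 => //; apply: mulr_ge0; rewrite ?sqr_ge0 ?sqn_ge0.
rewrite -expR_sum -expRD ler_expR.
have -> : \sum_r b r = q%:R * ((t + t ^+ 2) / 2) + (theta + 3 * theta ^+ 2 * sqn z) * C.
  rewrite big_split/=; congr (_ + _); last by rewrite -mulr_sumr.
  by rewrite sumr_const card_ord [RHS]mulr_natl.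
by rewrite /k /t le_eqVlt; apply/orP; left; apply/eqP; field.
Qed.

(** 85 p is the logarithmic cost of the union bound; 32 is the factor 2 lost in the net times the 16
    in [theta]. *)
Definition concentration_bound q p (S : 'M[R]_(q, p)) : R :=
  85 * 32 * (Num.sqrt p%:R * (Num.sqrt q%:R + Num.sqrt (frob2 S))).

(** [U] is the sum of exp (theta Q) and exp (- theta Q) over the grid, rescaled to mean at most 1.
    Every grid value then obeys |theta Q| <= 85 p + ln (1 + U), so one random variable controls all
    vectors at once, in mean as well as in the tail. *)
Theorem quadratic_concentration q p (S : 'M[R]_(q, p)) (E : T -> 'M[R]_(q, p)) :
  (0 < p)%N -> (p <= q)%N -> iid_gauss_mx P E ->
  exists U : T -> R, [/\ measurable_fun setT U, forall w, 0 <= U w,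
    (\int[P]_w (U w)%:E <= 1)%E &
    forall w v, `|sqn ((S + E w) *m v) - q%:R * sqn v - sqn (S *m v)| <=
      concentration_bound S * (1 + ln (1 + U w) / p%:R) * sqn v].
Proof.
move=> p0 pq iidE.
have mE i j : measurable_fun setT (fun w => E w i j) by exact: iidE.1 (i, j).
pose sp : R := Num.sqrt p%:R; pose sq : R := Num.sqrt q%:R.
pose sS : R := Num.sqrt (frob2 S).
have pR : 1 <= p%:R :> R by rewrite ler1n.
have qR : p%:R <= q%:R :> R by rewrite ler_nat.
have sp2 : sp ^+ 2 = p%:R by rewrite sqr_sqrtr//; lra.
have sq2 : sq ^+ 2 = q%:R by rewrite sqr_sqrtr//; lra.
have sS2 : sS ^+ 2 = frob2 S by rewrite sqr_sqrtr// frob2_ge0.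
have sp1 : 1 <= sp by rewrite -sqrtr1 ler_sqrt//; lra.
have spq : sp <= sq by rewrite ler_sqrt//; lra.
have sS0 : 0 <= sS by exact: sqrtr_ge0.
pose rho := sq + sS.
have rho0 : 0 < rho by rewrite /rho; lra.
(* With theta rho = sqrt p / 16 the exponent of the moment bound stays below p at the grid points
   counted, and theta <= 1/16 keeps the tilt in the range of that bound. *)
pose theta := sp / (16 * rho).
have th0 : 0 < theta by rewrite /theta divr_gt0//; lra.
have th1 : theta <= 1 / 16.
  by rewrite /theta ler_pdivrMr; [rewrite /rho; lra|lra].
have thr : theta * rho = sp / 16 by rewrite /theta; field; rewrite gt_eqF.
pose Q w v := sqn ((S + E w) *m v) - q%:R * sqn v - sqn (S *m v).
pose small (f : {ffun 'I_p -> 'I_(18 * p).+1}) := sqn (grid_point f : 'cV[R]_p) <= 81 / 64.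
pose W w := \sum_(f | small f) (expR (theta * Q w (grid_point f)) +
                               expR (- theta * Q w (grid_point f))).
(* 85 = 81 + 2 + 1 + 1: the two factors of [card_grid_le], with 3 <= e^2, then the moment bound e^p
   and the two signs, with 2 <= e^p. *)
pose a : R := expR (- (85 * p%:R)).
have mQ v : measurable_fun setT (Q ^~ v).
  apply: measurable_funB => //; apply: measurable_funB => //.
  exact: measurable_sqn.
have mterm (s : R) v : measurable_fun setT (fun w => expR (s * Q w v)).
  by apply: measurableT_comp => //; apply: measurable_funM.
have mW : measurable_fun setT W.
  by apply: measurable_sum_cond => f; apply: measurable_funD.
have W0 w : 0 <= W w by apply: sumr_ge0 => f _; rewrite addr_ge0// expR_ge0.
have mgf s v : `|s| = theta -> sqn v <= 81 / 64 ->
    (\int[P]_w (expR (s * Q w v))%:E <= (expR p%:R)%:E)%E.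
  move=> hs hv; have v0 := sqn_ge0 v.
  apply: le_trans (integral_exp_quadratic_le S iidE _) _.
    by rewrite -mulrA normrM normrM hs !ger0_norm//; nra.
  rewrite lee_fin ler_expR -[s ^+ 2]real_normK ?num_real// hs.
  have h1 := sqn_mulmx_le S v; have h2 := frob2_ge0 S.
  apply: le_trans (_ : theta ^+ 2 * sqn v * (3 * (rho ^+ 2 * sqn v)) <= _).
    rewrite ler_wpM2l//; first exact: mulr_ge0 (sqr_ge0 _) v0.
    have : (sq ^+ 2 + sS ^+ 2) * sqn v <= rho ^+ 2 * sqn v.
      rewrite ler_wpM2r// /rho; have : 0 <= sq * sS by rewrite mulr_ge0//; lra.
      by rewrite sqrrD; lra.
    rewrite sq2 sS2; have : 0 <= q%:R * sqn v by rewrite mulr_ge0//; lra.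
    lra.
  have -> : theta ^+ 2 * sqn v * (3 * (rho ^+ 2 * sqn v)) = 3 * (theta * rho) ^+ 2 * sqn v ^+ 2.
    by ring.
  rewrite thr exprMn sp2.
  have : sqn v ^+ 2 <= (81 / 64) ^+ 2 by apply: lerXn2r; rewrite ?nnegrE//; lra.
  have : 0 <= sqn v ^+ 2 by exact: sqr_ge0.
  nra.
exists (fun w => a * W w); split.
- by apply: measurable_funM.
- by move=> w; rewrite mulr_ge0 ?expR_ge0.
- under eq_integral do rewrite EFinM.
  rewrite ge0_integralZl ?lee_fin ?expR_ge0//; last 2 first.
    exact/measurable_EFinP.
    by move=> w _; rewrite lee_fin.
  have -> : (\int[P]_w (W w)%:E = \sum_(f | small f)
      (\int[P]_w (expR (theta * Q w (grid_point f)) +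
                               expR (- theta * Q w (grid_point f)))%:E))%E.
    under eq_integral do rewrite /W -sumEFin -big_filter.
    rewrite ge0_integral_sum ?big_filter//.
    by move=> f; apply/measurable_EFinP; apply: measurable_funD.
  apply: le_trans (_ : a%:E * (\sum_(f | small f) (2 * expR p%:R)%:E) <= _)%E.
    rewrite lee_wpmul2l ?lee_fin ?expR_ge0//; apply: lee_sum => f hf.
    under eq_integral do rewrite EFinD.
    rewrite ge0_integralD//; try by [move=> w _; rewrite lee_fin expR_ge0 | apply/measurable_EFinP].
    rewrite mulrDl mul1r EFinD; apply: leeD; apply: mgf => //.
      by rewrite ger0_norm// ltW.
    by rewrite normrN ger0_norm// ltW.
  rewrite sumEFin -EFinM lee_fin.
  rewrite (_ : \sum_(f | small f) (2 * expR p%:R) =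
    (2 * expR p%:R) * \sum_(f | small f) 1); last by rewrite mulr_sumr; apply: eq_bigr => f _; rewrite mulr1.
  have e2 : 2 <= expR (1 : R) by have := expR_ge1Dx (1 : R); lra.
  have ep : expR (p%:R : R) = expR 1 ^+ p by rewrite -expRM_natl mulr1.
  have c2 : 2 <= expR (p%:R : R).
    by apply: le_trans e2 _; rewrite ler_expR.
  have c3 : 3 ^+ p <= expR (p%:R : R) * expR (p%:R : R).
    by rewrite ep -exprMn; apply: lerXn2r; rewrite ?nnegrE// ?mulr_ge0//; nra.
  have := @card_grid_le R p p0; set X := \sum_(f | _) 1 => hX.
  have hX' : X <= expR (81 * p%:R) * (expR (p%:R : R) * expR (p%:R : R)).
    by apply: le_trans hX _; rewrite ler_wpM2l ?expR_ge0.
  have X0 : 0 <= X by apply: sumr_ge0.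
  apply: le_trans (_ : a * (expR p%:R * expR p%:R * (expR (81 * p%:R) * (expR (p%:R : R) * expR (p%:R : R)))) <= _).
    rewrite ler_wpM2l ?expR_ge0// ler_pM// ?mulr_ge0 ?expR_ge0//.
    by rewrite ler_wpM2r ?expR_ge0.
  by rewrite /a -!expRD -[leRHS]expR0 ler_expR; lra.
- move=> w v.
  pose L := ln (1 + a * W w).
  have aW0 : 0 <= a * W w by rewrite mulr_ge0 ?expR_ge0.
  have L0 : 0 <= L by rewrite /L ln_ge0//; lra.
  pose m := (85 * p%:R + L) / theta.
  have key : `|Q w v| <= 2 * m * sqn v.
    apply: (@quadratic_form_le_grid _ _ (Q w) (frob2 (S + E w) + q%:R + frob2 S)) => //.
    - apply: polarizedB; last exact: polarized_sqn.
      by apply: polarizedB; [exact: polarized_sqn|exact: polarized_scale_sqn].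
    - by move=> c u; rewrite /Q -!scalemxAr !sqnZ; ring.
    - move=> u; rewrite /Q; have h1 := sqn_mulmx_le S u.
      have h2 := sqn_mulmx_le (S + E w) u.
      have h3 := sqn_ge0 (S *m u); have h4 := sqn_ge0 ((S + E w) *m u).
      have h5 : 0 <= q%:R * sqn u by rewrite mulr_ge0 ?sqn_ge0.
      by rewrite ler_norml; apply/andP; split; lra.
    - move=> f hf; rewrite /m ler_pdivlMr// mulrC.
      set y := grid_point f in hf *.
      have expW s : `|s| = theta -> expR (s * Q w y) <= W w.
        move=> hs; rewrite /W (bigD1 f)//= -/y.
        have h0 : 0 <= \sum_(i | small i && (i != f)) (expR (theta * Q w (grid_point i)) +
                               expR (- theta * Q w (grid_point i))).
          by apply: sumr_ge0 => i _; rewrite addr_ge0// expR_ge0.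
        have := expR_ge0 (theta * Q w y); have := expR_ge0 (- theta * Q w y).
        have [->|->] : s = theta \/ s = - theta.
          by move: hs; case: (ler0P s) => _ <-; [right; rewrite opprK|left].
        + lra.
        + lra.
      have lnW s : `|s| = theta -> s * Q w y <= 85 * p%:R + L.
        move=> /expW h; rewrite -ler_expR expRD /L lnK ?posrE; last lra.
        apply: le_trans h _.
        have {1}-> : W w = expR (85 * p%:R) * (a * W w).
          by rewrite mulrA /a -expRD subrr expR0 mul1r.
        by rewrite ler_wpM2l ?expR_ge0//; lra.
      rewrite -[theta in leLHS](gtr0_norm th0) -normrM ler_norml.
      have := lnW theta (gtr0_norm th0); have := lnW (- theta).
      rewrite normrN gtr0_norm// => /(_ erefl) h1 h2.
      by apply/andP; split; lra.
  apply: le_trans key _; rewrite ler_wpM2r ?sqn_ge0//.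
  rewrite /concentration_bound -/sp -/sq -/sS -/rho.
  have -> : 2 * m = 85 * 32 * (sp * rho) * (1 + L / p%:R / 85).
    rewrite /m /theta -sp2; field.
    by rewrite !gt_eqF//; lra.
  have spr : 0 < sp * rho by exact: mulr_gt0 (lt_le_trans ltr01 sp1) rho0.
  have L1 : 0 <= L / p%:R by exact: divr_ge0.
  have spr0 : 0 <= 85 * 32 * (sp * rho) by move: (sp * rho) spr => y; lra.
  apply: (ler_wpM2l spr0); rewrite lerD2l -/L.
  by move: (L / p%:R) L1 => y; lra.
Qed.

End QuadraticConcentration.

(** * Measurability of the inverse, and a majorant of the inverse square root *)

Lemma measurable_inv {R : realType} : measurable_fun setT (@GRing.inv R).
Proof.
have -> : [set: R] = [set x | x != 0] `|` [set 0].
  by apply/seteqP; split=> x //= _; case: (eqVneq x 0) => ?; [right|left].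
have o0 : open [set x : R | x != 0].
  rewrite (_ : [set _ | _] = ~` [set 0]); first by rewrite openC; exact: closed_eq.
  by apply/seteqP; split=> x /= /eqP.
apply/measurable_funU => //; first exact: open_measurable.
split; last exact: measurable_fun_set1.
apply: open_continuous_measurable_fun => // x; rewrite inE/= => x0.
exact: inv_continuous.
Qed.

Lemma sum_half_le {R : realType} n : \sum_(0 <= k < n) ((1 / 2) ^+ k) <= 2 :> R.
Proof.
suff -> : \sum_(0 <= k < n) ((1 / 2) ^+ k) = 2 - 2 * (1 / 2) ^+ n :> R.
  by rewrite lerBlDr lerDl mulr_ge0 ?exprn_ge0.
elim: n => [|n IH]; first by rewrite big_nil expr0; lra.
by rewrite big_nat_recr//= IH exprS; lra.
Qed.

Definition dyadic_term {R : realType} (k : nat) (x : R) : \bar R :=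
  ((2 ^+ k)%:E * (\1_[set y : R | (`|y| <= (1 / 4) ^+ k)%R] x)%:E)%E.

(* A substitute for [x |-> |x|^(-1/2)] with value [+oo] at 0. *)
Definition inv_sqrt_majorant {R : realType} (x : R) : \bar R :=
  (1 + \sum_(0 <= k <oo) dyadic_term k x)%E.

Section InvSqrtMajorant.
Context {R : realType}.
Implicit Types x w r : R.

Let term_ge0 k x : (0 <= dyadic_term k x)%E.
Proof. by rewrite /dyadic_term -EFinM lee_fin mulr_ge0// exprn_ge0. Qed.

Lemma inv_sqrt_majorant_ge1 x : (1 <= inv_sqrt_majorant x)%E.
Proof.
rewrite /inv_sqrt_majorant leeDl//.
by apply: nneseries_ge0 => k _ _; exact: term_ge0.
Qed.

(** Let k be least with r < 2^k. Then 2^k <= 2 r, so |x| < 1 / (4 r^2) would imply |x| <= 4^(-k),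
    and the term of index k alone would lift the value above r. *)
Lemma inv_sqrt_majorantP x r : (inv_sqrt_majorant x <= r%:E)%E -> 1 / 4 <= r ^+ 2 * `|x|.
Proof.
move=> fr; rewrite leNgt; apply/negP => rx.
have r1 : 1 <= r by rewrite -lee_fin; apply: le_trans fr; exact: inv_sqrt_majorant_ge1.
have ex : exists k, r < 2 ^+ k.
  exists (Num.truncn r).+1; apply: lt_le_trans (_ : (Num.truncn r).+1%:R <= _).
    by have /andP[] := truncn_itv (le_trans ler01 r1).
  by rewrite -natrX ler_nat; exact: ltnW (ltn_expl _ _).
have := ex_minnP ex => -[[|k] hk mink].
  by move: hk; rewrite expr0; lra.
have kr : 2 ^+ k <= r by rewrite leNgt; apply/negP => /mink; rewrite ltnn.
have xk : `|x| <= (1 / 4) ^+ k.+1.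
  have h : (1 / 4) ^+ k.+1 = (((2 : R) ^+ k.+1) ^+ 2)^-1.
    by rewrite -exprM mulnC exprM div1r exprVn; congr ((_ ^+ _)^-1); rewrite expr2; lra.
  rewrite h -[leRHS]mul1r ler_pdivlMr ?exprn_gt0//.
  have h2 : (2 ^+ k.+1) ^+ 2 <= (2 * r) ^+ 2.
    apply: lerXn2r; rewrite ?nnegrE ?exprn_ge0//; first lra.
    by rewrite exprS ler_pM2l.
  have := ler_wpM2l (normr_ge0 x) h2; rewrite exprMn; lra.
have : ((1 + 2 ^+ k.+1)%:E <= r%:E)%E.
  apply: le_trans fr; rewrite /inv_sqrt_majorant EFinD leeD2l//.
  apply: le_trans (nneseries_lim_ge k.+2 _); last by move=> n _ _; exact: term_ge0.
  rewrite big_nat_recr//=; rewrite -[leLHS]add0e; apply: leeD.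
    by apply: sume_ge0 => i _; exact: term_ge0.
  by rewrite /dyadic_term indicE mem_set//= mule1.
by rewrite lee_fin; lra.
Qed.

Let mterm k : measurable_fun setT (@dyadic_term R k).
Proof.
apply: emeasurable_funM => //; apply/measurable_EFinP; apply: measurable_indic.
rewrite (_ : [set _ | _] = `[- (1 / 4) ^+ k, (1 / 4) ^+ k]%classic); first exact: measurable_itv.
by apply/seteqP; split => x /=; rewrite in_itv/= ler_norml.
Qed.

Lemma measurable_inv_sqrt_majorant : measurable_fun setT (@inv_sqrt_majorant R).
Proof.
apply: emeasurable_funD => //; apply: ge0_emeasurable_sum => [k x _ _|k _].
  exact: term_ge0.
exact: mterm.
Qed.

(** The term of index k contributes at most 2^k 4^(-k), wherever its interval is centered; 3 = 1 + 2
    sums the geometric series. *)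
Lemma integral_inv_sqrt_majorant_le w :
  (\int[gauss]_y inv_sqrt_majorant (y - w) <= 3%:E)%E.
Proof.
have mB : measurable_fun setT (fun y : R => y - w) by exact: measurable_funB.
have mser : measurable_fun setT (fun x : R => \sum_(0 <= k <oo) dyadic_term k x)%E.
  by apply: ge0_emeasurable_sum => [k x _ _|k _]; [exact: term_ge0|exact: mterm].
rewrite /inv_sqrt_majorant ge0_integralD//; last 2 first.
- by move=> y _; apply: nneseries_ge0 => k _ _; exact: term_ge0.
- exact: (measurableT_comp mser mB).
have -> : (\int[gauss]_(_ in [set: R]) (1 : \bar R) = 1)%E.
  rewrite (_ : (fun _ => 1%E) = cst 1%:E)// integral_cst// mul1e.
  exact: (@probability_setT _ _ _ gauss).
rewrite (_ : 3%:E = (1 + 2%:E)%E); last first.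
  by rewrite -EFinD; congr EFin; lra.
rewrite leeD2l// integral_nneseries//; last first.
  by move=> k; exact: (measurableT_comp (mterm k) mB).
apply: lime_le.
  by apply: is_cvg_nneseries => k _ _; apply: integral_ge0 => y _; exact: term_ge0.
apply: nearW => n; apply: le_trans (_ : (\sum_(0 <= k < n) ((1 / 2) ^+ k))%:E <= _)%E; last first.
  by rewrite lee_fin sum_half_le.
rewrite -sumEFin; apply: lee_sum => k _.
have mi : measurable_fun setT (fun y : R =>
    (\1_[set y : R | `|y| <= (1 / 4) ^+ k] (y - w))%:E : \bar R).
  apply/measurable_EFinP; apply: (measurableT_comp _ mB); apply: measurable_indic.
  rewrite (_ : [set _ | _] = `[- (1 / 4) ^+ k, (1 / 4) ^+ k]%classic); first exact: measurable_itv.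
  by apply/seteqP; split => x /=; rewrite in_itv/= ler_norml.
rewrite /dyadic_term ge0_integralZl// ?lee_fin ?exprn_ge0//.
have mI : measurable [set y : R | `|y - w| <= (1 / 4) ^+ k].
  rewrite (_ : [set _ | _] = `[(w - (1 / 4) ^+ k)%R, (w + (1 / 4) ^+ k)%R]%classic); first exact: measurable_itv.
  by apply/seteqP; split => y /=; rewrite in_itv/= ler_distl.
have -> : (\int[gauss]_y (\1_[set y : R | (`|y| <= (1 / 4) ^+ k)%R] (y - w))%:E =
   gauss [set y : R | (`|y - w| <= (1 / 4) ^+ k)%R])%E.
  rewrite -[in RHS](setIT [set y : R | _]) -integral_indic//.
apply: le_trans (_ : (2 ^+ k)%:E * ((1 / 4) ^+ k)%:E <= _)%E.
  rewrite lee_wpmul2l ?lee_fin ?exprn_ge0//.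
  by apply: normal_interval_le; rewrite exprn_ge0//; lra.
by rewrite -EFinM -exprMn lee_fin; rewrite (_ : 2 * (1 / 4) = 1 / 2)//; lra.
Qed.

End InvSqrtMajorant.

(** * Distance of a 2 x 2 block from the rank one matrices *)

Section RankOneBlocks.
Context {R : realType}.

(** The gap times d is the determinant of the block. The rank one condition expresses it through the
    deviations, linearly with coefficients at most |d| plus quadratic terms. If the norm f of the
    deviations is at most 2 |d|, division by d gives 3 f; otherwise the gap is at most 2 |d| < f
    anyway. *)
Let core (a b c d al be ga de : R) : `|a| <= `|d| -> `|b| <= `|d| -> `|c| <= `|d| ->
  (a - al) * (d - de) = (b - be) * (c - ga) ->
  (a - b * c / d) ^+ 2 <= 9 * (al ^+ 2 + be ^+ 2 + ga ^+ 2 + de ^+ 2).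
Proof.
move=> ad bd cd rk; set S := al ^+ 2 + be ^+ 2 + ga ^+ 2 + de ^+ 2.
have S0 : 0 <= S by rewrite /S !addr_ge0 ?sqr_ge0.
have [d0|d0] := eqVneq d 0.
  rewrite d0 invr0 mulr0 subr0; move: ad; rewrite d0 normr0 normr_le0 => /eqP ->.
  by rewrite expr0n/=; lra.
pose f := Num.sqrt S; have f2 : f ^+ 2 = S by rewrite sqr_sqrtr.
have f0 : 0 <= f by exact: sqrtr_ge0.
have dp : 0 < `|d| by rewrite normr_gt0.
set x := a - b * c / d.
have xd : x * d = a * de + d * al - al * de - b * ga - c * be + be * ga.
  have -> : x * d = a * d - b * c by rewrite /x; field.
  lra.
suff : `|x| <= 3 * f.
  move=> h; rewrite -real_normK ?num_real// -f2.
  have : `|x| ^+ 2 <= (3 * f) ^+ 2 by apply: lerXn2r; rewrite ?nnegrE//; lra.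
  by rewrite exprMn; lra.
have [fd|fd] := leP f (2 * `|d|); last first.
  have : `|x| <= `|a| + `|b| * `|c| / `|d|.
    by rewrite /x; apply: le_trans (ler_normB _ _) _; rewrite !normrM normfV.
  have : `|b| * `|c| / `|d| <= `|d|.
    rewrite ler_pdivrMr//; apply: ler_pM => //.
  lra.
rewrite -(ler_pM2r dp) -normrM xd.
have h1 : `|a * de + d * al - al * de - b * ga - c * be + be * ga| <=
  `|d| * (`|al| + `|be| + `|ga| + `|de|) + (`|al| * `|de| + `|be| * `|ga|).
  have pr u v : `|u| <= `|d| -> - (`|d| * `|v|) <= u * v <= `|d| * `|v|.
    by move=> ud; rewrite -ler_norml normrM ler_wpM2r.
  have nn (u v : R) : - (`|u| * `|v|) <= u * v <= `|u| * `|v|.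
    by rewrite -ler_norml normrM.
  have := pr a de ad; have := pr d al (lexx _); have := pr b ga bd; have := pr c be cd.
  have := nn al de; have := nn be ga.
  move=> /andP[? ?] /andP[? ?] /andP[? ?] /andP[? ?] /andP[? ?] /andP[? ?].
  by rewrite ler_norml; apply/andP; split; lra.
apply: le_trans h1 _.
have sq (u : R) : `|u| ^+ 2 = u ^+ 2 by rewrite real_normK ?num_real.
have h2 : `|al| + `|be| + `|ga| + `|de| <= 2 * f.
  rewrite -(@ler_sqr _ (_ + _)) ?nnegrE ?addr_ge0//; last by rewrite mulr_ge0.
  rewrite exprMn f2 /S -(sq al) -(sq be) -(sq ga) -(sq de).
  have := sqr_ge0 (`|al| - `|be|); have := sqr_ge0 (`|al| - `|ga|).
  have := sqr_ge0 (`|al| - `|de|); have := sqr_ge0 (`|be| - `|ga|).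
  have := sqr_ge0 (`|be| - `|de|); have := sqr_ge0 (`|ga| - `|de|).
  nra.
have h3 : `|al| * `|de| + `|be| * `|ga| <= f ^+ 2 / 2.
  rewrite f2 /S -(sq al) -(sq be) -(sq ga) -(sq de).
  have := sqr_ge0 (`|al| - `|de|); have := sqr_ge0 (`|be| - `|ga|); nra.
nra.
Qed.

(** Signed distance of the first entry from the value that makes the block singular; for d = 0 the
    convention 1 / 0 = 0 makes it a itself. Given the other entries it is a translate of a, which is
    what lets a be integrated out. *)
Definition block_gap (a b c d : R) : R := a - b * c / d.

(** The entry of largest modulus is the pivot; [core] then bounds the gap of the diagonally opposite
    entry. *)
Lemma block_gap_le_dist (a b c d al be ga de : R) :
  (a - al) * (d - de) = (b - be) * (c - ga) ->
  let S := al ^+ 2 + be ^+ 2 + ga ^+ 2 + de ^+ 2 in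
  [\/ block_gap a b c d ^+ 2 <= 9 * S, block_gap b a d c ^+ 2 <= 9 * S,
      block_gap c d a b ^+ 2 <= 9 * S | block_gap d c b a ^+ 2 <= 9 * S].
Proof.
move=> rk S; rewrite /block_gap.
have [/andP[ad /andP[bd cd]]|h1] := boolP [&& `|a| <= `|d|, `|b| <= `|d| & `|c| <= `|d|].
  by constructor 1; exact: core.
have [/andP[ad /andP[bd cd]]|h2] := boolP [&& `|b| <= `|c|, `|a| <= `|c| & `|d| <= `|c|].
  constructor 2; have := @core b a d c be al de ga ad bd cd.
  by rewrite /S; move=> h; apply: le_trans (h _) _; lra.
have [/andP[ad /andP[bd cd]]|h3] := boolP [&& `|c| <= `|b|, `|d| <= `|b| & `|a| <= `|b|].
  constructor 3; have := @core c d a b ga de al be ad bd cd.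
  by rewrite /S; move=> h; apply: le_trans (h _) _; lra.
have [/andP[ad /andP[bd cd]]|h4] := boolP [&& `|d| <= `|a|, `|c| <= `|a| & `|b| <= `|a|].
  constructor 4; have := @core d c b a de ga be al ad bd cd.
  by rewrite /S; move=> h; apply: le_trans (h _) _; lra.
move: h1 h2 h3 h4; rewrite !negb_and -!ltNge.
by move=> /or3P[] ? /or3P[] ? /or3P[] ? /or3P[] ?; lra.
Qed.

End RankOneBlocks.

(** * A small-ball estimate for residuals of rank one fits *)

Section SmallBall.
Context {R : realType} {d} {T : measurableType d} (P : probability T R).

(** Given the other three entries the gap is a normal variable minus a constant, so integrating that
    one entry gives a bound free of the signal. *)
Lemma integral_block_gap_le (I : finType) (x : T -> I -> R) (s : I -> R) i j k l :
  iid_gauss P x -> j != i -> k != i -> l != i ->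
  (\int[P]_w inv_sqrt_majorant (block_gap (s i + x w i) (s j + x w j)
     (s k + x w k) (s l + x w l)) <= 3%:E)%E.
Proof.
move=> iidx ji ki li.
pose F (u : famT R I) : \bar R := inv_sqrt_majorant (block_gap (s i + u i) (s j + u j)
     (s k + u k) (s l + u l)).
have mF : measurable_fun setT F.
  apply: (measurableT_comp measurable_inv_sqrt_majorant).
  have mc m : measurable_fun setT (fun u : famT R I => s m + u m).
    by apply: measurable_funD => //; exact: measurable_coord.
  apply: measurable_funB => //; apply: measurable_funM.
    exact: measurable_funM.
  exact: (measurableT_comp measurable_inv).
have F0 u : (0 <= F u)%E by apply: le_trans (inv_sqrt_majorant_ge1 _).
rewrite (_ : integral _ _ _ = \int[P]_w F (x w))%E//.
rewrite (iid_gauss_resample i)//.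
apply: le_trans (_ : \int[P]_w 3%:E <= _)%E; last first.
  by rewrite integral_cst//= probability_setT mule1.
apply: ge0_le_integral => //.
- by move=> w _; apply: integral_ge0 => y _; exact: F0.
- apply: (@measurable_fun_fubini_tonelli_F _ _ _ _ _ gauss
    (fun p : T * R => F (setc i p.2 (x p.1)))) => //.
  apply: (measurableT_comp mF); apply: measurable_to_fam => m; rewrite /setc.
  case: (m == i); first exact: measurable_snd.
  by apply: (measurableT_comp (iidx.1 m)); exact: measurable_fst.
- move=> w _; rewrite /F /setc eqxx (negbTE ji) (negbTE ki) (negbTE li).
  set g := (s j + x w j) * (s k + x w k) / (s l + x w l).
  apply: le_trans (integral_inv_sqrt_majorant_le (g - s i)).
  rewrite le_eqVlt; apply/orP; left; apply/eqP; apply: eq_integral => y _.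
  by rewrite /block_gap -/g; congr inv_sqrt_majorant; ring.
Qed.

(** [ordS] is the cyclic successor. Wrapping around lets every index pair be the corner of a 2 x 2
    block, and each matrix entry occurs exactly four times. *)
Definition flip_ord n (b : bool) (i : 'I_n) : 'I_n := if b then ordS i else i.

Definition block_entry q p (A : 'M[R]_(q, p)) (rc : 'I_q * 'I_p) (e : bool * bool) : R :=
  A (flip_ord e.1 rc.1) (flip_ord e.2 rc.2).

Definition entry_gap q p (A : 'M[R]_(q, p)) (k : ('I_q * 'I_p) * (bool * bool)) : R :=
  let y e1 e2 := block_entry A k.1 (e1, e2) in
  block_gap (y k.2.1 k.2.2) (y k.2.1 (~~ k.2.2)) (y (~~ k.2.1) k.2.2)
    (y (~~ k.2.1) (~~ k.2.2)).

Lemma ordS_neq n (i : 'I_n) : (1 < n)%N -> ordS i != i.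
Proof.
move=> n1; apply/eqP => /(congr1 val) /=.
have := ltn_ord i; rewrite leq_eqVlt => /orP[/eqP h|h].
  by rewrite h modnn => h0; move: h; rewrite -h0 => h; rewrite -h in n1.
by rewrite modn_small// => /eqP; rewrite eqn_leq ltnn.
Qed.

(** 5 - 4 v is the tangent at 1 of the convex function v^(-4), taken at v = psi / mu. *)
Lemma tangent_inv_pow4 (psi mu phi2 : R) : 0 < psi -> 0 < mu -> 1 <= phi2 * psi ^+ 4 ->
  5 - 4 * (psi / mu) <= phi2 * mu ^+ 4.
Proof.
move=> p0 m0 h.
have v0 : 0 < psi / mu by rewrite divr_gt0.
have pE : psi = (psi / mu) * mu by rewrite divfK// gt_eqF.
move: (psi / mu) v0 pE => v v0 pE.
have v4 : 0 < v ^+ 4 by rewrite exprn_gt0.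
rewrite -(ler_pM2r v4).
have -> : phi2 * mu ^+ 4 * v ^+ 4 = phi2 * psi ^+ 4 by rewrite pE; ring.
apply: le_trans h; rewrite -subr_ge0.
have -> : 1 - (5 - 4 * v) * v ^+ 4 = (v - 1) ^+ 2 * (4 * v ^+ 3 + 3 * v ^+ 2 + 2 * v + 1).
  by ring.
apply: mulr_ge0; first exact: sqr_ge0.
have := exprn_gt0 3 v0; have := exprn_gt0 2 v0; lra.
Qed.

Lemma sum_block_entries q p (A : 'M[R]_(q, p)) (e : bool * bool) :
  \sum_rc block_entry A rc e ^+ 2 = frob2 A.
Proof.
rewrite /block_entry /frob2 -(pair_bigA _ (fun r c => A (flip_ord e.1 r) (flip_ord e.2 c) ^+ 2))/=.
have flip_inj n b : injective (@flip_ord n b) by case: b => // i j /ordS_inj.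
rewrite [RHS](reindex_inj (flip_inj _ e.1)); apply: eq_bigr => r _.
by rewrite [RHS](reindex_inj (flip_inj _ e.2)).
Qed.

(** [B] is four times the sum over corners of the majorant, averaged over blocks, hence of mean at
    most 4 * 4 * 3 = 48. If [B w] <= mu, each block is at squared distance at least psi^(-4) from
    rank one, with psi of average at most mu. Convexity of v^(-4) then bounds the total distance
    below, although the blocks overlap and are dependent. *)
Theorem rank_one_residual_small_ball q p (S : 'M[R]_(q, p)) (E : T -> 'M[R]_(q, p)) :
  (1 < q)%N -> (1 < p)%N -> iid_gauss_mx P E ->
  exists B : T -> \bar R, [/\ measurable_fun setT B, forall w, (0 <= B w)%E,
    (\int[P]_w B w <= 48%:E)%E &
    forall w (mu : R) (u : 'cV[R]_q) (v : 'cV[R]_p), (B w <= mu%:E)%E ->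
      0 < mu /\ (q * p)%:R <= 4 * frob2 (S + E w - u *m v^T) * mu ^+ 4].
Proof.
move=> q1 p1 iidE.
pose K := (('I_q * 'I_p) * (bool * bool))%type.
pose c0 : R := 4 / (q * p)%:R.
have q0 : (0 < q)%N := ltnW q1; have p0 : (0 < p)%N := ltnW p1.
have qp0 : 0 < (q * p)%:R :> R by rewrite ltr0n muln_gt0 q0 p0.
have c00 : 0 < c0 by rewrite divr_gt0.
pose f (k : K) w := inv_sqrt_majorant (entry_gap (S + E w) k).
have f1 k w : (1 <= f k w)%E by exact: inv_sqrt_majorant_ge1.
have f0 k w : (0 <= f k w)%E by apply: le_trans (f1 k w).
have mE i j : measurable_fun setT (fun w => E w i j) by exact: iidE.1 (i, j).
have mA i j : measurable_fun setT (fun w => (S + E w) i j).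
  rewrite (_ : (fun _ => _) = fun w => S i j + E w i j); first exact: measurable_funD.
  by apply/funext => w; rewrite mxE.
have mf k : measurable_fun setT (f k).
  apply: (measurableT_comp measurable_inv_sqrt_majorant).
  apply: (@measurable_funB _ _ _ _ (fun w => block_entry (S + E w) k.1 (k.2.1, k.2.2))).
    exact: mA.
  apply: measurable_funM; first by apply: measurable_funM; exact: mA.
  by apply: (measurableT_comp measurable_inv); exact: mA.
have fint k : (\int[P]_w f k w <= 3%:E)%E.
  case: k => -[r c] [e1 e2].
  have nf n (i : 'I_n) b : (1 < n)%N -> flip_ord (~~ b) i != flip_ord b i.
    by move=> n1; case: b; rewrite /flip_ord/= ?ordS_neq// eq_sym ordS_neq.
  have := @integral_block_gap_le _ _ (fun k : 'I_q * 'I_p => S k.1 k.2)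
    (flip_ord e1 r, flip_ord e2 c) (flip_ord e1 r, flip_ord (~~ e2) c)
    (flip_ord (~~ e1) r, flip_ord e2 c) (flip_ord (~~ e1) r, flip_ord (~~ e2) c) iidE.
  rewrite !xpair_eqE !eqxx (negbTE (nf _ _ _ q1)) (negbTE (nf _ _ _ p1)) /=.
  move=> /(_ isT isT isT); apply: le_trans; rewrite le_eqVlt; apply/orP; left; apply/eqP.
  by apply: eq_integral => w _; rewrite /f /entry_gap /block_entry /= !mxE.
exists (fun w => \sum_(k : K) c0%:E * f k w)%E; split.
- by apply: emeasurable_sum => k; exact: emeasurable_funM.
- by move=> w; apply: sume_ge0 => k _; rewrite mule_ge0// lee_fin ltW.
- rewrite ge0_integral_sum//; last 2 first.
    by move=> k; exact: emeasurable_funM.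
    by move=> k w _; rewrite mule_ge0// lee_fin ltW.
  apply: le_trans (_ : \sum_(k : K) (c0 * 3)%:E <= _)%E.
    apply: lee_sum => k _; rewrite ge0_integralZl//; last by rewrite lee_fin ltW.
    by rewrite (EFinM c0 3); apply: lee_wpmul2l; rewrite ?lee_fin ?(ltW c00).
  rewrite sumEFin lee_fin sumr_const !card_prod !card_ord card_bool -mulr_natr /c0.
  rewrite le_eqVlt; apply/orP; left; apply/eqP.
  by rewrite !natrM; field; rewrite !pnatr_eq0 -!lt0n q0 p0.
move=> w mu u v Bmu.
have fk k : f k w = (fine (f k w))%:E.
  rewrite fineK// ge0_fin_numE// ltey; apply/eqP => fy.
  have : (c0%:E * f k w <= mu%:E)%E.
    apply: le_trans Bmu; rewrite (bigD1 k)//= leeDl//.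
    by apply: sume_ge0 => i _; rewrite mule_ge0// lee_fin ltW.
  by rewrite fy gt0_muley ?lte_fin// leye_eq.
pose g k := fine (f k w).
have g1 k : 1 <= g k by rewrite -lee_fin /g -fk.
(* The factor 4 absorbs the constants: gap^2 <= 9 phi2 and g^2 |gap| >= 1/4 yield phi2 (4 g)^4 >=
   256 / 144. *)
pose psi rc := 4 * \sum_(e : bool * bool) g (rc, e).
pose F := S + E w - u *m v^T.
pose phi2 rc := \sum_(e : bool * bool) block_entry F rc e ^+ 2.
have psik rc e : 4 * g (rc, e) <= psi rc.
  rewrite /psi ler_pM2l// (bigD1 e)//= lerDl; apply: sumr_ge0 => i _.
  by have := g1 (rc, i); lra.
have psi0 rc : 0 < psi rc by have := psik rc (true, true); have := g1 (rc, (true, true)); lra.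
have sum_psi : (q * p)%:R^-1 * \sum_rc psi rc <= mu.
  rewrite -lee_fin; apply: le_trans Bmu.
  under [leRHS]eq_bigr do rewrite fk -EFinM.
  have e : \sum_k fine (f k w) = \sum_rc \sum_e g (rc, e).
    by rewrite (pair_bigA _ (fun a b => g (a, b)))/=; apply: eq_bigr => -[a b] _.
  rewrite sumEFin lee_fin.
  have -> : \sum_(k : K) c0 * fine (f k w) = c0 * \sum_rc \sum_e g (rc, e).
    by rewrite -e mulr_sumr.
  rewrite /c0 /psi -mulr_sumr.
  by rewrite le_eqVlt; apply/orP; left; apply/eqP; rewrite mulrA [X in X * _]mulrC.
have sp0 : 0 < \sum_rc psi rc.
  pose rc0 : 'I_q * 'I_p := (Ordinal (ltnW q1), Ordinal (ltnW p1)).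
  rewrite (bigD1 rc0)//= ltr_pwDl// sumr_ge0// => i _; exact: ltW.
have mu0 : 0 < mu by apply: lt_le_trans sum_psi; rewrite mulr_gt0// invr_gt0.
split => //.
have phipsi rc : 1 <= phi2 rc * psi rc ^+ 4.
  have : exists e, entry_gap (S + E w) (rc, e) ^+ 2 <= 9 * phi2 rc.
    case: rc => r c.
    have phiE : phi2 (r, c) = block_entry F (r, c) (false, false) ^+ 2 +
      block_entry F (r, c) (false, true) ^+ 2 + block_entry F (r, c) (true, false) ^+ 2 +
      block_entry F (r, c) (true, true) ^+ 2.
      rewrite /phi2 -(pair_bigA _ (fun a b => block_entry F (r, c) (a, b) ^+ 2))/=.
      by rewrite !big_bool/=; ring.
    rewrite phiE.
    have rk e : block_entry (S + E w) (r, c) e - block_entry F (r, c) e =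
       u (flip_ord e.1 r) 0 * v (flip_ord e.2 c) 0.
      by rewrite /block_entry /F !mxE big_ord1 !mxE; ring.
    have [] := @block_gap_le_dist _ (block_entry (S + E w) (r, c) (false, false))
      (block_entry (S + E w) (r, c) (false, true)) (block_entry (S + E w) (r, c) (true, false))
      (block_entry (S + E w) (r, c) (true, true)) (block_entry F (r, c) (false, false))
      (block_entry F (r, c) (false, true)) (block_entry F (r, c) (true, false))
      (block_entry F (r, c) (true, true)).
    - by rewrite !rk /=; ring.
    - by exists (false, false).
    - by exists (false, true).
    - by exists (true, false).
    - by exists (true, true).
  move=> [e he].
  have hf : 1 / 4 <= g (rc, e) ^+ 2 * `|entry_gap (S + E w) (rc, e)|.
    by apply: inv_sqrt_majorantP; rewrite -/(f (rc, e) w) fk.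
  have g0 : 0 <= g (rc, e) by have := g1 (rc, e); lra.
  have hf2 : (1 / 4) ^+ 2 <= (g (rc, e) ^+ 2 * `|entry_gap (S + E w) (rc, e)|) ^+ 2.
    by apply: lerXn2r; rewrite ?nnegrE ?mulr_ge0 ?exprn_ge0//; lra.
  rewrite [X in _ <= X]exprMn real_normK ?num_real// -exprM in hf2.
  have h4 : (4 * g (rc, e)) ^+ 4 <= psi rc ^+ 4.
    by apply: lerXn2r; rewrite ?nnegrE ?(ltW (psi0 rc))//; move: g0; lra.
  rewrite exprMn in h4.
  have phi0 : 0 <= phi2 rc by apply: sumr_ge0 => i _; exact: sqr_ge0.
  have := ler_wpM2l phi0 h4.
  have gg : 0 <= g (rc, e) ^+ (2 * 2) by rewrite exprn_ge0.
  have := ler_wpM2l gg he.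
  rewrite (_ : (2 * 2)%N = 4%N)// in hf2 gg *.
  have : 0 <= phi2 rc * (g (rc, e) ^+ 4) by rewrite mulr_ge0.
  lra.
(* The tangents sum to at least q p (5 - 4) because psi has average at most mu. *)
have hsum : \sum_rc (5 - 4 * (psi rc / mu)) <= \sum_rc phi2 rc * mu ^+ 4.
  by apply: ler_sum => rc _; exact: tangent_inv_pow4.
have e1 : \sum_rc phi2 rc * mu ^+ 4 = 4 * frob2 F * mu ^+ 4.
  rewrite -mulr_suml exchange_big/=; congr (_ * _).
  under eq_bigr do rewrite sum_block_entries.
  by rewrite sumr_const card_prod card_bool [RHS]mulr_natl.
rewrite -e1; apply: le_trans hsum.
rewrite sumrB -mulr_sumr -mulr_suml sumr_const card_prod !card_ord.
have : (\sum_rc psi rc) / mu <= (q * p)%:R.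
  by rewrite ler_pdivrMr// -ler_pdivrMl.
by rewrite -mulr_natr; lra.
Qed.

End SmallBall.

(** * Reindexing the entries of a matrix *)

Section Reshape.
Context {R : realType}.

Definition inner p q (A B : 'M[R]_(p, q)) : R := \sum_i \sum_j A i j * B i j.

(** One encoding for rearrangements and their transposes: for bijective [h], energies, inner
    products and the law of the noise transfer at once. *)
Definition reshape P Q q p (h : 'I_q * 'I_p -> 'I_P * 'I_Q) (C : 'M[R]_(P, Q)) : 'M[R]_(q, p) :=
  \matrix_(r, c) C (h (r, c)).1 (h (r, c)).2.

Lemma reshapeD P Q q p (h : 'I_q * 'I_p -> 'I_P * 'I_Q) C D :
  reshape h (C + D) = reshape h C + reshape h D.
Proof. by apply/matrixP => i j; rewrite !mxE. Qed.

Lemma reshapeB P Q q p (h : 'I_q * 'I_p -> 'I_P * 'I_Q) C D :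
  reshape h (C - D) = reshape h C - reshape h D.
Proof. by apply/matrixP => i j; rewrite !mxE. Qed.

Lemma reshapeZ P Q q p (h : 'I_q * 'I_p -> 'I_P * 'I_Q) a C :
  reshape h (a *: C) = a *: reshape h C.
Proof. by apply/matrixP => i j; rewrite !mxE. Qed.

Lemma inner_reshape P Q q p (h : 'I_q * 'I_p -> 'I_P * 'I_Q) C D : bijective h ->
  inner (reshape h C) (reshape h D) = inner C D.
Proof.
move=> hb; rewrite /inner (pair_bigA _ (fun i j => C i j * D i j))/=.
rewrite (reindex h) /=; last exact: onW_bij.
rewrite (pair_bigA _ (fun i j => reshape h C i j * reshape h D i j))/=.
by apply: eq_bigr => -[r c] _; rewrite !mxE.
Qed.

Lemma frob2E p q (A : 'M[R]_(p, q)) : frob2 A = inner A A.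
Proof. by apply: eq_bigr => i _; apply: eq_bigr => j _; rewrite expr2. Qed.

Lemma frob2_reshape P Q q p (h : 'I_q * 'I_p -> 'I_P * 'I_Q) C : bijective h ->
  frob2 (reshape h C) = frob2 C.
Proof. by move=> hb; rewrite !frob2E inner_reshape. Qed.

Lemma iid_gauss_reindex {d} {T : measurableType d} (P : probability T R)
    (I K : finType) (x : T -> I -> R) (g : K -> I) :
  bijective g -> iid_gauss P x -> iid_gauss P (fun w k => x w (g k)).
Proof.
move=> [g' gK g'K] [mx xP]; split=> [k|B mB]; first exact: mx.
have := xP (fun i => B (g' i)) (fun i => mB _).
have -> : [set w | forall i, B (g' i) (x w i)] = [set w | forall k, B k (x w (g k))].
  apply/seteqP; split => w /= hw k; first by have := hw (g k); rewrite gK.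
  by have := hw (g' k); rewrite g'K.
move=> ->; rewrite (reindex g); last by exists g' => i _.
by apply: eq_bigr => k _; rewrite gK.
Qed.

Lemma iid_std_normal_gauss {d} {T : measurableType d} (P : probability T R) p q
    (E : T -> 'M[R]_(p, q)) : iid_std_normal P E -> iid_gauss_mx P E.
Proof.
move=> [mE E1 E2]; split=> [[i j]|B mB]; first exact: mE.
have := E2 (fun i j => B (i, j)) (fun i j => mB _).
have -> : [set w | forall i j, B (i, j) (E w i j)] =
   [set w | forall k : 'I_p * 'I_q, B k (E w k.1 k.2)].
  by apply/seteqP; split => w /= hw; [move=> [i j]; exact: hw|move=> i j; exact: (hw (i, j))].
move=> ->; rewrite (pair_bigA _ (fun i j => P ((fun w => E w i j) @^-1` B (i, j))))/=.
by apply: eq_bigr => -[i j] _ /=; rewrite E1.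
Qed.

Lemma iid_gauss_reshape {d} {T : measurableType d} (Pr : probability T R) P Q q p
    (h : 'I_q * 'I_p -> 'I_P * 'I_Q) (E : T -> 'M[R]_(P, Q)) : bijective h ->
  iid_gauss_mx Pr E -> iid_gauss_mx Pr (fun w => reshape h (E w)).
Proof.
move=> hb iidE; have := iid_gauss_reindex hb iidE.
congr iid_gauss; apply/funext => w; apply/funext => -[r c] /=.
by rewrite mxE.
Qed.

Definition swap_index q p (h : 'I_q * 'I_p) : 'I_p * 'I_q := (h.2, h.1).

Lemma reshape_swap P Q q p (h : 'I_q * 'I_p -> 'I_P * 'I_Q) C :
  reshape (h \o @swap_index p q) C = (reshape h C)^T.
Proof. by apply/matrixP => i j; rewrite !mxE. Qed.

Lemma bij_swap P Q q p (h : 'I_q * 'I_p -> 'I_P * 'I_Q) : bijective h ->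
  bijective (h \o @swap_index p q).
Proof.
by move=> hb; apply: bij_comp => //; exists (@swap_index q p) => -[].
Qed.

Lemma divmod_lt a b k : (k < a * b)%N -> (k %/ b < a)%N && (k %% b < b)%N.
Proof.
move=> kab; have b0 : (0 < b)%N by case: b kab => //; rewrite muln0.
by rewrite ltn_divLR// kab ltn_mod.
Qed.

Lemma ltn_divmod a b i j : (i < a -> j < b -> i * b + j < a * b)%N.
Proof.
move=> ia jb; apply: (@leq_trans (i * b + b)%N); first by rewrite ltn_add2l.
by rewrite -mulSnr leq_mul2r ia orbT.
Qed.

Lemma divn_divmod b i j : (j < b -> (i * b + j) %/ b = i)%N.
Proof. by move=> jb; rewrite divnMDl ?divn_small ?addn0//; apply: leq_ltn_trans jb. Qed.

Lemma modn_divmod b i j : (j < b -> (i * b + j) %% b = j)%N.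
Proof. by move=> jb; rewrite modnMDl modn_small. Qed.

Lemma sum_divmod K a b (F : nat -> nat -> R) : K = (a * b)%N ->
  \sum_(r < K) F (r %/ b)%N (r %% b)%N = \sum_(i < a) \sum_(j < b) F i j.
Proof.
move=> ->; rewrite (pair_bigA _ (fun (i : 'I_a) (j : 'I_b) => F i j))/=.
pose g (k : 'I_a * 'I_b) : 'I_(a * b) := Ordinal (ltn_divmod (ltn_ord k.1) (ltn_ord k.2)).
rewrite (reindex g); last first.
  apply: onW_bij; apply: inj_card_bij; last by rewrite card_prod !card_ord.
  move=> [i j] [i' j'] /(congr1 val) /= e.
  have := congr1 (fun k => k %/ b)%N e; have := congr1 (fun k => k %% b)%N e.
  by rewrite /= !modn_divmod// !divn_divmod// => /val_inj -> /val_inj ->.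
by apply: eq_bigr => -[i j] _ /=; rewrite divn_divmod// modn_divmod.
Qed.

End Reshape.

(** * The rearrangement as a bijection of indices *)

Section Rearrangement.
Context {R : realType}.

Lemma getm_ord p q (A : 'M[R]_(p, q)) (i : 'I_p) (j : 'I_q) : getm A i j = A i j.
Proof. by rewrite /getm !valK. Qed.

Lemma getmE p q (A : 'M[R]_(p, q)) i j (ip : (i < p)%N) (jq : (j < q)%N) :
  getm A i j = A (Ordinal ip) (Ordinal jq).
Proof. by rewrite -getm_ord. Qed.

Section Index.
Variables (a b m n : nat).
Hypotheses (ma : (m <= a)%N) (nb : (n <= b)%N).

Let ea : (2 ^ a = 2 ^ m * 2 ^ (a - m))%N. Proof. by rewrite -expnD subnKC. Qed.
Let eb : (2 ^ b = 2 ^ n * 2 ^ (b - n))%N. Proof. by rewrite -expnD subnKC. Qed.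

Lemma expn_rest : (2 ^ (a + b - m - n) = 2 ^ (a - m) * 2 ^ (b - n))%N.
Proof. by rewrite -expnD; congr (2 ^ _)%N; lia. Qed.

Lemma rearr_row_lt (r : 'I_(2 ^ (m + n))) (c : 'I_(2 ^ (a + b - m - n))) :
  (r %/ 2 ^ n * 2 ^ (a - m) + c %/ 2 ^ (b - n) < 2 ^ a)%N.
Proof.
have := ltn_ord r; rewrite [X in (_ < X)%N]expnD => /divmod_lt/andP[h1 _].
have := ltn_ord c; rewrite [X in (_ < X)%N]expn_rest => /divmod_lt/andP[h2 _].
by rewrite ea ltn_divmod.
Qed.

Lemma rearr_col_lt (r : 'I_(2 ^ (m + n))) (c : 'I_(2 ^ (a + b - m - n))) :
  (r %% 2 ^ n * 2 ^ (b - n) + c %% 2 ^ (b - n) < 2 ^ b)%N.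
Proof. by rewrite eb ltn_divmod// ltn_mod expn_gt0. Qed.

Definition rearr_index (rc : 'I_(2 ^ (m + n)) * 'I_(2 ^ (a + b - m - n))) :
  'I_(2 ^ a) * 'I_(2 ^ b) :=
  (Ordinal (rearr_row_lt rc.1 rc.2), Ordinal (rearr_col_lt rc.1 rc.2)).

Lemma rearrE (C : 'M[R]_(2 ^ a, 2 ^ b)) : rearr m n C = reshape rearr_index C.
Proof.
apply/matrixP => r c; rewrite !mxE /rearr_index/=.
by rewrite (getmE C (rearr_row_lt r c) (rearr_col_lt r c)).
Qed.

Lemma rearr_index_bij : bijective rearr_index.
Proof.
apply: inj_card_bij; last first.
  by rewrite !card_prod !card_ord -!expnD leq_exp2l//; lia.
move=> [r c] [r' c'] [] /= e1 e2.
have cl (k : 'I_(2 ^ (a + b - m - n))) : (k %/ 2 ^ (b - n) < 2 ^ (a - m))%N.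
  by have := ltn_ord k; rewrite [X in (_ < X)%N]expn_rest => /divmod_lt/andP[].
have cm (k : nat) : (k %% 2 ^ (b - n) < 2 ^ (b - n))%N by rewrite ltn_mod expn_gt0.
have q1 := congr1 (fun k => k %/ 2 ^ (a - m))%N e1.
have q2 := congr1 (fun k => k %% 2 ^ (a - m))%N e1.
have q3 := congr1 (fun k => k %/ 2 ^ (b - n))%N e2.
have q4 := congr1 (fun k => k %% 2 ^ (b - n))%N e2.
rewrite /= !divn_divmod// in q1; rewrite /= !modn_divmod// in q2.
rewrite /= !divn_divmod// in q3; rewrite /= !modn_divmod// in q4.
congr (_, _); apply: val_inj => /=.
  by rewrite (divn_eq r (2 ^ n)) q1 q3 -divn_eq.
by rewrite (divn_eq c (2 ^ (b - n))) q2 q4 -divn_eq.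
Qed.

Definition vecm p q K (A : 'M[R]_(p, q)) : 'cV[R]_K := \col_k getm A (k %/ q) (k %% q).

(** The reason for rearranging: a Kronecker product becomes a matrix of rank at most one, so the fit
    is a leading singular term. *)
Lemma rearr_kron (A : 'M[R]_(2 ^ m, 2 ^ n)) (B : 'M[R]_(2 ^ (a - m), 2 ^ (b - n))) :
  rearr m n (kron (2 ^ a) (2 ^ b) A B) =
  vecm (2 ^ (m + n)) A *m (vecm (2 ^ (a + b - m - n)) B)^T.
Proof.
apply/matrixP => r c; rewrite rearrE !mxE big_ord1 !mxE /=.
have cl : (c %/ 2 ^ (b - n) < 2 ^ (a - m))%N.
  by have := ltn_ord c; rewrite [X in (_ < X)%N]expn_rest => /divmod_lt/andP[].
have cm : (c %% 2 ^ (b - n) < 2 ^ (b - n))%N by rewrite ltn_mod expn_gt0.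
by rewrite !divn_divmod// !modn_divmod.
Qed.

End Index.

Lemma inner_vecm p q K (A B : 'M[R]_(p, q)) : K = (p * q)%N ->
  \sum_(k < K) vecm K A k 0 * vecm K B k 0 = \tr (A *m B^T).
Proof.
move=> Kpq; under eq_bigr do rewrite !mxE.
rewrite (sum_divmod (fun i j => getm A i j * getm B i j) Kpq) /mxtrace.
apply: eq_bigr => i _; rewrite mxE; apply: eq_bigr => j _.
by rewrite !getm_ord mxE.
Qed.

Lemma vecm_unvec K p q (u : 'cV[R]_K) : K = (p * q)%N ->
  vecm K (\matrix_(i < p, j < q) getm u (i * q + j) 0) = u.
Proof.
move=> Kpq; apply/colP => k; rewrite mxE.
have := ltn_ord k; rewrite [X in (_ < X)%N]Kpq => /divmod_lt/andP[h1 h2].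
by rewrite (getmE _ h1 h2) mxE /= -divn_eq; rewrite (getm_ord u k 0).
Qed.

Lemma inner_outer p q (a1 a2 : 'cV[R]_p) (b1 b2 : 'cV[R]_q) :
  inner (a1 *m b1^T) (a2 *m b2^T) =
  (\sum_i a1 i 0 * a2 i 0) * (\sum_j b1 j 0 * b2 j 0).
Proof.
rewrite /inner mulr_suml; apply: eq_bigr => i _; rewrite mulr_sumr.
by apply: eq_bigr => j _; rewrite !mxE !big_ord1 !mxE; ring.
Qed.

End Rearrangement.

(** * Spectral norm and leading singular pair *)

Section SpectralNorm.
Context {R : realType}.

Definition dot n (u w : 'cV[R]_n) : R := \sum_i u i 0 * w i 0.

Lemma sqn_dot n (u : 'cV[R]_n) : sqn u = dot u u.
Proof. by apply: eq_bigr => i _; rewrite expr2. Qed.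

Lemma dot_sqr_le n (u w : 'cV[R]_n) : dot u w ^+ 2 <= sqn u * sqn w.
Proof. exact: cauchy_schwarz. Qed.

Lemma dotC n (u w : 'cV[R]_n) : dot u w = dot w u.
Proof. by apply: eq_bigr => i _; rewrite mulrC. Qed.

Lemma dot_mxE n (u w : 'cV[R]_n) : dot u w = (u^T *m w) 0 0.
Proof. by rewrite mxE; apply: eq_bigr => i _; rewrite mxE. Qed.

Lemma dot_bilin p q (C : 'M[R]_(p, q)) u v : (u^T *m C *m v) 0 0 = dot u (C *m v).
Proof. by rewrite dot_mxE mulmxA. Qed.

Lemma dot_trmx p q (C : 'M[R]_(p, q)) u v : dot u (C *m v) = dot (C^T *m u) v.
Proof. by rewrite !dot_mxE trmx_mul trmxK mulmxA. Qed.

Lemma sqnD n (u w : 'cV[R]_n) : sqn (u + w) = sqn u + sqn w + 2 * dot u w.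
Proof.
rewrite /sqn /dot mulr_sumr -!big_split; apply: eq_bigr => i _.
by rewrite mxE /=; ring.
Qed.

Lemma sqn_eq0 n (u : 'cV[R]_n) : (sqn u == 0) = (u == 0).
Proof.
apply/eqP/eqP => [|->]; last by apply: big1 => i _; rewrite mxE expr0n.
move/psumr_eq0P => h; apply/colP => i; rewrite mxE.
have := h _ i isT; move=> /(_ (fun j _ => sqr_ge0 _)) /eqP.
by rewrite sqrf_eq0 => /eqP.
Qed.

Lemma vnormE n (v : 'cV[R]_n) : vnorm v = Num.sqrt (sqn v).
Proof. by []. Qed.

Lemma vnorm_sqr n (v : 'cV[R]_n) : vnorm v ^+ 2 = sqn v.
Proof. by rewrite vnormE sqr_sqrtr// sqn_ge0. Qed.

Lemma vnorm_ge0 n (v : 'cV[R]_n) : 0 <= vnorm v.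
Proof. exact: sqrtr_ge0. Qed.

Lemma vnorm_eq1 n (v : 'cV[R]_n) : vnorm v = 1 <-> sqn v = 1.
Proof.
by split=> [h|]; [rewrite -vnorm_sqr h expr1n|rewrite vnormE => ->; exact: sqrtr1].
Qed.

Lemma sqn_normalize n (v : 'cV[R]_n) : v != 0 -> sqn ((vnorm v)^-1 *: v) = 1.
Proof.
by move=> v0; rewrite sqnZ exprVn vnorm_sqr mulVf// sqn_eq0.
Qed.

Definition unit_col n (n0 : (0 < n)%N) : 'cV[R]_n := delta_mx (Ordinal n0) 0.

Lemma sqn_unit_col n (n0 : (0 < n)%N) : sqn (unit_col n0) = 1.
Proof.
rewrite /sqn (bigD1 (Ordinal n0))//= big1 ?addr0.
  by rewrite mxE !eqxx/= expr1n.
by move=> i /negbTE h; rewrite mxE h /= expr0n.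
Qed.

Section Fixed.
Variables (p q : nat) (C : 'M[R]_(p, q)).

Let S := [set vnorm (C *m v) | v in [set v : 'cV[R]_q | vnorm v = 1]].

Let Sub : has_ubound S.
Proof.
exists (Num.sqrt (frob2 C)) => _ [v /= /vnorm_eq1 v1 <-].
by rewrite vnormE ler_wsqrtr//; have := sqn_mulmx_le C v; rewrite v1 mulr1.
Qed.

Lemma vnorm_le_specnorm v : sqn v = 1 -> vnorm (C *m v) <= specnorm C.
Proof.
move=> v1; apply: sup_upper_bound; last by exists v => //=; exact/vnorm_eq1.
by split=> //; exists (vnorm (C *m v)); exists v => //=; exact/vnorm_eq1.
Qed.

Lemma sqn_le_specnorm v : sqn (C *m v) <= specnorm C ^+ 2 * sqn v.
Proof.
have [->|v0] := eqVneq v 0.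
  by rewrite mulmx0 /sqn !big1 ?mulr0// => i _; rewrite mxE expr0n.
have := vnorm_le_specnorm (sqn_normalize v0); rewrite -scalemxAr => h.
have sv0 : 0 < sqn v by rewrite lt_def sqn_eq0 v0 sqn_ge0.
have : vnorm ((vnorm v)^-1 *: (C *m v)) ^+ 2 <= specnorm C ^+ 2.
  by apply: lerXn2r => //; rewrite nnegrE; [exact: vnorm_ge0|exact: le_trans (vnorm_ge0 _) h].
by rewrite vnorm_sqr sqnZ exprVn vnorm_sqr mulrC ler_pdivrMr.
Qed.

Lemma specnorm_ge0 : (0 < q)%N -> 0 <= specnorm C.
Proof. by move=> q0; apply: le_trans (vnorm_le_specnorm (sqn_unit_col q0)); exact: vnorm_ge0. Qed.

Lemma specnorm_le c : (0 < q)%N -> (forall v, sqn v = 1 -> vnorm (C *m v) <= c) -> specnorm C <= c.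
Proof.
move=> q0 h; apply: ge_sup.
  exists (vnorm (C *m unit_col q0)); exists (unit_col q0) => //=.
  by apply/vnorm_eq1; exact: sqn_unit_col.
by move=> _ [v /= /vnorm_eq1 v1 <-]; exact: h.
Qed.

Lemma dot_le_specnorm u v : (0 < q)%N -> sqn u = 1 -> sqn v = 1 -> dot u (C *m v) ^+ 2 <= specnorm C ^+ 2.
Proof.
move=> q0 u1 v1; apply: le_trans (dot_sqr_le _ _) _; rewrite u1 mul1r -vnorm_sqr.
by apply: lerXn2r; rewrite ?nnegrE ?vnorm_ge0 ?specnorm_ge0// vnorm_le_specnorm.
Qed.

(** A maximizer is what makes [lead_pair] a genuine singular pair instead of the default value; it
    exists because the unit sphere is compact. *)
Lemma specnorm_attained : (0 < q)%N -> exists2 v : 'cV[R]_q, sqn v = 1 & vnorm (C *m v) = specnorm C.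
Proof.
move=> q0.
have contsum (n : nat) (F : 'I_n -> 'rV[R]_q -> R) :
    (forall i, continuous (F i)) -> continuous (fun v => \sum_i F i v).
  move=> cF; elim: (index_enum _) => [|i s IH].
    rewrite (_ : (fun _ => _) = cst 0); first exact: cst_continuous.
    by apply/funext => v; rewrite big_nil.
  rewrite (_ : (fun _ => _) = (F i) \+ (fun v => \sum_(i <- s) F i v)).
    by move=> v; exact: (@continuousD _ R^o _ _ _ _ (cF i v) (IH v)).
  by apply/funext => v; rewrite big_cons.
have contsq (f : 'rV[R]_q -> R) : continuous f -> continuous (fun v => f v ^+ 2).
  move=> cf; rewrite (_ : (fun _ => _) = (fun v => f v * f v)).
    by move=> v; exact: (continuousM (cf v) (cf v)).
  by apply/funext => v; rewrite expr2.
have c1 : continuous (fun v : 'rV[R]_q => sqn v^T).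
  apply: (contsum _ _ _) => i; apply: (contsq _ _).
  by rewrite (_ : (fun _ => _) = (fun v : 'rV[R]_q => v 0 i)); [exact: coord_continuous|apply/funext => v; rewrite mxE].
have c2 : continuous (fun v : 'rV[R]_q => sqn (C *m v^T)).
  apply: (contsum _ _ _) => i; apply: (contsq _ _).
  rewrite (_ : (fun _ => _) = (fun v : 'rV[R]_q => \sum_j C i j * v 0 j)); last first.
    by apply/funext => v; rewrite mxE; apply: eq_bigr => j _; rewrite mxE.
  apply: (contsum _ _ _) => j v.
  exact: (continuousM (@cst_continuous _ _ (C i j) v) (@coord_continuous _ _ _ 0 j v)).
pose A := [set v : 'rV[R]_q | sqn v^T = 1].
have clA : closed A.
  have c1' : closed [set x : R | x = 1] by exact: closed_eq.
  exact: ((continuous_closedP _).1 c1 _ c1').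
have cA : compact A.
  have cB := @rV_compact R q (fun=> `[(-1 : R), 1]%classic) (fun=> @segment_compact R _ _).
  refine (subclosed_compact clA cB _).
  move=> v /= v1 i; rewrite /= in_itv/= -ler_norml.
  rewrite -(@ler_sqr _ _ 1) ?nnegrE// expr1n real_normK ?num_real// -v1.
  by rewrite /sqn (bigD1 i)//= mxE lerDl sumr_ge0// => j _; exact: sqr_ge0.
have A0 : A !=set0 by exists (unit_col q0)^T; rewrite /A /= trmxK sqn_unit_col.
have [c /set_mem cinA cmax] := EVT_max_rV A0 cA (continuous_subspaceT c2).
exists c^T => //; apply: le_anti; rewrite vnorm_le_specnorm//=.
apply: specnorm_le => // v v1; rewrite !vnormE ler_wsqrtr//.
by have := cmax v^T; rewrite trmxK; apply; rewrite inE /A /= trmxK.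
Qed.

Lemma lead_pairP : (0 < p)%N -> (0 < q)%N -> is_leading_pair C (lead_pair C).
Proof.
move=> p0 q0; have [v v1 vC] := specnorm_attained q0.
suff [uv h] : exists uv, is_leading_pair C uv by apply: xgetPex; exists uv.
(* If the image of the maximizer vanishes, the spectral norm is 0 and any unit vector serves on the
   left. *)
have [w0|w0] := eqVneq (C *m v) 0.
  exists (unit_col p0, v); split => /=; [apply/vnorm_eq1; exact: sqn_unit_col|exact/vnorm_eq1|].
  rewrite dot_bilin -vC w0 vnormE.
  have -> : sqn (0 : 'cV[R]_p) = 0 by apply/eqP; rewrite sqn_eq0.
  by rewrite sqrtr0 /dot big1// => i _; rewrite [X in _ * X]mxE mulr0.
exists ((vnorm (C *m v))^-1 *: (C *m v), v); split => /=.
- by apply/vnorm_eq1; exact: sqn_normalize.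
- exact/vnorm_eq1.
- rewrite dot_bilin -vC /dot.
  rewrite (eq_bigr (fun i => (vnorm (C *m v))^-1 * ((C *m v) i 0 ^+ 2))); last first.
    by move=> i _; rewrite [in LHS]mxE -mulrA -expr2.
  rewrite -mulr_sumr -/(sqn (C *m v)) -vnorm_sqr expr2 mulrA mulVf ?mul1r//.
  by rewrite vnormE sqrtr_eq0 -ltNge lt_def sqn_eq0 w0 sqn_ge0.
Qed.

End Fixed.

Lemma frob2_sub_outer p q (C : 'M[R]_(p, q)) (l : R) u v : sqn u = 1 -> sqn v = 1 ->
  frob2 (C - l *: (u *m v^T)) = frob2 C - 2 * l * dot u (C *m v) + l ^+ 2.
Proof.
move=> u1 v1.
have e1 : \sum_i \sum_j u i 0 ^+ 2 * v j 0 ^+ 2 = 1.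
  by rewrite -[RHS]mul1r -{1}u1 -v1 mulr_suml; apply: eq_bigr => i _; rewrite mulr_sumr.
have e2 : \sum_i \sum_j (u i 0 * v j 0) * C i j = dot u (C *m v).
  by apply: eq_bigr => i _; rewrite mxE mulr_sumr; apply: eq_bigr => j _; ring.
have e1' : \sum_i \sum_j l ^+ 2 * (u i 0 ^+ 2 * v j 0 ^+ 2) = l ^+ 2.
  by under eq_bigr do rewrite -mulr_sumr; rewrite -mulr_sumr e1 mulr1.
have e2' : \sum_i \sum_j 2 * l * ((u i 0 * v j 0) * C i j) = 2 * l * dot u (C *m v).
  by rewrite -e2 mulr_sumr; apply: eq_bigr => i _; rewrite mulr_sumr.
rewrite -e2' -[in RHS]e1' /frob2 -sumrB -big_split/=.
apply: eq_bigr => i _; rewrite -sumrB -big_split/=; apply: eq_bigr => j _.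
by rewrite !mxE big_ord1 !mxE; ring.
Qed.

(** The squared norm of C^T w is the inner product of w with C C^T w; Cauchy-Schwarz and the bound
    for C give the bound for the transpose. *)
Lemma specnorm_trmx p q (C : 'M[R]_(p, q)) w : (0 < q)%N ->
  sqn (C^T *m w) <= specnorm C ^+ 2 * sqn w.
Proof.
move=> q0; set y := C^T *m w.
have h : sqn y = dot w (C *m y) by rewrite dot_trmx sqn_dot.
have [y0|y0] := eqVneq (sqn y) 0.
  by rewrite y0 mulr_ge0 ?sqr_ge0 ?sqn_ge0.
have yp : 0 < sqn y by rewrite lt_def y0 sqn_ge0.
have := dot_sqr_le w (C *m y); rewrite -h => h2.
have h3 : sqn y ^+ 2 <= sqn w * (specnorm C ^+ 2 * sqn y).
  by apply: le_trans h2 _; rewrite ler_wpM2l ?sqn_ge0 ?sqn_le_specnorm.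
by rewrite -(ler_pM2r yp) -expr2; apply: le_trans h3 _; rewrite mulrA [sqn w * _]mulrC.
Qed.

(** Expanding the square, the cross term is at most xi times the product of the two norms, and the
    sign conditions allow phi1 and phi2 to bound these. *)
Lemma two_term_signal_le r c (R1 R2 : 'M[R]_(r, c)) (l1 l2 phi1 phi2 xi : R) v :
  0 <= l1 -> 0 <= l2 -> 0 <= phi1 -> 0 <= phi2 -> 0 <= xi ->
  (forall u, sqn (R1 *m u) <= phi1 ^+ 2 * sqn u) ->
  (forall u, sqn (R2 *m u) <= phi2 ^+ 2 * sqn u) ->
  cosTheta R1 R2 <= xi ->
  sqn ((l1 *: R1 + l2 *: R2) *m v) <=
  (l1 ^+ 2 * phi1 ^+ 2 + l2 ^+ 2 * phi2 ^+ 2 + 2 * l1 * l2 * phi1 * phi2 * xi) * sqn v.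
Proof.
move=> l10 l20 p10 p20 xi0 h1 h2 hc.
have hdot : dot (R1 *m v) (R2 *m v) <= xi * (vnorm (R1 *m v) * vnorm (R2 *m v)).
  (* Vanishing images are excluded from the supremum in [cosTheta], but there the inner product is
     0. *)
  have [z1|z1] := eqVneq (R1 *m v) 0.
    rewrite z1 /dot big1; last by move=> i _; rewrite mxE mul0r.
    by rewrite !mulr_ge0 ?vnorm_ge0.
  have [z2|z2] := eqVneq (R2 *m v) 0.
    rewrite z2 /dot big1; last by move=> i _; rewrite [X in _ * X]mxE mulr0.
    by rewrite !mulr_ge0 ?vnorm_ge0.
  have n0 (w : 'cV[R]_r) : w != 0 -> 0 < vnorm w.
    by move=> w0; rewrite vnormE sqrtr_gt0 lt_def sqn_eq0 w0 sqn_ge0.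
  rewrite -ler_pdivrMr ?mulr_gt0 ?n0//; apply: le_trans hc.
  set S := (X in _ <= sup X); have : S (dot (R1 *m v) (R2 *m v) / (vnorm (R1 *m v) * vnorm (R2 *m v))).
    by exists v, v; split => //; rewrite dot_mxE trmx_mul !mulmxA.
  move=> hS; apply: sup_upper_bound => //; split; first by eexists; exact: hS.
  (* The supremum dominates its members once the set is bounded; Cauchy-Schwarz gives the bound
     1. *)
  exists 1 => _ [u1 [u2 [y1 y2 ->]]].
  rewrite ler_pdivrMr ?mulr_gt0 ?n0// mul1r.
  rewrite -[leRHS]ger0_norm ?mulr_ge0 ?vnorm_ge0// -[leRHS]sqrtr_sqr.
  apply: le_trans (ler_norm _) _; rewrite -sqrtr_sqr ler_wsqrtr// exprMn !vnorm_sqr.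
  by have := dot_sqr_le (R1 *m u1) (R2 *m u2); rewrite dot_mxE trmx_mul !mulmxA.
have hv (i : 'M[R]_(r, c)) ph : 0 <= ph -> sqn (i *m v) <= ph ^+ 2 * sqn v -> vnorm (i *m v) <= ph * vnorm v.
  move=> ph0 hs; rewrite -(@ler_sqr _ (vnorm _)) ?nnegrE ?mulr_ge0 ?vnorm_ge0//.
  by rewrite exprMn !vnorm_sqr.
have hp : vnorm (R1 *m v) * vnorm (R2 *m v) <= phi1 * phi2 * sqn v.
  apply: le_trans (_ : (phi1 * vnorm v) * (phi2 * vnorm v) <= _).
    by apply: ler_pM; rewrite ?vnorm_ge0// hv.
  by rewrite le_eqVlt; apply/orP; left; apply/eqP; rewrite -vnorm_sqr; ring.
rewrite mulmxDl -!scalemxAl sqnD !sqnZ.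
have -> : dot (l1 *: (R1 *m v)) (l2 *: (R2 *m v)) = l1 * l2 * dot (R1 *m v) (R2 *m v).
  by rewrite /dot mulr_sumr; apply: eq_bigr => i _; rewrite !mxE; ring.
have ll : 0 <= l1 * l2 by rewrite mulr_ge0.
have k1 := ler_wpM2l (sqr_ge0 l1) (h1 v); have k2 := ler_wpM2l (sqr_ge0 l2) (h2 v).
have k3 := ler_wpM2l ll (le_trans hdot (ler_wpM2l xi0 hp)).
lra.
Qed.

End SpectralNorm.

(** * Measurability of the spectral norm *)

Section MeasurableSpecnorm.
Context {R : realType}.

Lemma vnormD n (a b : 'cV[R]_n) : vnorm (a + b) <= vnorm a + vnorm b.
Proof.
have h : dot a b <= vnorm a * vnorm b.
  rewrite -[leRHS]ger0_norm ?mulr_ge0 ?vnorm_ge0// -sqrtr_sqr.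
  apply: le_trans (ler_norm _) _; rewrite -sqrtr_sqr ler_wsqrtr//.
  by rewrite exprMn !vnorm_sqr dot_sqr_le.
rewrite -(@ler_sqr _ (vnorm _)) ?nnegrE ?addr_ge0 ?vnorm_ge0//.
by rewrite sqrrD !vnorm_sqr sqnD -mulr_natr; lra.
Qed.

Lemma vnormN n (a : 'cV[R]_n) : vnorm (- a) = vnorm a.
Proof. by rewrite !vnormE; congr Num.sqrt; apply: eq_bigr => i _; rewrite mxE sqrrN. Qed.

Definition int_col q (z : {ffun 'I_q -> int}) : 'cV[R]_q := \col_i (z i)%:~R.

(** The inequality is homogeneous and rescaled integer columns are dense. They form a countable
    family, which is what measurability of [specnorm] rests on. *)
Lemma specnorm_le_int p q (C : 'M[R]_(p, q)) c : (0 < q)%N -> 0 <= c ->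
  (forall z, sqn (C *m int_col z) <= c ^+ 2 * sqn (int_col z)) -> specnorm C <= c.
Proof.
move=> q0 c0 hz; apply: specnorm_le => // v v1; rewrite leNgt; apply/negP => hc.
pose F := Num.sqrt (frob2 C); pose K := (c + F) * Num.sqrt q%:R.
have F0 : 0 <= F by exact: sqrtr_ge0.
have K0 : 0 <= K by rewrite mulr_ge0 ?sqrtr_ge0 ?addr_ge0.
set g := vnorm (C *m v) - c; have g0 : 0 < g by rewrite subr_gt0.
(* Rounding [v] to mesh 1 / n costs at most K / n, which is below the excess [g]. *)
pose n := (Num.truncn (K / g)).+1.
have nK : K / g < n%:R by have /andP[] := truncn_itv (divr_ge0 K0 (ltW g0)).
have n0 : 0 < n%:R :> R by rewrite ltr0n.
pose z : {ffun 'I_q -> int} := [ffun i => Num.floor (n%:R * v i 0)].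
pose y := n%:R^-1 *: int_col z.
have vy : sqn (v - y) <= (Num.sqrt q%:R / n%:R) ^+ 2.
  rewrite exprMn sqr_sqrtr// /sqn -[q in q%:R]card_ord -sum1_card natr_sum mulr_suml.
  apply: ler_sum => i _; rewrite !mxE ffunE mul1r.
  have /andP[h1 h2] := floor_itv (n%:R * v i 0).
  have -> : v i 0 - n%:R^-1 * (Num.floor (n%:R * v i 0))%:~R =
     (n%:R * v i 0 - (Num.floor (n%:R * v i 0))%:~R) / n%:R by field; rewrite gt_eqF.
  rewrite exprMn ler_piMl ?sqr_ge0//; rewrite intrD1 in h2.
  by rewrite expr_le1//; move: h1 h2; lra.
have vy' : vnorm (v - y) <= Num.sqrt q%:R / n%:R.
  have b0 : 0 <= Num.sqrt q%:R / n%:R := divr_ge0 (sqrtr_ge0 _) (ltW n0).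
  by rewrite -(@ler_sqr _ (vnorm _)) ?nnegrE ?vnorm_ge0// vnorm_sqr.
have hy : vnorm (C *m y) <= c * vnorm y.
  rewrite -(@ler_sqr _ (vnorm _)) ?nnegrE ?mulr_ge0 ?vnorm_ge0// exprMn !vnorm_sqr.
  by rewrite /y -scalemxAr !sqnZ mulrCA ler_wpM2l ?sqr_ge0.
have hr : vnorm (C *m (v - y)) <= F * vnorm (v - y).
  rewrite -(@ler_sqr _ (vnorm _)) ?nnegrE ?mulr_ge0 ?vnorm_ge0// exprMn !vnorm_sqr.
  by rewrite sqr_sqrtr ?frob2_ge0// sqn_mulmx_le.
have h1 : vnorm (C *m v) <= vnorm (C *m y) + vnorm (C *m (v - y)).
  have e : v = y + (v - y) by rewrite addrC subrK.
  by rewrite {1}e mulmxDr; exact: vnormD.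
have h2 : vnorm y <= 1 + vnorm (v - y).
  have e : y = v + (- (v - y)) by rewrite opprB addrC subrK.
  rewrite {1}e; apply: le_trans (vnormD _ _) _; by rewrite (vnorm_eq1 v).2// lerD2l vnormN.
have : vnorm (C *m v) <= c + K / n%:R.
  apply: le_trans h1 _; have := ler_wpM2l c0 h2; have := ler_wpM2l c0 vy'.
  have := ler_wpM2l F0 vy'; rewrite /K; move: hy hr.
  rewrite [(c + F) * _ / _]mulrAC -mulrA mulrDl; lra.
apply/negP; rewrite -ltNge -ltrBrDl -/g.
by move: nK; rewrite !ltr_pdivrMr// mulrC.
Qed.

Lemma measurable_specnorm {d} {T : measurableType d} p q (C : T -> 'M[R]_(p, q)) :
  (0 < q)%N -> (forall i j, measurable_fun setT (fun w => C w i j)) ->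
  measurable_fun setT (fun w => specnorm (C w)).
Proof.
move=> q0 mC; have msq (v : 'cV[R]_q) : measurable_fun setT (fun w => sqn (C w *m v)).
  by have := measurable_sqn 0 v mC; under eq_fun do rewrite add0r.
apply: (measurability _ (RGenOInfty.measurableE R)) => // _ [_ [c ->] <-]; rewrite setTI.
have [c0|c0] := ltP c 0.
  rewrite (_ : _ @^-1` _ = setT)//; apply/seteqP; split => w //= _.
  by rewrite in_itv/= andbT; apply: lt_le_trans c0 _; exact: specnorm_ge0.
rewrite (_ : _ @^-1` _ = \bigcup_(z : {ffun 'I_q -> int})
    [set w | c ^+ 2 * sqn (int_col z) < sqn (C w *m int_col z)]); last first.
  apply/seteqP; split => w /=; rewrite in_itv/= andbT.
    move=> h; apply: contrapT => hn; move: h; rewrite ltNge => /negP; apply.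
    apply: specnorm_le_int => // z; rewrite leNgt; apply/negP => hz.
    by apply: hn; exists z.
  move=> [z _ /= hz]; rewrite ltNge; apply/negP => hc; move: hz; rewrite ltNge => /negP; apply.
  apply: le_trans (sqn_le_specnorm _ _) _; rewrite ler_wpM2r ?sqn_ge0//.
  by apply: lerXn2r => //; rewrite nnegrE; exact: specnorm_ge0.
apply: countable_bigcupT_measurable; first exact: countableP.
move=> z; rewrite -[X in measurable X]setTI.
rewrite (_ : [set w | _] = (fun w => sqn (C w *m int_col z)) @^-1` `]c ^+ 2 * sqn (int_col z), +oo[).
  exact: msq.
by apply/seteqP; split => w /=; rewrite in_itv/= andbT.
Qed.

End MeasurableSpecnorm.

(** * Residual and unfolding of a configuration *)

Section Configurations.
Context {R : realType}.

Section Fit.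
Variables (M N m n : nat).
Hypotheses (mM : (m <= M)%N) (nN : (n <= N)%N).
Local Notation h := (rearr_index mM nN).

Lemma rearr_fit (Y : 'M[R]_(2 ^ M, 2 ^ N)) :
  rearr m n (fit m n Y) = specnorm (rearr m n Y) *:
    ((lead_pair (rearr m n Y)).1 *m (lead_pair (rearr m n Y)).2^T).
Proof.
rewrite /fit rearrE reshapeZ -rearrE rearr_kron// !vecm_unvec ?expnD//.
exact: expn_rest.
Qed.

(** The coefficient of the fit equals the bilinear form at the leading pair, so the squared distance
    loses exactly the squared spectral norm. *)
Lemma fit_residual (Y : 'M[R]_(2 ^ M, 2 ^ N)) : exists u v,
  [/\ sqn u = 1, sqn v = 1,
      dot u (reshape h Y *m v) = specnorm (rearr m n Y),
      frob2 (Y - fit m n Y) = frob2 Y - specnorm (rearr m n Y) ^+ 2 &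
      reshape h (Y - fit m n Y) = reshape h Y - specnorm (rearr m n Y) *: (u *m v^T)].
Proof.
set C := rearr m n Y.
have [] := lead_pairP C; rewrite ?expn_gt0//.
set u := (lead_pair C).1; set v := (lead_pair C).2.
move=> /vnorm_eq1 u1 /vnorm_eq1 v1; rewrite dot_bilin => uv.
have hC : C = reshape h Y by rewrite /C rearrE.
have hr : reshape h (Y - fit m n Y) = reshape h Y - specnorm C *: (u *m v^T).
  by rewrite reshapeB -!rearrE rearr_fit.
exists u, v; split => //; first by rewrite -hC.
rewrite -(frob2_reshape _ (rearr_index_bij mM nN)) hr frob2_sub_outer//.
rewrite -hC uv hC (frob2_reshape _ (rearr_index_bij mM nN)) -hC; ring.
Qed.

Lemma fit_residual_tr (Y : 'M[R]_(2 ^ M, 2 ^ N)) :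
  let h' := h \o @swap_index _ _ in exists u v,
  [/\ sqn u = 1, sqn v = 1,
      dot u (reshape h' Y *m v) = specnorm (rearr m n Y),
      frob2 (Y - fit m n Y) = frob2 Y - specnorm (rearr m n Y) ^+ 2 &
      reshape h' (Y - fit m n Y) = reshape h' Y - specnorm (rearr m n Y) *: (u *m v^T)].
Proof.
move=> h'; have [u [v [u1 v1 uv e1 e2]]] := fit_residual Y.
exists v, u; split => //; first by rewrite reshape_swap dot_trmx trmxK dotC.
rewrite !reshape_swap e2; apply/matrixP => i j; rewrite !mxE !big_ord1 !mxE.
by congr (_ - _ * _); rewrite mulrC.
Qed.

End Fit.

Lemma phiW_ge0 M N m0 n0 (X : 'M[R]_(2 ^ M, 2 ^ N)) : 0 <= phiW m0 n0 X.
Proof. by rewrite /phiW; apply: bigmax_ge_id. Qed.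

Lemma specnorm_le_phiW M N m0 n0 m n (X : 'M[R]_(2 ^ M, 2 ^ N)) :
  inW M N m0 n0 m n -> specnorm (rearr m n X) <= phiW m0 n0 X.
Proof.
move=> mnW; have /andP[/and4P[mM nN _ _] _] := mnW.
rewrite -ltnS in mM; rewrite -ltnS in nN.
apply: (bigmax_sup (Ordinal mM)) => //; apply: (bigmax_sup (Ordinal nN)) => //=.
by rewrite mnW.
Qed.

(* [q x p] unfolding of a configuration, transposed if necessary so that [p <= q]. *)
Lemma configuration_unfolding M N m0 n0 m n (X1 X2 : 'M[R]_(2 ^ M, 2 ^ N)) (l1 l2 xi : R) :
  0 <= l1 -> 0 <= l2 -> 0 <= xi -> inW M N m0 n0 m n ->
  (inWA M N m0 n0 m n -> cosTheta (rearr m n X1) (rearr m n X2) <= xi) ->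
  (inWB M N m0 n0 m n -> cosTheta (rearrT m n X1) (rearrT m n X2) <= xi) ->
  exists q p (h : 'I_q * 'I_p -> 'I_(2 ^ M) * 'I_(2 ^ N)),
    [/\ bijective h, (p <= q)%N, (1 < p)%N, (q * p)%N = (2 ^ (M + N))%N &
     [/\ (p + q)%N = (2 ^ (m + n) + 2 ^ (M + N - m - n))%N,
     forall Y : 'M[R]_(2 ^ M, 2 ^ N), exists (l : R) (u : 'cV[R]_q) (v : 'cV[R]_p), [/\ sqn u = 1, sqn v = 1,
        dot u (reshape h Y *m v) = l,
        frob2 (Y - fit m n Y) = frob2 Y - l ^+ 2 &
        reshape h (Y - fit m n Y) = reshape h Y - l *: (u *m v^T)] &
     forall v : 'cV[R]_p, sqn (reshape h (l1 *: X1 + l2 *: X2) *m v) <=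
       (l1 ^+ 2 * phiW m0 n0 X1 ^+ 2 + l2 ^+ 2 * phiW m0 n0 X2 ^+ 2
        + 2 * l1 * l2 * phiW m0 n0 X1 * phiW m0 n0 X2 * xi) * sqn v]].
Proof.
move=> l10 l20 xi0 mnW hA hB; have /andP[/and4P[mM nN n00 nMN] _] := mnW.
have mn1 : (1 < 2 ^ (m + n))%N.
  by rewrite -[1%N]/(2 ^ 0)%N ltn_exp2l// lt0n addn_eq0.
have mn2 : (1 < 2 ^ (M + N - m - n))%N.
  rewrite -[1%N]/(2 ^ 0)%N ltn_exp2l// -subnDA subn_gt0 ltn_neqAle leq_add// andbT.
  by apply: contra nMN => /eqP e; apply/andP; split; apply/eqP; lia.
have card : (2 ^ (m + n) * 2 ^ (M + N - m - n) = 2 ^ (M + N))%N.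
  by rewrite -expnD; congr (2 ^ _)%N; lia.
have hbij := rearr_index_bij mM nN.
have sp (X : 'M[R]_(2 ^ M, 2 ^ N)) : 0 <= specnorm (rearr m n X).
  by apply: specnorm_ge0; rewrite expn_gt0.
have phi (X : 'M[R]_(2 ^ M, 2 ^ N)) u : sqn (rearr m n X *m u) <= phiW m0 n0 X ^+ 2 * sqn u.
  apply: le_trans (sqn_le_specnorm _ _) _; rewrite ler_wpM2r ?sqn_ge0//.
  by apply: lerXn2r; rewrite ?nnegrE ?phiW_ge0// specnorm_le_phiW.
have phiT (X : 'M[R]_(2 ^ M, 2 ^ N)) u : sqn ((rearr m n X)^T *m u) <= phiW m0 n0 X ^+ 2 * sqn u.
  apply: le_trans (specnorm_trmx _ _ _) _; rewrite ?expn_gt0// ler_wpM2r ?sqn_ge0//.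
  by apply: lerXn2r; rewrite ?nnegrE ?phiW_ge0// specnorm_le_phiW.
(* The case split is that of the angle condition: in either case it concerns the column spaces of
   the unfolding whose columns are the longer vectors. *)
have [hle|hlt] := leqP ((M - m) + (N - n)) (m + n).
  exists (2 ^ (m + n))%N, (2 ^ (M + N - m - n))%N, (rearr_index mM nN).
  split => //; first by rewrite leq_exp2l//; lia.
  split; first exact: addnC.
    move=> Y; have [u [v H]] := fit_residual mM nN Y.
    by exists (specnorm (rearr m n Y)), u, v.
  move=> v; rewrite reshapeD !reshapeZ -!rearrE.
  apply: two_term_signal_le; rewrite ?phiW_ge0//.
  by apply: hA; rewrite /inWA mnW.
exists (2 ^ (M + N - m - n))%N, (2 ^ (m + n))%N, (rearr_index mM nN \o @swap_index _ _).
split => //; [exact: bij_swap| by rewrite leq_exp2l//; lia| by rewrite mulnC|].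
split => //.
  move=> Y; have [u [v H]] := fit_residual_tr mM nN Y.
  by exists (specnorm (rearr m n Y)), u, v.
move=> v; rewrite reshapeD !reshapeZ !reshape_swap -!rearrE.
apply: two_term_signal_le; rewrite ?phiW_ge0//.
by apply: hB; rewrite /inWB mnW.
Qed.

End Configurations.

(** * Logarithmic inequalities for the residual *)

Section LogBounds.
Context {R : realType}.
Implicit Types u mu a x : R.

Lemma ln_le_sub1 x : 0 < x -> ln x <= x - 1.
Proof.
by move=> x0; have := @le_ln1Dx R (x - 1); rewrite subrKC; apply; lra.
Qed.

Lemma ln1D_ge0 u : 0 <= u -> 0 <= ln (1 + u).
Proof. by move=> u0; rewrite ln_ge0// lerDl. Qed.

(** Products of logarithms are bounded through their squares; a square that is linear in the
    variable has a mean controlled by that of the variable. The reason is 1 + u <= (1 + sqrt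
    u)^2. *)
Lemma ln1D_sqr_le u : 0 <= u -> ln (1 + u) ^+ 2 <= 4 * u.
Proof.
move=> u0; pose y := Num.sqrt u.
have y0 : 0 <= y by exact: sqrtr_ge0.
have yu : y ^+ 2 = u by rewrite sqr_sqrtr.
have h : ln (1 + u) <= 2 * y.
  apply: le_trans (_ : ln ((1 + y) ^+ 2) <= _).
    by rewrite ler_ln ?posrE ?exprn_gt0//; [rewrite -yu sqrrD expr1n; lra|lra|lra].
  rewrite lnXn; last lra.
  by rewrite -[leLHS]mulr_natl ler_pM2l// le_ln1Dx//; lra.
have : ln (1 + u) ^+ 2 <= (2 * y) ^+ 2.
  by apply: lerXn2r; rewrite ?nnegrE ?ln1D_ge0//; lra.
by rewrite exprMn yu; lra.
Qed.

(** Three uses of 1 + z^2 <= (1 + z)^2 give 1 + 4 mu^4 <= (1 + 2 sqrt mu)^8. *)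
Lemma ln_pow4_sqr_le mu : 0 <= mu -> ln (1 + 4 * mu ^+ 4) ^+ 2 <= 256 * mu.
Proof.
move=> mu0; pose y := 2 * Num.sqrt mu.
have y0 : 0 <= y by rewrite mulr_ge0 ?sqrtr_ge0.
have ymu : y ^+ 2 = 4 * mu by rewrite exprMn sqr_sqrtr// expr2; lra.
have sq (z : R) : 0 <= z -> 1 + z ^+ 2 <= (1 + z) ^+ 2 by move=> z0; rewrite sqrrD expr1n; lra.
have m4 : 0 <= mu ^+ 4 by exact: exprn_ge0.
have h : ln (1 + 4 * mu ^+ 4) <= 8 * y.
  apply: le_trans (_ : ln ((1 + y) ^+ 8) <= _); last first.
    rewrite lnXn; last lra.
    by rewrite -[leLHS]mulr_natl ler_pM2l// le_ln1Dx//; lra.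
  have h1 := sq _ y0; have h2 := sq _ (sqr_ge0 y); have h3 := sq _ (sqr_ge0 (y ^+ 2)).
  rewrite ler_ln ?posrE ?exprn_gt0//; [|lra|lra].
  apply: le_trans (_ : 1 + ((y ^+ 2) ^+ 2) ^+ 2 <= _).
    have -> : ((y ^+ 2) ^+ 2) ^+ 2 = 64 * (4 * mu ^+ 4) by rewrite ymu; ring.
    lra.
  apply: le_trans h3 _; apply: le_trans (_ : ((1 + y ^+ 2) ^+ 2) ^+ 2 <= _).
    by apply: lerXn2r h2; rewrite nnegrE ?sqr_ge0//; have := sqr_ge0 (y ^+ 2); lra.
  rewrite (_ : (1 + y) ^+ 8 = (((1 + y) ^+ 2) ^+ 2) ^+ 2); last by rewrite -!exprM.
  apply: lerXn2r; rewrite ?nnegrE ?sqr_ge0//.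
  by apply: lerXn2r h1; rewrite nnegrE ?sqr_ge0//; have := sqr_ge0 y; lra.
have : ln (1 + 4 * mu ^+ 4) ^+ 2 <= (8 * y) ^+ 2.
  by apply: lerXn2r; rewrite ?nnegrE ?ln1D_ge0 ?mulr_ge0//.
by rewrite exprMn ymu expr2; lra.
Qed.

(* Either the relative error [e * H] is at most 1/2, or the crude bound [Lb] is multiplied by
   [2 * e * H >= 1]. *)
Lemma log_gap_le a x e H Lb : 0 < a -> 0 < x -> 0 <= e -> 0 <= H -> 0 <= Lb ->
  a * (1 - e * H) <= x -> ln a - ln x <= Lb -> ln a - ln x <= 2 * (e * (H * (1 + Lb))).
Proof.
move=> a0 x0 e0 H0 L0 hx hL.
have eH : 0 <= e * H by rewrite mulr_ge0.
have eHL : 0 <= e * H * Lb by rewrite mulr_ge0.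
have [h|h] := leP (e * H) (1 / 2); last first.
  apply: le_trans hL _; rewrite mulrA [in leRHS]mulrDr mulr1.
  have : 1 / 2 * Lb <= e * H * Lb by rewrite ler_wpM2r// ltW.
  lra.
have ax : 0 < a / x by rewrite divr_gt0.
rewrite -ln_div ?posrE//; apply: le_trans (ln_le_sub1 ax) _.
have xa : a / 2 <= x.
  apply: le_trans hx; have h' : 1 / 2 <= 1 - e * H by lra.
  by have := ler_wpM2l (ltW a0) h'; lra.
have : a / x - 1 <= 2 * (e * H).
  rewrite lerBlDr ler_pdivrMr//.
  have h2 : 2 * (e * H) * (a / 2) <= 2 * (e * H) * x by rewrite ler_wpM2l// mulr_ge0.
  lra.
rewrite (mulrA e) mulrDr mulr1; lra.
Qed.

Lemma sqr3_le (x y z : R) : (x + y + z) ^+ 2 <= 3 * (x ^+ 2 + y ^+ 2 + z ^+ 2).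
Proof.
have := sqr_ge0 (x - y); have := sqr_ge0 (x - z); have := sqr_ge0 (y - z); nra.
Qed.

(* [log_gap_le], the crude bound coming from the noise energy and from the small-ball bound on [x]. *)
Lemma log_residual_le (c a x e sig2 g U1 U3 U0 L1 mu : R) :
  0 < c -> 0 < a -> 0 < x -> 0 <= e -> 0 <= sig2 ->
  0 <= U1 -> 0 <= U3 -> 0 <= U0 -> 0 <= mu ->
  0 <= L1 -> L1 <= ln (1 + U1) ->
  a * (1 - e * (c * (2 + L1 + ln (1 + U3)))) <= x ->
  a <= g + sig2 -> g <= 2 * x + 2 * (sig2 * (1 + c * (1 + ln (1 + U0)))) ->
  sig2 <= 4 * x * mu ^+ 4 ->
  ln a - ln x <= e * (48 * (c ^+ 2 + (3 + c) ^+ 2 + 16) * (1 + U1 + U3 + U0 + mu)).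
Proof.
move=> c0 a0 x0 e0 s0 U10 U30 U00 mu0 L10 L1U hx ag gx sx.
have l3 := ln1D_ge0 U30; have l0 := ln1D_ge0 U00.
have m4 : 0 <= 4 * mu ^+ 4 by rewrite mulr_ge0// exprn_ge0.
have lm := ln1D_ge0 m4.
pose Z := 1 + c * (1 + ln (1 + U0)).
have cl0 : 0 <= c * ln (1 + U0) by rewrite mulr_ge0// ltW.
have Z0 : 1 <= Z by rewrite /Z mulrDr mulr1; lra.
pose H := c * (2 + L1 + ln (1 + U3)).
have H0 : 0 <= H by rewrite /H mulr_ge0 ?(ltW c0)//; lra.
pose Lb := 2 + 2 * Z + ln (1 + 4 * mu ^+ 4).
have Lb0 : 0 <= Lb by rewrite /Lb; lra.
have hL : ln a - ln x <= Lb.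
  rewrite -ln_div ?posrE//.
  (* a <= g + sig2 <= 2 x + (2 Z + 1) sig2, and sig2 <= 4 x mu^4 turns the noise level into a
     multiple of x. *)
  apply: le_trans (_ : ln ((3 + 2 * Z) * (1 + 4 * mu ^+ 4)) <= _).
    rewrite ler_ln ?posrE ?divr_gt0 ?mulr_gt0//; try lra.
    rewrite ler_pdivrMr//.
    have : (2 * Z + 1) * sig2 <= (2 * Z + 1) * (4 * x * mu ^+ 4) by rewrite ler_wpM2l//; lra.
    have : 0 <= 2 * x * (4 * mu ^+ 4) by rewrite mulr_ge0//; lra.
    have : 0 <= Z * x by rewrite mulr_ge0//; lra.
    move: ag gx; rewrite -/Z; nra.
  rewrite lnM ?posrE; try lra.
  have := @ln_le_sub1 (3 + 2 * Z); rewrite /Lb; lra.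
have := log_gap_le a0 x0 e0 H0 Lb0 hx hL; move/le_trans; apply.
rewrite mulrCA ler_wpM2l//.
have s1 : L1 ^+ 2 <= 4 * U1.
  by apply: le_trans (ln1D_sqr_le U10); apply: lerXn2r; rewrite ?nnegrE//; lra.
have s3 := ln1D_sqr_le U30; have s0' := ln1D_sqr_le U00; have sm := ln_pow4_sqr_le mu0.
have hH : H ^+ 2 <= c ^+ 2 * (12 * (1 + U1 + U3)).
  rewrite /H exprMn ler_wpM2l ?sqr_ge0//; apply: le_trans (sqr3_le _ _ _) _.
  by rewrite expr2; lra.
have hLb : (1 + Lb) ^+ 2 <= 3 * ((2 * (3 + c)) ^+ 2 + 4 * c ^+ 2 * (4 * U0) + 256 * mu).
  have -> : 1 + Lb = (5 + 2 * c) + 2 * c * ln (1 + U0) + ln (1 + 4 * mu ^+ 4).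
    by rewrite /Lb /Z; ring.
  apply: le_trans (sqr3_le _ _ _) _; rewrite ler_pM2l//.
  have k1 : (5 + 2 * c) ^+ 2 <= (2 * (3 + c)) ^+ 2.
    by apply: lerXn2r; rewrite ?nnegrE; lra.
  have k2 : (2 * c * ln (1 + U0)) ^+ 2 <= 4 * c ^+ 2 * (4 * U0).
    rewrite exprMn; have -> : (2 * c) ^+ 2 = 4 * c ^+ 2 by ring.
    by rewrite ler_wpM2l// mulr_ge0// sqr_ge0.
  lra.
(* Passing to squares avoids products of the auxiliary variables, whose joint law is not
   controlled. *)
have am : 2 * (H * (1 + Lb)) <= H ^+ 2 + (1 + Lb) ^+ 2.
  by have := sqr_ge0 (H - (1 + Lb)); nra.
apply: le_trans am _.
have cc : 0 <= c ^+ 2 by exact: sqr_ge0.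
have cd : 0 <= (3 + c) ^+ 2 by exact: sqr_ge0.
rewrite (_ : (2 * (3 + c)) ^+ 2 = 4 * (3 + c) ^+ 2) in hLb; last by ring.
apply: le_trans (lerD hH hLb) _.
move: (c ^+ 2) cc => A A0; move: ((3 + c) ^+ 2) cd => D D0.
have : 0 <= A * U1 by rewrite mulr_ge0.
have : 0 <= A * U3 by rewrite mulr_ge0.
have : 0 <= A * U0 by rewrite mulr_ge0.
have : 0 <= A * mu by rewrite mulr_ge0.
have : 0 <= D * U1 by rewrite mulr_ge0.
have : 0 <= D * U3 by rewrite mulr_ge0.
have : 0 <= D * U0 by rewrite mulr_ge0.
have : 0 <= D * mu by rewrite mulr_ge0.
lra.
Qed.

End LogBounds.

(** * Concentration at the noise level of the model *)

Section ScaledNoise.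
Context {R : realType} {d} {T : measurableType d} (P : probability T R).
Variables (M N : nat) (E : T -> 'M[R]_(2 ^ M, 2 ^ N)) (sigma : R).
Hypotheses (iidE : iid_gauss_mx P E) (sigma0 : 0 < sigma).

Definition concentration_const : R := 85 * 32.

Lemma concentration_const_gt0 : 0 < concentration_const.
Proof. by rewrite /concentration_const; lra. Qed.

Lemma concentration_boundE q p (S : 'M[R]_(q, p)) : concentration_bound S =
  concentration_const * (Num.sqrt p%:R * (Num.sqrt q%:R + Num.sqrt (frob2 S))).
Proof. by []. Qed.

Local Notation total := ((2 ^ (M + N))%:R : R).
Local Notation rt := (Num.sqrt total).
Local Notation s := (sigma / rt).
Implicit Types X : 'M[R]_(2 ^ M, 2 ^ N).
Local Notation c0 := concentration_const.

(** With T = 2^(M + N) and |X| the Frobenius norm this is sigma^2 T^(-1/2) + sigma |X| T^(-1/4). It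
    bounds the rescaled error for every unfolding with p <= q, because then sqrt p <= T^(1/4). *)
Definition noise_scale (X : 'M[R]_(2 ^ M, 2 ^ N)) : R :=
  (sigma ^+ 2 + sigma * Num.sqrt (frob2 X) * Num.sqrt (Num.sqrt (2 ^ (M + N))%:R))
    / Num.sqrt (2 ^ (M + N))%:R.

Let total1 : 1 <= total. Proof. by rewrite ler1n expn_gt0. Qed.
Let rt2 : rt ^+ 2 = total. Proof. by rewrite sqr_sqrtr// ler0n. Qed.
Let rt1 : 1 <= rt.
Proof. rewrite -[leLHS]sqrtr1; apply: ler_wsqrtr; exact: total1. Qed.
Let rt0 : 0 < rt. Proof. exact: lt_le_trans ltr01 rt1. Qed.
Let s0 : 0 < s. Proof. exact: divr_gt0. Qed.
Let s2 : s ^+ 2 * total = sigma ^+ 2.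
Proof. by rewrite -[X in _ * X = _]rt2; field; rewrite !gt_eqF//. Qed.

Let frob2Z q p (a : R) (A : 'M[R]_(q, p)) : frob2 (a *: A) = a ^+ 2 * frob2 A.
Proof.
rewrite /frob2 mulr_sumr; apply: eq_bigr => i _; rewrite mulr_sumr.
by apply: eq_bigr => j _; rewrite mxE exprMn.
Qed.

Let sqrt_frob2 X : Num.sqrt (frob2 (s^-1 *: X)) = s^-1 * Num.sqrt (frob2 X).
Proof. by rewrite frob2Z sqrtrM ?sqr_ge0// sqrtr_sqr ger0_norm// invr_ge0 ltW. Qed.

Let scaleE X w : X + s *: E w = s *: (s^-1 *: X + E w).
Proof. by rewrite scalerDr scalerA divff ?scale1r// gt_eqF. Qed.

Let sqn_col1 q p (A : 'M[R]_(q, p)) : p = 1%N ->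
  sqn (A *m const_mx 1) = frob2 A /\ sqn (const_mx 1 : 'cV[R]_p) = 1.
Proof.
move=> p1; subst p; split; last by rewrite /sqn big_ord1 mxE expr1n.
by apply: eq_bigr => i _; rewrite mxE !big_ord1 mxE mulr1.
Qed.

(** At (M, N) the rearrangement is a single column, so p = 1 and the quadratic form at 1 is the
    squared Frobenius norm: the concentration theorem covers the energy too. *)
Lemma energy_concentration X : exists U : T -> R,
  [/\ measurable_fun setT U, forall w, 0 <= U w, (\int[P]_w (U w)%:E <= 1)%E &
  forall w, `|frob2 (X + s *: E w) - sigma ^+ 2 - frob2 X| <=
    c0 * ((sigma ^+ 2 + sigma * Num.sqrt (frob2 X)) / rt) * (1 + ln (1 + U w))].
Proof.
pose h := rearr_index (leqnn M) (leqnn N).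
have hb : bijective h by exact: rearr_index_bij.
have p1 : (2 ^ (M + N - M - N) = 1)%N by rewrite -subnDA subnn.
pose S := s^-1 *: X.
have [||U [mU U0 UE HU]] := @quadratic_concentration _ _ _ P _ _ (reshape h S) _ _ _
  (iid_gauss_reshape hb iidE).
- by rewrite expn_gt0.
- by rewrite p1 expn_gt0.
exists U; split => // w; have := HU w (const_mx 1).
have [-> ->] := sqn_col1 (reshape h S + reshape h (E w)) p1.
have [-> _] := sqn_col1 (reshape h S) p1.
rewrite -reshapeD !(frob2_reshape _ hb) concentration_boundE (frob2_reshape _ hb).
rewrite [in Num.sqrt (2 ^ (M + N - M - N))%:R]p1 [in _ / (2 ^ (M + N - M - N))%:R]p1.
rewrite !mulr1 sqrtr1 mul1r divr1 /S sqrt_frob2 => hh.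
rewrite scaleE frob2Z.
have -> : s ^+ 2 * frob2 (s^-1 *: X + E w) - sigma ^+ 2 - frob2 X =
   s ^+ 2 * (frob2 (s^-1 *: X + E w) - total - frob2 (s^-1 *: X)).
  by rewrite [frob2 (s^-1 *: X)]frob2Z -s2; field; rewrite !gt_eqF//.
rewrite normrM ger0_norm ?sqr_ge0//.
apply: le_trans (ler_wpM2l (sqr_ge0 s) hh) _.
rewrite le_eqVlt; apply/orP; left; apply/eqP; field.
by rewrite !gt_eqF.
Qed.

Lemma unfolding_concentration X q p (h : 'I_q * 'I_p -> 'I_(2 ^ M) * 'I_(2 ^ N)) :
  bijective h -> (0 < p)%N -> (p <= q)%N -> (q * p)%N = (2 ^ (M + N))%N -> exists U : T -> R,
  [/\ measurable_fun setT U, forall w, 0 <= U w, (\int[P]_w (U w)%:E <= 1)%E &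
  forall w v, sqn (reshape h (X + s *: E w) *m v) <= sqn (reshape h X *m v) +
    (sigma ^+ 2 / p%:R + c0 * noise_scale X * (1 + ln (1 + U w) / p%:R)) * sqn v].
Proof.
move=> hb p0 pq qp; pose S := s^-1 *: X.
have [//|//|U [mU U0 UE HU]] := @quadratic_concentration _ _ _ P _ _ (reshape h S) _ _ _
  (iid_gauss_reshape hb iidE).
exists U; split => // w v; have := HU w v; rewrite ler_norml => /andP[_ hh].
have pR : 1 <= p%:R :> R by rewrite ler1n.
have qR : 1 <= q%:R :> R by rewrite ler1n (leq_trans p0).
have qpR : q%:R * p%:R = total by rewrite -natrM qp.
have sv := sqn_ge0 v.
have e1 : sqn (reshape h (X + s *: E w) *m v) = s ^+ 2 * sqn ((reshape h S + reshape h (E w)) *m v).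
  by rewrite scaleE reshapeZ -scalemxAl sqnZ -reshapeD.
have e2 : sqn (reshape h X *m v) = s ^+ 2 * sqn (reshape h S *m v).
  by rewrite /S reshapeZ -scalemxAl sqnZ mulrA -exprMn divff ?expr1n ?mul1r// gt_eqF.
have e3 : sigma ^+ 2 / p%:R = s ^+ 2 * q%:R.
  have e : s ^+ 2 * (q%:R * p%:R) = sigma ^+ 2 by rewrite qpR.
  by rewrite -e mulrA mulfK// gt_eqF//; lra.
have L0 : 0 <= 1 + ln (1 + U w) / p%:R.
  by rewrite addr_ge0// divr_ge0 ?ln1D_ge0.
have hs : s ^+ 2 * (Num.sqrt p%:R * (Num.sqrt q%:R + Num.sqrt (frob2 (reshape h S))))
    <= noise_scale X.
  have e4 : Num.sqrt p%:R * Num.sqrt q%:R = rt.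
    by rewrite -sqrtrM; [rewrite mulrC qpR|lra].
  have prt : Num.sqrt p%:R <= Num.sqrt rt.
    rewrite ler_wsqrtr// -(@ler_sqr _ p%:R) ?nnegrE ?(ltW rt0)// rt2 -qpR expr2.
    by rewrite ler_wpM2r// ler_nat.
  rewrite (frob2_reshape _ hb) sqrt_frob2 mulrDr e4 mulrDr /noise_scale.
  have -> : s ^+ 2 * (Num.sqrt p%:R * (s^-1 * Num.sqrt (frob2 X))) =
    sigma * Num.sqrt (frob2 X) * Num.sqrt p%:R / rt.
    by field; rewrite !gt_eqF//.
  have -> : s ^+ 2 * rt = sigma ^+ 2 / rt by field; rewrite !gt_eqF//.
  rewrite mulrDl lerD2l ler_wpM2r ?invr_ge0 ?(ltW rt0)// ler_wpM2l//.
  by rewrite mulr_ge0 ?sqrtr_ge0// ltW.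
have hs2 : s ^+ 2 * (concentration_bound (reshape h S) * (1 + ln (1 + U w) / p%:R) * sqn v) <=
   c0 * noise_scale X * (1 + ln (1 + U w) / p%:R) * sqn v.
  rewrite concentration_boundE; move: (Num.sqrt p%:R * _) hs => z hs.
  have -> : s ^+ 2 * (c0 * z * (1 + ln (1 + U w) / p%:R) * sqn v) =
     c0 * (s ^+ 2 * z) * (1 + ln (1 + U w) / p%:R) * sqn v by ring.
  apply: ler_wpM2r => //; apply: ler_wpM2r => //; apply: ler_wpM2l => //.
  exact: ltW concentration_const_gt0.
have := ler_wpM2l (sqr_ge0 s) hh; rewrite e1 e2 e3; lra.
Qed.

Definition residual X m n w : R := frob2 ((X + s *: E w) - fit m n (X + s *: E w)).

Lemma residual_ge0 X m n w : 0 <= residual X m n w.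
Proof. exact: frob2_ge0. Qed.

Let measurable_Y X i j : measurable_fun setT (fun w => (X + s *: E w) i j).
Proof.
rewrite (_ : (fun _ => _) = fun w => X i j + s * E w i j).
  by apply: measurable_funD => //; apply: measurable_funM => //; exact: iidE.1 (i, j).
by apply/funext => w; rewrite !mxE.
Qed.

Lemma residualE X m n w (mM : (m <= M)%N) (nN : (n <= N)%N) : residual X m n w =
  frob2 (X + s *: E w) - specnorm (rearr m n (X + s *: E w)) ^+ 2.
Proof. by rewrite /residual; have [u [v [_ _ _ -> _]]] := fit_residual mM nN (X + s *: E w). Qed.

Lemma measurable_residual X m n : (m <= M)%N -> (n <= N)%N ->
  measurable_fun setT (residual X m n).
Proof.
move=> mM nN; rewrite (_ : residual X m n = fun w =>
  frob2 (X + s *: E w) - specnorm (rearr m n (X + s *: E w)) ^+ 2); last first.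
  by apply/funext => w; exact: residualE.
apply: measurable_funB.
  apply: measurable_sum_cond => i; apply: measurable_sum_cond => j.
  by apply: measurable_funX; exact: measurable_Y.
apply: measurable_funX; apply: measurable_specnorm; first by rewrite expn_gt0.
move=> i j; rewrite (_ : (fun _ => _) = fun w =>
  (X + s *: E w) (rearr_index mM nN (i, j)).1 (rearr_index mM nN (i, j)).2).
  exact: measurable_Y.
by apply/funext => w; rewrite rearrE mxE.
Qed.

Lemma residual_small_ball X m n : inC M N m n -> exists B : T -> \bar R,
  [/\ measurable_fun setT B, forall w, (0 <= B w)%E, (\int[P]_w B w <= 48%:E)%E &
    forall w mu, (B w <= mu%:E)%E -> 0 < mu /\ sigma ^+ 2 <= 4 * residual X m n w * mu ^+ 4].
Proof.
move=> /and4P[mM nN n00 nMN].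
have mn1 : (1 < 2 ^ (m + n))%N.
  by rewrite -[1%N]/(2 ^ 0)%N ltn_exp2l// lt0n addn_eq0.
have mn2 : (1 < 2 ^ (M + N - m - n))%N.
  rewrite -[1%N]/(2 ^ 0)%N ltn_exp2l// -subnDA subn_gt0 ltn_neqAle leq_add// andbT.
  by apply: contra nMN => /eqP e; apply/andP; split; apply/eqP; lia.
have card : (2 ^ (m + n) * 2 ^ (M + N - m - n) = 2 ^ (M + N))%N.
  by rewrite -expnD; congr (2 ^ _)%N; lia.
have hb := rearr_index_bij mM nN.
pose h := rearr_index mM nN; pose S := s^-1 *: X.
have [B [mB B0 BE HB]] := rank_one_residual_small_ball (reshape h S) mn1 mn2
   (iid_gauss_reshape hb iidE).
exists B; split => // w mu Bmu.
have [u [v [u1 v1 _ _ e]]] := fit_residual mM nN (X + s *: E w).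
set l := specnorm _ in e.
(* The rank one matrix in the small-ball bound is arbitrary, so it absorbs the scaling of the
   noise. *)
have [mu0 h2] := HB w mu ((l / s) *: u) v Bmu; split => //.
have e2 : s *: (reshape h S + reshape h (E w) - ((l / s) *: u) *m v^T) =
    reshape h (X + s *: E w - fit m n (X + s *: E w)).
  rewrite e scaleE [in RHS]reshapeZ [in RHS]reshapeD scalerBr; congr (_ - _).
  by rewrite -scalemxAl scalerA mulrC divfK// gt_eqF.
have e3 : residual X m n w = s ^+ 2 *
    frob2 (reshape h S + reshape h (E w) - ((l / s) *: u) *m v^T).
  by rewrite -frob2Z e2 (frob2_reshape _ hb).
rewrite card in h2; rewrite e3 -s2.
by have := ler_wpM2l (sqr_ge0 s) h2; lra.
Qed.

End ScaledNoise.

(** * Means and tails of the auxiliary variables *)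

Section IntegralBounds.
Context {R : realType} {d} {T : measurableType d} (P : probability T R).

Lemma integral_add_le (f g : T -> \bar R) (a b : R) :
  measurable_fun setT f -> measurable_fun setT g ->
  (forall w, 0 <= f w)%E -> (forall w, 0 <= g w)%E ->
  (\int[P]_w f w <= a%:E)%E -> (\int[P]_w g w <= b%:E)%E ->
  (\int[P]_w (f w + g w) <= (a + b)%:E)%E.
Proof. by move=> mf mg f0 g0 fa gb; rewrite ge0_integralD// EFinD leeD. Qed.

Lemma integral_scale_le (f : T -> \bar R) (k a : R) :
  measurable_fun setT f -> (forall w, 0 <= f w)%E -> 0 <= k ->
  (\int[P]_w f w <= a%:E)%E -> (\int[P]_w (k%:E * f w) <= (k * a)%:E)%E.
Proof. by move=> mf f0 k0 fa; rewrite ge0_integralZl// EFinM lee_wpmul2l. Qed.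

Lemma integral_cst_prob (k : R) : (\int[P]_w k%:E = k%:E)%E.
Proof. by rewrite integral_cst//= probability_setT mule1. Qed.

Lemma integrable_dominated (f : T -> R) (B : T -> \bar R) (a : R) :
  measurable_fun setT f -> measurable_fun setT B ->
  (forall w, `|f w|%:E <= B w)%E -> (\int[P]_w B w <= a%:E)%E ->
  P.-integrable setT (fun w => (f w)%:E).
Proof.
move=> mf mB fB Ba; apply/integrableP; split; first exact/measurable_EFinP.
apply: le_lt_trans (_ : \int[P]_w B w < +oo)%E; last exact: le_lt_trans Ba (ltry _).
apply: ge0_le_integral => //; last by move=> w _; rewrite abse_EFin; exact: fB.
by apply: measurableT_comp => //; exact/measurable_EFinP.
Qed.

Lemma integral_le_cst_add (f : T -> R) (B : T -> \bar R) (c a : R) :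
  P.-integrable setT (fun w => (f w)%:E) -> measurable_fun setT B ->
  (forall w, 0 <= B w)%E -> (forall w, (f w)%:E <= c%:E + B w)%E ->
  (\int[P]_w B w <= a%:E)%E -> (\int[P]_w (f w)%:E <= (c + a)%:E)%E.
Proof.
move=> intf mB B0 fB Ba.
have intB : P.-integrable setT B.
  apply/integrableP; split => //; under eq_integral do rewrite gee0_abs//.
  exact: le_lt_trans Ba (ltry _).
have intc : P.-integrable setT (fun=> c%:E).
  exact: finite_measure_integrable_cst.
apply: le_trans (_ : \int[P]_w (c%:E + B w) <= _)%E.
  by apply: le_integral => //; exact: integrableD.
by rewrite integralD// integral_cst_prob EFinD leeD2l.
Qed.

Lemma integral_EFin_le (U : T -> R) (k : R) : measurable_fun setT U ->
  (forall w, 0 <= U w) -> 0 <= k -> (\int[P]_w (U w)%:E <= 1)%E ->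
  (\int[P]_w (k%:E * (U w)%:E) <= k%:E)%E.
Proof.
move=> mU U0 k0 UE; rewrite -[X in (_ <= X%:E)%E]mulr1.
by apply: integral_scale_le => //; exact/measurable_EFinP.
Qed.

(** Markov's inequality for 1 + U, of mean at most 2, at level exp (x p); then exp (x p) >= x p
    keeps a factor 1 / p to be summed over configurations. *)
Lemma prob_ln1D_gt_le (U : T -> R) (p x : R) : measurable_fun setT U ->
  (forall w, 0 <= U w) -> (\int[P]_w (U w)%:E <= 1)%E -> 0 < p -> 0 < x ->
  (P [set w | (x < ln (1 + U w) / p)%R] <= (2 / (x * p))%:E)%E.
Proof.
move=> mU U0 UE p0 x0; have xp0 : 0 < x * p by rewrite mulr_gt0.
pose A := [set w | x < ln (1 + U w) / p].
have mA : measurable A.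
  rewrite (_ : A = (fun w => ln (1 + U w) / p) @^-1` `]x, +oo[).
    rewrite -[X in measurable X]setTI.
    apply: (measurable_funM _ (measurable_cst _)) => //.
    apply: (measurableT_comp (@measurable_ln R)); exact: measurable_funD.
  by apply/seteqP; split => w /=; rewrite in_itv/= andbT.
have UA w : A w -> expR (x * p) <= 1 + U w.
  rewrite /A/= ltr_pdivlMr// => h; rewrite -[1 + U w]lnK ?posrE ?ler_expR 1?ltW//.
  by have := U0 w; lra.
apply: le_trans (_ : ((expR (x * p))^-1 * 2)%:E <= _)%E; last first.
  rewrite lee_fin mulrC ler_wpM2l// lef_pV2 ?posrE ?expR_gt0//.
  by have := expR_ge1Dx (x * p); lra.
have step : ((expR (x * p))%:E * P A <= 2%:E)%E.
  apply: le_trans (_ : \int[P]_w (1 + U w)%:E <= _)%E; last first.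
    under eq_integral do rewrite EFinD.
    rewrite (_ : 2%:E = (1 + 1)%:E)//.
    apply: integral_add_le => //; first exact/measurable_EFinP.
    by rewrite integral_cst_prob.
  rewrite -[P A](_ : \int[P]_w (\1_A w)%:E = _)%E; last by rewrite integral_indic// setIT.
  have mI : measurable_fun setT (fun w => (\1_A w)%:E : \bar R).
    by apply/measurable_EFinP; exact: measurable_indic.
  have e0 : (0 <= (expR (x * p))%:E)%E by rewrite lee_fin expR_ge0.
  rewrite -(ge0_integralZl _ measurableT mI _ e0)//.
  apply: ge0_le_integral => //.
  - exact: emeasurable_funM.
  - by apply/measurable_EFinP; exact: measurable_funD.
  - move=> w _; rewrite -EFinM lee_fin indicE; case: (boolP (w \in A)) => wA.
      by rewrite mulr1 UA//; exact: set_mem.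
    by rewrite mulr0; have := U0 w; lra.
have PA : P A \is a fin_num by exact: fin_num_measure.
move: step; rewrite -(fineK PA) -EFinM !lee_fin => step.
by rewrite mulrC ler_pdivlMr ?expR_gt0// mulrC.
Qed.

Lemma prob_gt_le (B : T -> \bar R) (a x : R) : measurable_fun setT B ->
  (forall w, 0 <= B w)%E -> (\int[P]_w B w <= a%:E)%E -> 0 < x ->
  (P [set w | (x%:E < B w)%E] <= (a / x)%:E)%E.
Proof.
move=> mB B0 Ba x0; pose A := [set w | (x%:E < B w)%E].
have mA : measurable A.
  by rewrite -[A]setTI; exact: emeasurable_fun_o_infty.
have step : (x%:E * P A <= a%:E)%E.
  apply: le_trans Ba.
  rewrite -[P A](_ : \int[P]_w (\1_A w)%:E = _)%E; last by rewrite integral_indic// setIT.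
  have mI : measurable_fun setT (fun w => (\1_A w)%:E : \bar R).
    by apply/measurable_EFinP; exact: measurable_indic.
  have e0 : (0 <= x%:E)%E by rewrite lee_fin ltW.
  rewrite -(ge0_integralZl _ measurableT mI _ e0)//.
  apply: ge0_le_integral => //.
  - by move=> w _; rewrite mule_ge0// lee_fin ltW.
  - exact: emeasurable_funM.
  - move=> w _; rewrite indicE; case: (boolP (w \in A)) => wA.
      by rewrite mule1 ltW//; exact: set_mem.
    by rewrite mule0.
have PA : P A \is a fin_num by exact: fin_num_measure.
move: step; rewrite -/A -(fineK PA) -EFinM !lee_fin => step.
by rewrite ler_pdivlMr// mulrC.
Qed.

Lemma prob_bigsetU_le (I : Type) (s : seq I) (F : I -> set T) (a : I -> R) :
  (forall i, measurable (F i)) -> (forall i, P (F i) <= (a i)%:E)%E ->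
  (P (\big[setU/set0]_(i <- s) F i) <= (\sum_(i <- s) a i)%:E)%E.
Proof.
move=> mF Fa; elim: s => [|i s IH]; first by rewrite !big_nil measure0.
rewrite !big_cons EFinD; apply: le_trans (measureU2 _ _ _) _ => //.
  exact: bigsetU_measurable.
by apply: leeD; [exact: Fa|exact: IH].
Qed.

End IntegralBounds.

(** * The two-term model: signal, noise and residuals *)

Section TwoTermModel.
Context {R : realType} {d} {T : measurableType d} (P : probability T R).
Variables (M N m0 n0 : nat) (l1 l2 sigma xi : R).
Variables (A1 A2 : 'M[R]_(2 ^ m0, 2 ^ n0)) (B1 B2 : 'M[R]_(2 ^ (M - m0), 2 ^ (N - n0))).
Variable E : T -> 'M[R]_(2 ^ M, 2 ^ N).
Hypotheses (iidE : iid_gauss_mx P E) (m0M : (m0 <= M)%N) (n0N : (n0 <= N)%N).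
Hypotheses (l21 : l2 <= l1) (l20 : 0 < l2) (sigma0 : 0 < sigma) (xi0 : 0 < xi).
Hypotheses (trA : [/\ \tr (A1 *m A1^T) = 1, \tr (A2 *m A2^T) = 1,
                 \tr (A1 *m A2^T) = 0 & \tr (A2 *m A1^T) = 0])
           (trB : [/\ \tr (B1 *m B1^T) = 1, \tr (B2 *m B2^T) = 1,
                 \tr (B1 *m B2^T) = 0 & \tr (B2 *m B1^T) = 0]).

Local Notation X1 := (kron (2 ^ M) (2 ^ N) A1 B1).
Local Notation X2 := (kron (2 ^ M) (2 ^ N) A2 B2).
Local Notation X := (l1 *: X1 + l2 *: X2).
Local Notation rt := (Num.sqrt (2 ^ (M + N))%:R : R).
Local Notation s := (sigma / rt).
Local Notation c0 := (@concentration_const R).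
Local Notation Res := (residual E sigma X).

Hypothesis cosA : forall m n, inWA M N m0 n0 m n ->
     cosTheta (rearr m n X1) (rearr m n X2) <= xi.
Hypothesis cosB : forall m n, inWB M N m0 n0 m n ->
     cosTheta (rearrT m n X1) (rearrT m n X2) <= xi.

Definition signal_gap : R := l1 ^+ 2 * (1 - phiW m0 n0 X1 ^+ 2) - l2 ^+ 2 * phiW m0 n0 X2 ^+ 2
             - 2 * l1 * l2 * phiW m0 n0 X1 * phiW m0 n0 X2 * xi.
Local Notation G := signal_gap.
Local Notation b := (sigma ^+ 2 + l2 ^+ 2).

Let l10 : 0 < l1. Proof. exact: lt_le_trans l20 l21. Qed.
Let rt1 : 1 <= rt.
Proof. by rewrite -[leLHS]sqrtr1 ler_wsqrtr// ler1n expn_gt0. Qed.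
Let rt0 : 0 < rt. Proof. exact: lt_le_trans ltr01 rt1. Qed.
Let rt2 : rt ^+ 2 = (2 ^ (M + N))%:R. Proof. by rewrite sqr_sqrtr// ler0n. Qed.
Let c00 : 0 < c0 := concentration_const_gt0.

Let frob2_pair q p (D1 D2 : 'M[R]_(q, p)) a1 a2 :
  frob2 (a1 *: D1 + a2 *: D2) =
  a1 ^+ 2 * frob2 D1 + a2 ^+ 2 * frob2 D2 + 2 * a1 * a2 * inner D1 D2.
Proof.
rewrite /frob2 /inner !mulr_sumr -!big_split; apply: eq_bigr => i _ /=.
rewrite !mulr_sumr -!big_split; apply: eq_bigr => j _ /=.
by rewrite !mxE; ring.
Qed.

Let unitA (A : 'M[R]_(2 ^ m0, 2 ^ n0)) : \tr (A *m A^T) = 1 -> sqn (vecm (2 ^ (m0 + n0)) A) = 1.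
Proof.
by move=> h; rewrite sqn_dot /dot inner_vecm ?h// expnD.
Qed.

Let unitB (B : 'M[R]_(2 ^ (M - m0), 2 ^ (N - n0))) : \tr (B *m B^T) = 1 ->
  sqn (vecm (2 ^ (M + N - m0 - n0)) B) = 1.
Proof.
by move=> h; rewrite sqn_dot /dot inner_vecm ?h// (expn_rest m0M n0N).
Qed.

Let inner_kron (A A' : 'M[R]_(2 ^ m0, 2 ^ n0)) (B B' : 'M[R]_(2 ^ (M - m0), 2 ^ (N - n0))) :
  inner (kron (2 ^ M) (2 ^ N) A B) (kron (2 ^ M) (2 ^ N) A' B') =
  \tr (A *m A'^T) * \tr (B *m B'^T).
Proof.
rewrite -(inner_reshape _ _ (rearr_index_bij m0M n0N)) -!rearrE !rearr_kron// inner_outer.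
by rewrite (inner_vecm _ _ (expnD 2 m0 n0)) (inner_vecm _ _ (expn_rest m0M n0N)).
Qed.

Lemma frob2_signal : frob2 X = l1 ^+ 2 + l2 ^+ 2.
Proof.
have [a1 a2 a12 a21] := trA; have [b1 b2 b12 b21] := trB.
by rewrite frob2_pair !frob2E !inner_kron a1 a2 a12 b1 b2 b12; ring.
Qed.

Lemma frob2_second_term : frob2 (l2 *: X2) = l2 ^+ 2.
Proof.
have [a1 a2 a12 a21] := trA; have [b1 b2 b12 b21] := trB.
have := frob2_pair X2 X2 l2 0; rewrite scale0r addr0 => ->.
by rewrite !frob2E !inner_kron a2 b2; ring.
Qed.

(** The leading pair captures at least as much energy as the true unit vectors do, so subtracting l1
    X1 instead leaves at least as large a remainder. *)
Lemma true_residual_le w : Res m0 n0 w <= frob2 (l2 *: X2 + s *: E w).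
Proof.
have [a1 a2 a12 a21] := trA; have [b1 b2 b12 b21] := trB.
rewrite (residualE _ _ _ _ m0M n0N).
have -> : l2 *: X2 + s *: E w = (X + s *: E w) - l1 *: X1.
  by rewrite -(addrA (l1 *: X1)) [RHS]addrC addKr.
set Y := X + s *: E w.
rewrite -(frob2_reshape (Y - _) (rearr_index_bij m0M n0N)) reshapeB reshapeZ -!rearrE rearr_kron//.
rewrite frob2_sub_outer ?unitA ?unitB//.
set dt := dot _ _.
have : dt ^+ 2 <= specnorm (rearr m0 n0 Y) ^+ 2.
  by apply: dot_le_specnorm; rewrite ?expn_gt0 ?unitA ?unitB.
rewrite rearrE (frob2_reshape _ (rearr_index_bij m0M n0N)).
by have := sqr_ge0 (dt - l1); nra.
Qed.

Let sqrt_energy : Num.sqrt (frob2 X) <= l1 + l2.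
Proof.
rewrite frob2_signal -[leRHS]ger0_norm; last by move: l10 l20; lra.
rewrite -sqrtr_sqr ler_wsqrtr// sqrrD.
have l12 : 0 <= l1 * l2 by exact: ltW (mulr_gt0 l10 l20).
lra.
Qed.

(** [noise_scale] with the norm of the signal replaced by its bound l1 + l2; the two summands
    correspond to the two limits of the signal-to-noise condition. *)
Definition model_scale : R :=
  sigma ^+ 2 / rt + (l1 + l2) * sigma / Num.sqrt rt.
Local Notation scale := model_scale.

Lemma noise_scale_le : noise_scale sigma X <= scale.
Proof.
have rr0 : 0 < Num.sqrt rt by rewrite sqrtr_gt0.
have rr2 : Num.sqrt rt ^+ 2 = rt by rewrite sqr_sqrtr// ltW.
rewrite /noise_scale /model_scale mulrDl lerD2l.
have -> : sigma * Num.sqrt (frob2 X) * Num.sqrt rt / rt = Num.sqrt (frob2 X) * (sigma / Num.sqrt rt).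
  by move: (Num.sqrt rt) rr0 rr2 => y y0 <-; field; rewrite gt_eqF.
by rewrite -[leRHS]mulrA ler_wpM2r// divr_ge0// ltW.
Qed.

Lemma scale_gt0 : 0 < scale.
Proof.
rewrite /model_scale ltr_pwDl// ?divr_gt0 ?exprn_gt0//.
by rewrite divr_ge0 ?sqrtr_ge0// mulr_ge0 ?addr_ge0// ltW.
Qed.

Lemma energy_event : exists U : T -> R,
  [/\ measurable_fun setT U, forall w, 0 <= U w, (\int[P]_w (U w)%:E <= 1)%E &
  forall w, `|frob2 (X + s *: E w) - sigma ^+ 2 - (l1 ^+ 2 + l2 ^+ 2)| <=
    c0 * scale * (1 + ln (1 + U w))].
Proof.
have [U [mU U0 UE HU]] := energy_concentration iidE sigma0 X.
exists U; split => // w; rewrite -frob2_signal; apply: le_trans (HU w) _.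
apply: ler_wpM2r; first by rewrite addr_ge0// ln1D_ge0.
apply: ler_wpM2l; first exact: ltW.
apply: le_trans noise_scale_le; rewrite /noise_scale.
apply: ler_wpM2r; first by rewrite invr_ge0 ltW.
rewrite lerD2l ler_peMr// ?mulr_ge0 ?sqrtr_ge0 ?(ltW sigma0)//.
by rewrite -[leLHS]sqrtr1 ler_wsqrtr.
Qed.

Lemma true_residual_event : exists U : T -> R,
  [/\ measurable_fun setT U, forall w, 0 <= U w, (\int[P]_w (U w)%:E <= 1)%E &
  forall w, Res m0 n0 w <= b * (1 + c0 * (2 / rt) * (1 + ln (1 + U w)))].
Proof.
have [U [mU U0 UE HU]] := energy_concentration iidE sigma0 (l2 *: X2).
exists U; split => // w; apply: le_trans (true_residual_le w) _.
have := HU w; rewrite frob2_second_term sqrtr_sqr (gtr0_norm l20) ler_norml => /andP[_ h].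
have L0 : 0 <= 1 + ln (1 + U w) by rewrite addr_ge0// ln1D_ge0.
have h2 : (sigma ^+ 2 + sigma * l2) / rt <= b * (2 / rt).
  rewrite mulrA ler_wpM2r ?invr_ge0 ?(ltW rt0)//.
  by have := sqr_ge0 (sigma - l2); have := sqr_ge0 l2; have := sqr_ge0 sigma; nra.
have h3 : c0 * ((sigma ^+ 2 + sigma * l2) / rt) * (1 + ln (1 + U w)) <=
   c0 * (b * (2 / rt)) * (1 + ln (1 + U w)).
  by apply: ler_wpM2r => //; apply: ler_wpM2l => //; exact: ltW.
have -> : b * (1 + c0 * (2 / rt) * (1 + ln (1 + U w))) =
  b + c0 * (b * (2 / rt)) * (1 + ln (1 + U w)) by ring.
lra.
Qed.

(** Enters only the crude bound on the logarithm, so the gain 1 / rt is given up. *)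
Lemma noise_event : exists U : T -> R,
  [/\ measurable_fun setT U, forall w, 0 <= U w, (\int[P]_w (U w)%:E <= 1)%E &
  forall w, frob2 (s *: E w) <= sigma ^+ 2 * (1 + c0 * (1 + ln (1 + U w)))].
Proof.
have [U [mU U0 UE HU]] := energy_concentration iidE sigma0 0.
exists U; split => // w.
have f0 : frob2 (0 : 'M[R]_(2 ^ M, 2 ^ N)) = 0.
  by apply: big1 => i _; apply: big1 => j _; rewrite mxE expr0n.
have := HU w; rewrite f0 sqrtr0 mulr0 addr0 subr0 add0r ler_norml => /andP[_ h].
have L0 : 0 <= 1 + ln (1 + U w) by rewrite addr_ge0// ln1D_ge0.
have h3 : c0 * (sigma ^+ 2 / rt) * (1 + ln (1 + U w)) <= c0 * sigma ^+ 2 * (1 + ln (1 + U w)).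
  apply: ler_wpM2r => //; apply: ler_wpM2l => //; first exact: ltW.
  by rewrite ler_pdivrMr// ler_peMr ?sqr_ge0.
have -> : sigma ^+ 2 * (1 + c0 * (1 + ln (1 + U w))) =
  sigma ^+ 2 + c0 * sigma ^+ 2 * (1 + ln (1 + U w)) by ring.
lra.
Qed.

(** Two bounds of different use. The first is sharp up to the concentration error. The second is
    pathwise, from the distance of the signal to the rank one matrices and (a + b)^2 <= 2 a^2 + 2
    b^2, and serves the crude bound on the logarithm. *)
Lemma wrong_configuration_event m n : inW M N m0 n0 m n -> exists (q p : nat) (U : T -> R),
  [/\ (1 < p)%N, (q * p)%N = (2 ^ (M + N))%N, (p + q)%N = (2 ^ (m + n) + 2 ^ (M + N - m - n))%N,
   [/\ measurable_fun setT U, forall w, 0 <= U w & (\int[P]_w (U w)%:E <= 1)%E] &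
   forall w, frob2 (X + s *: E w) - (l1 ^+ 2 - G + sigma ^+ 2 / p%:R +
       c0 * scale * (1 + ln (1 + U w) / p%:R)) <= Res m n w /\
     G + l2 ^+ 2 <= 2 * Res m n w + 2 * frob2 (s *: E w)].
Proof.
move=> mnW.
have [q [p [h [hb pq p1 qp [pqs fitP sig]]]]] :=
  configuration_unfolding (ltW l10) (ltW l20) (ltW xi0) mnW (@cosA m n) (@cosB m n).
have [U [mU U0 UE HU]] := unfolding_concentration iidE sigma0 X hb (ltnW p1) pq qp.
exists q, p, U; split => // w.
have [l [u [v [u1 v1 uv e1 e2]]]] := fitP (X + s *: E w).
have gE : l1 ^+ 2 * phiW m0 n0 X1 ^+ 2 + l2 ^+ 2 * phiW m0 n0 X2 ^+ 2 +
   2 * l1 * l2 * phiW m0 n0 X1 * phiW m0 n0 X2 * xi = l1 ^+ 2 - G.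
  by rewrite /signal_gap; ring.
have sv := sig v; rewrite gE v1 mulr1 in sv.
have L0 : 0 <= 1 + ln (1 + U w) / p%:R by rewrite addr_ge0// divr_ge0// ln1D_ge0.
split.
  have := HU w v; rewrite v1 mulr1 => h1.
  have h2 : l ^+ 2 <= sqn (reshape h (X + s *: E w) *m v).
    by rewrite -uv; apply: le_trans (dot_sqr_le _ _) _; rewrite u1 mul1r.
  have h3 : c0 * noise_scale sigma X * (1 + ln (1 + U w) / p%:R) <=
      c0 * scale * (1 + ln (1 + U w) / p%:R).
    by apply: ler_wpM2r => //; apply: ler_wpM2l; [exact: ltW|exact: noise_scale_le].
  have -> : Res m n w = frob2 (X + s *: E w) - l ^+ 2 by exact: e1.
  lra.
have hd : dot u (reshape h X *m v) ^+ 2 <= l1 ^+ 2 - G.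
  by apply: le_trans (dot_sqr_le _ _) _; rewrite u1 mul1r.
have h1 : l1 ^+ 2 + l2 ^+ 2 - (l1 ^+ 2 - G) <= frob2 (reshape h X - l *: (u *m v^T)).
  rewrite frob2_sub_outer// (frob2_reshape _ hb) frob2_signal.
  by have := sqr_ge0 (dot u (reshape h X *m v) - l); nra.
have h2 : frob2 (reshape h X - l *: (u *m v^T)) <= 2 * Res m n w + 2 * frob2 (s *: E w).
  have -> : Res m n w = frob2 (reshape h (X + s *: E w) - l *: (u *m v^T)).
    by rewrite -e2 (frob2_reshape _ hb).
  rewrite -(frob2_reshape (s *: E w) hb) (reshapeD h X (s *: E w)).
  move: (reshape h X) (reshape h (s *: E w)) (l *: (u *m v^T)) => D1 D2 D3.
  rewrite /frob2 !mulr_sumr -big_split; apply: ler_sum => i _ /=.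
  rewrite !mulr_sumr -big_split; apply: ler_sum => j _ /=; rewrite !mxE.
  by have := sqr_ge0 (D1 i j - D3 i j + 2 * D2 i j); nra.
lra.
Qed.

End TwoTermModel.

(** * The loss from the short side, and sums over configurations *)

Section LogFacts.
Context {R : realType}.

Lemma ln_1B_ge (y : R) : 0 <= y -> y <= 1 / 2 -> - (2 * y) <= ln (1 - y).
Proof.
move=> y0 y1; have h : 0 < 1 - y by lra.
have := @ln_le_sub1 R (1 - y)^-1; rewrite invr_gt0 => /(_ h).
rewrite lnV ?posrE// => h2.
suff : (1 - y)^-1 - 1 <= 2 * y by lra.
rewrite lerBlDr -[leLHS]mul1r ler_pdivrMr//; nra.
Qed.

Lemma bernoulli_ineq (y : R) k : 0 <= y -> y <= 1 -> 1 - k%:R * y <= (1 - y) ^+ k.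
Proof.
move=> y0 y1; elim: k => [|k IH]; first by rewrite mul0r subr0 expr0.
rewrite exprS; have h : 0 <= 1 - y by lra.
have := ler_wpM2l h IH; rewrite -natr1; have : 0 <= k%:R * y * y by rewrite !mulr_ge0.
nra.
Qed.

Lemma dvd_pow2_even p k : (1 < p)%N -> (p %| 2 ^ k)%N -> exists j, p = (2 * j)%N.
Proof.
move=> p1 /dvdn_pfactor[//|[|j] _ pj]; first by rewrite pj expn0 in p1.
by exists (2 ^ j)%N; rewrite pj expnS.
Qed.

(* The constant [2 ln 2] of the penalty condition comes from here: equality at [p = 2]. *)
Lemma ln_1B_inv_ge p k : (1 < p)%N -> (p %| 2 ^ k)%N ->
  - (2 * ln 2 / p%:R) <= ln (1 - p%:R^-1) :> R.
Proof.
move=> p1 /(dvd_pow2_even p1)[j pj].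
have j0 : 0 < j%:R :> R by rewrite ltr0n; case: j pj p1 => // ->.
have pR : p%:R = 2 * j%:R :> R by rewrite pj natrM.
set y : R := p%:R^-1.
have y0 : 0 < y by rewrite invr_gt0 pR mulr_gt0.
have y1 : y <= 1 / 2.
  have : 1 <= j%:R :> R by move: j0; rewrite ltr0n ler1n.
  by move=> j1; rewrite /y pR -[1/2]invrK lef_pV2 ?posrE; lra.
(* Bernoulli with exponent j = p / 2: (1 - 1/p)^(p/2) >= 1/2. *)
have := @bernoulli_ineq y j (ltW y0); rewrite (_ : 1 - j%:R * y = 1 / 2); last first.
  by rewrite /y pR; field; rewrite gt_eqF.
move=> /(_ (le_trans y1 _)) h; have {}h : 1 / 2 <= (1 - y) ^+ j by apply: h; lra.
have : ln (1 / 2) <= ln ((1 - y) ^+ j) by rewrite ler_ln ?posrE// exprn_gt0//; lra.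
rewrite lnXn; last lra.
rewrite -[leRHS]mulr_natl div1r lnV ?posrE// => h2.
have -> : - (2 * ln 2 * y) = - ln 2 / j%:R by rewrite /y pR; field; rewrite gt_eqF.
by rewrite ler_pdivrMr// mulrC.
Qed.

Lemma sum_inv_pow2_le n : \sum_(i < n) (2 ^ i)%:R^-1 <= 2 :> R.
Proof.
rewrite (eq_bigr (fun i : 'I_n => (1 / 2) ^+ i)); last first.
  by move=> i _; rewrite natrX div1r exprVn.
by rewrite -(big_mkord xpredT (fun i => (1 / 2) ^+ i)) sum_half_le.
Qed.

(** Each half is a product of two geometric series bounded by 2, the second after reversing the
    indices. The bound does not grow with M and N, so the union over configurations costs only a
    constant. *)
Lemma sum_inv_dims_le M N :
  \sum_(i : 'I_M.+1 * 'I_N.+1) ((2 ^ (i.1 + i.2))%:R^-1 + (2 ^ (M + N - i.1 - i.2))%:R^-1) <= 8 :> R.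
Proof.
have e k : \sum_(i < k.+1) (2 ^ (k - i))%:R^-1 = \sum_(i < k.+1) (2 ^ i)%:R^-1 :> R.
  rewrite (reindex_inj rev_ord_inj)/=; apply: eq_bigr => i _; rewrite subSS subKn//.
  by rewrite -ltnS.
have nn k : 0 <= \sum_(i < k.+1) (2 ^ i)%:R^-1 :> R by apply: sumr_ge0 => i _; rewrite invr_ge0.
have s4 : (\sum_(i < M.+1) (2 ^ i)%:R^-1) * (\sum_(i < N.+1) (2 ^ i)%:R^-1) <= 2 * 2 :> R.
  by apply: ler_pM => //; exact: sum_inv_pow2_le.
have idx (i : 'I_M.+1) (j : 'I_N.+1) : (M + N - i - j = (M - i) + (N - j))%N.
  by move: (val i) (val j) (ltn_ord i) (ltn_ord j) => k l; rewrite !ltnS => kM lN; lia.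
rewrite big_split /= (_ : 8 = 2 * 2 + 2 * 2 :> R); last by lra.
apply: lerD.
  apply: le_trans s4; rewrite big_distrlr/= pair_bigA/=; apply: ler_sum => -[i j] _ /=.
  by rewrite -invfM -natrM -expnD.
rewrite -!e in s4; apply: le_trans s4; rewrite big_distrlr/= pair_bigA/=.
apply: ler_sum => -[i j] _ /=.
by rewrite idx -invfM -natrM -expnD.
Qed.

(** Sum and product determine an unordered pair, so [p] is one of the two powers. *)
Lemma inv_dims_le (p q k l : nat) : (0 < p)%N -> (q * p = 2 ^ (k + l))%N ->
  (p + q = 2 ^ k + 2 ^ l)%N -> p%:R^-1 <= (2 ^ k)%:R^-1 + (2 ^ l)%:R^-1 :> R.
Proof.
move=> p0 qp pq; have pk : (p == 2 ^ k)%N || (p == 2 ^ l)%N.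
  by rewrite expnD in qp; move: (2 ^ k)%N (2 ^ l)%N qp pq => a a' qp pq; nia.
have i0 j : 0 <= (2 ^ j)%:R^-1 :> R by rewrite invr_ge0.
by case/orP: pk => /eqP ->; rewrite ?lerDl ?lerDr.
Qed.

End LogFacts.

(** * Comparison of criteria from abstract residual bounds *)

Section CriterionComparison.
Context {R : realType} {d} {T : measurableType d} (P : probability T R).
Variables (M N m0 n0 : nat) (Res : nat -> nat -> T -> R) (energy noise : T -> R).
Variables (sigma l1 l2 G c scale kappa : R).

Local Notation T0 := ((2 ^ (M + N))%:R : R).
Local Notation rt := (Num.sqrt T0).
Local Notation b := (sigma ^+ 2 + l2 ^+ 2).
Local Notation dims m n := ((2 ^ (m + n))%:R + (2 ^ (M + N - m - n))%:R : R).

Hypotheses (c0 : 0 < c) (scale0 : 0 < scale) (sigma0 : 0 < sigma) (l20 : 0 < l2) (G0 : 0 < G).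
Hypothesis kappa_ge : 2 * ln 2 <= kappa.
Hypothesis in0 : inC M N m0 n0.
Hypothesis mRes : forall m n, inC M N m n -> measurable_fun setT (Res m n).
Hypothesis Res0 : forall m n w, 0 <= Res m n w.
Hypothesis Res_energy : forall m n w, inC M N m n -> Res m n w <= energy w.

Hypothesis energyH : exists U : T -> R, [/\ measurable_fun setT U, forall w, 0 <= U w,
  (\int[P]_w (U w)%:E <= 1)%E &
  forall w, `|energy w - sigma ^+ 2 - (l1 ^+ 2 + l2 ^+ 2)| <= c * scale * (1 + ln (1 + U w))].
Hypothesis trueH : exists U : T -> R, [/\ measurable_fun setT U, forall w, 0 <= U w,
  (\int[P]_w (U w)%:E <= 1)%E &
  forall w, Res m0 n0 w <= b * (1 + c * (2 / rt) * (1 + ln (1 + U w)))].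
Hypothesis noiseH : exists U : T -> R, [/\ measurable_fun setT U, forall w, 0 <= U w,
  (\int[P]_w (U w)%:E <= 1)%E &
  forall w, noise w <= sigma ^+ 2 * (1 + c * (1 + ln (1 + U w)))].
Hypothesis wrongH : forall m n, inW M N m0 n0 m n -> exists (q p : nat) (U : T -> R),
  [/\ (1 < p)%N, (q * p)%N = (2 ^ (M + N))%N, (p + q)%N = (2 ^ (m + n) + 2 ^ (M + N - m - n))%N,
   [/\ measurable_fun setT U, forall w, 0 <= U w & (\int[P]_w (U w)%:E <= 1)%E] &
   forall w, energy w - (l1 ^+ 2 - G + sigma ^+ 2 / p%:R +
       c * scale * (1 + ln (1 + U w) / p%:R)) <= Res m n w /\
     G + l2 ^+ 2 <= 2 * Res m n w + 2 * noise w].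
Hypothesis ballH : forall m n, inC M N m n -> exists B : T -> \bar R,
  [/\ measurable_fun setT B, forall w, (0 <= B w)%E, (\int[P]_w B w <= 48%:E)%E &
    forall w mu, (B w <= mu%:E)%E -> 0 < mu /\ sigma ^+ 2 <= 4 * Res m n w * mu ^+ 4].

Let T01 : 1 <= T0. Proof. by rewrite ler1n expn_gt0. Qed.
Let rt1 : 1 <= rt. Proof. by rewrite -[leLHS]sqrtr1 ler_wsqrtr. Qed.
Let rt0 : 0 < rt. Proof. exact: lt_le_trans ltr01 rt1. Qed.
Let s2 : 0 < sigma ^+ 2. Proof. exact: exprn_gt0. Qed.
Let b0 : 0 < b. Proof. by rewrite ltr_pwDl// sqr_ge0. Qed.
Let Gb0 : 0 < G + b. Proof. exact: addr_gt0. Qed.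

Let Res_pos m n w mu : 0 < mu -> sigma ^+ 2 <= 4 * Res m n w * mu ^+ 4 -> 0 < Res m n w.
Proof.
move=> mu0 h; rewrite lt_neqAle Res0 andbT; apply/eqP => h0.
by move: h; rewrite -h0 mulr0 mul0r; move: s2; lra.
Qed.

(** From above ln x <= x - 1 and the energy; from below the small-ball bound, through ln (1 + 4
    mu^4) <= 16 (1 + mu). Where [B] is infinite, so is the dominating function. *)
Lemma integrable_ln_residual m n : inC M N m n ->
  P.-integrable setT (fun w => (ln (Res m n w))%:E).
Proof.
move=> mnC; have [B [mB B0 BE HB]] := ballH mnC.
have [U [mU U0 UE HU]] := energyH.
pose k := `|ln (sigma ^+ 2)| + 16 + (sigma ^+ 2 + (l1 ^+ 2 + l2 ^+ 2) + c * scale).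
have cs0 : 0 <= c * scale by rewrite mulr_ge0// ltW.
have k0 : 0 <= k.
  by rewrite /k !addr_ge0 ?sqr_ge0.
pose F w : \bar R := (k%:E + ((c * scale)%:E * (U w)%:E + 16%:E * B w))%E.
have mU' : measurable_fun setT (fun w => (U w)%:E) by exact/measurable_EFinP.
have mF1 : measurable_fun setT (fun w => (c * scale)%:E * (U w)%:E)%E by exact: emeasurable_funM.
have mF2 : measurable_fun setT (fun w => 16%:E * B w)%E by exact: emeasurable_funM.
have F10 w : (0 <= (c * scale)%:E * (U w)%:E)%E by rewrite mule_ge0// lee_fin.
have F20 w : (0 <= 16%:E * B w)%E by rewrite mule_ge0.
apply: (@integrable_dominated _ _ _ _ _ F (k + (c * scale + 16 * 48))).
- by apply: (measurableT_comp (@measurable_ln R)); exact: mRes.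
- by apply: emeasurable_funD => //; exact: emeasurable_funD.
- move=> w; rewrite /F; have := HB w.
  case EB : (B w) => [mu| |]; last by have := B0 w; rewrite EB.
    move=> /(_ mu (lexx _))[mu0 hmu]; have rp := Res_pos mu0 hmu.
    rewrite -EFinM -!EFinD lee_fin.
    have L0 : ln (1 + U w) <= U w by apply: le_ln1Dx; have := U0 w; lra.
    have csU : c * scale * ln (1 + U w) <= c * scale * U w by rewrite ler_wpM2l.
    have up : ln (Res m n w) <= k + (c * scale * U w + 16 * mu).
      apply: le_trans (ln_le_sub1 rp) _; have := Res_energy w mnC.
      have := HU w; rewrite ler_norml => /andP[_]; rewrite mulrDr mulr1.
      by rewrite /k; have := normr_ge0 (ln (sigma ^+ 2)); lra.
    have m4 : 0 <= 4 * mu ^+ 4 by rewrite mulr_ge0// exprn_ge0// ltW.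
    have lm : ln (1 + 4 * mu ^+ 4) <= 16 * (1 + mu).
      rewrite -(@ler_sqr _ (ln _)) ?nnegrE ?ln1D_ge0 ?mulr_ge0 ?addr_ge0 ?(ltW mu0)//.
      apply: le_trans (ln_pow4_sqr_le (ltW mu0)) _.
      by rewrite exprMn sqrrD expr1n; have := sqr_ge0 mu; lra.
    have lo : ln (sigma ^+ 2) <= ln (Res m n w) + ln (1 + 4 * mu ^+ 4).
      rewrite -lnM ?posrE//; last lra.
      rewrite ler_ln ?posrE ?mulr_gt0//; last lra.
      by rewrite mulrDr mulr1; move: rp hmu; lra.
    rewrite ler_norml; apply/andP; split => //.
    have : 0 <= c * scale * U w by rewrite mulr_ge0.
    have := ler_norm (- ln (sigma ^+ 2)); rewrite normrN.
    have := ler_norm (ln (sigma ^+ 2)).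
    have := sqr_ge0 l1; have := sqr_ge0 l2; rewrite /k; move: s2 lo lm cs0; lra.
  by rewrite gt0_muley ?lte_fin// -EFinM !addey// leey.
- apply: integral_add_le => //; first exact: emeasurable_funD.
  + by move=> w; rewrite adde_ge0.
  + by rewrite integral_cst_prob.
  + apply: integral_add_le => //; first exact: integral_EFin_le.
    by apply: integral_scale_le.
Qed.

Lemma true_log_residual_le :
  (\int[P]_w (ln (Res m0 n0 w))%:E <= (ln b + (4 * c + 48) / rt)%:E)%E.
Proof.
have [B [mB B0 BE HB]] := ballH in0; have [U [mU U0 UE HU]] := trueH.
pose a := c * (2 / rt).
have a0 : 0 < a by rewrite /a mulr_gt0// divr_gt0.
(* [ln] is 0 at 0, so an upper bound could fail at a vanishing residual. The term B / rt costs only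
   48 / rt in mean and makes the bound trivial wherever the residual is not known to be positive. *)
pose F w : \bar R := (a%:E + (a%:E * (U w)%:E + (rt^-1)%:E * B w))%E.
have mU' : measurable_fun setT (fun w => (U w)%:E) by exact/measurable_EFinP.
have mF1 : measurable_fun setT (fun w => a%:E * (U w)%:E)%E by exact: emeasurable_funM.
have mF2 : measurable_fun setT (fun w => (rt^-1)%:E * B w)%E by exact: emeasurable_funM.
have ri : 0 < rt^-1 by rewrite invr_gt0.
have F10 w : (0 <= a%:E * (U w)%:E)%E by rewrite mule_ge0// lee_fin// ltW.
have F20 w : (0 <= (rt^-1)%:E * B w)%E by rewrite mule_ge0// lee_fin ltW.
have mF12 := emeasurable_funD mF1 mF2.
apply: (@integral_le_cst_add _ _ _ _ _ F).
- exact: integrable_ln_residual.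
- exact: emeasurable_funD.
- by move=> w; rewrite /F !adde_ge0// lee_fin ltW.
- move=> w; rewrite /F; have := HB w.
  case EB : (B w) => [mu| |]; last by have := B0 w; rewrite EB.
    move=> /(_ mu (lexx _))[mu0 hmu]; have rp := Res_pos mu0 hmu.
    rewrite -!EFinM -!EFinD lee_fin.
    have L0 : ln (1 + U w) <= U w by apply: le_ln1Dx; have := U0 w; lra.
    have aU : a * ln (1 + U w) <= a * U w by rewrite ler_wpM2l// ltW.
    have rb : 0 < Res m0 n0 w / b by rewrite divr_gt0.
    have := ln_le_sub1 rb; rewrite ln_div ?posrE// => h.
    have h2 : Res m0 n0 w / b <= 1 + a * (1 + ln (1 + U w)).
      by rewrite ler_pdivrMr// mulrC; exact: HU.
    have : 0 <= rt^-1 * mu by rewrite mulr_ge0// ltW.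
    rewrite mulrDr mulr1 in h2; lra.
  by rewrite gt0_muley ?lte_fin// -EFinM !addey// leey.
- rewrite (_ : (4 * c + 48) / rt = a + (a + rt^-1 * 48)); last first.
    by rewrite /a; field; rewrite gt_eqF.
  apply: integral_add_le => //.
  + by move=> w; rewrite lee_fin ltW.
  + by move=> w; rewrite adde_ge0.
  + by rewrite integral_cst_prob.
  + apply: integral_add_le => //; first by apply: integral_EFin_le => //; exact: ltW.
    by apply: integral_scale_le => //; exact: ltW.
Qed.

(** Leading order of the lower bound on the residual of a wrong configuration with short side [p]:
    the fit may also capture sigma^2 / p of the noise. *)
Let level (p : nat) := G + l2 ^+ 2 + sigma ^+ 2 * (1 - p%:R^-1).

Let level_ge p : (1 < p)%N -> (G + b) * (1 - p%:R^-1) <= level p /\ (G + b) / 2 <= level p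
  /\ level p <= G + l2 ^+ 2 + sigma ^+ 2.
Proof.
move=> p1; have p2 : 2 <= p%:R :> R by rewrite ler_nat.
have y0 : 0 <= p%:R^-1 :> R by rewrite invr_ge0.
have y1 : p%:R^-1 <= 1 / 2 :> R by rewrite -[1/2]invrK lef_pV2 ?posrE; lra.
have := sqr_ge0 l2; rewrite /level; move: s2 G0 => ? ? ?.
have : 0 <= (G + l2 ^+ 2) * p%:R^-1 by rewrite mulr_ge0//; lra.
have : 0 <= sigma ^+ 2 * (1 / 2 - p%:R^-1) by rewrite mulr_ge0//; lra.
have : 0 <= sigma ^+ 2 * p%:R^-1 by rewrite mulr_ge0//; lra.
lra.
Qed.

Let ln_level p : (1 < p)%N -> (p %| 2 ^ (M + N))%N -> ln (G + b) - 2 * ln 2 / p%:R <= ln (level p).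
Proof.
move=> p1 pd; have [h1 [h2 _]] := level_ge p1.
have p2 : 2 <= p%:R :> R by rewrite ler_nat.
have y1 : p%:R^-1 <= 1 / 2 :> R by rewrite -[1/2]invrK lef_pV2 ?posrE; lra.
apply: le_trans (_ : ln ((G + b) * (1 - p%:R^-1)) <= _).
  by rewrite lnM ?posrE//; [have := @ln_1B_inv_ge R p (M + N) p1 pd; lra|lra].
rewrite ler_ln ?posrE//; first by rewrite mulr_gt0//; lra.
by apply: lt_le_trans h2; rewrite divr_gt0.
Qed.

(** 52 = 1 + 3 + 48 bounds the mean of 1, three auxiliary variables and the small-ball variable; the
    other factor comes from [log_residual_le]. *)
Definition log_constant : R := 52 * (48 * (c ^+ 2 + (3 + c) ^+ 2 + 16)).

(** [log_residual_le] with a = [level p] and e = [scale] / a bounds ln a - ln Res by e times a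
    linear expression in the auxiliary variables, whose means are known; [ln_level] and a >= (G + b)
    / 2 then remove a. *)
Lemma wrong_log_residual_ge m n : inW M N m0 n0 m n -> exists q p : nat,
  [/\ (1 < p)%N, (q * p)%N = (2 ^ (M + N))%N,
      (p + q)%N = (2 ^ (m + n) + 2 ^ (M + N - m - n))%N &
  ((ln (G + b) - 2 * ln 2 / p%:R - 2 * log_constant * (scale / (G + b)))%:E <=
     \int[P]_w (ln (Res m n w))%:E)%E].
Proof.
move=> mnW; have [q [p [U1 [p1 qp pqs [mU1 U10 U1E] H1]]]] := wrongH mnW.
exists q, p; split => //.
have mnC : inC M N m n by case/andP: mnW.
have [B [mB B0 BE HB]] := ballH mnC.
have [U3 [mU3 U30 U3E H3]] := energyH; have [U0 [mU0 U00 U0E H0]] := noiseH.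
have p0 : 0 < p%:R :> R by rewrite ltr0n ltnW.
have pR : 1 <= p%:R :> R by rewrite ler1n ltnW.
have [a1 [a2 a3]] := level_ge p1; set a := level p in a1 a2 a3.
have aa : 0 < a by apply: lt_le_trans a2; rewrite divr_gt0.
pose K := 48 * (c ^+ 2 + (3 + c) ^+ 2 + 16).
have K0 : 0 < K by rewrite /K; have := sqr_ge0 c; have := sqr_ge0 (3 + c); lra.
pose e := scale / a; have e0 : 0 < e by rewrite divr_gt0.
pose S w : \bar R := (1 + ((U1 w)%:E + ((U3 w)%:E + ((U0 w)%:E + B w))))%E.
pose F w : \bar R := ((e * K)%:E * S w)%E.
have eK : 0 < e * K by exact: mulr_gt0.
have mE (U : T -> R) : measurable_fun setT U -> measurable_fun setT (fun w => (U w)%:E).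
  by move=> ?; exact/measurable_EFinP.
have mS1 : measurable_fun setT (fun w => (U0 w)%:E + B w)%E.
  by apply: emeasurable_funD => //; exact: mE.
have mS2 : measurable_fun setT (fun w => (U3 w)%:E + ((U0 w)%:E + B w))%E.
  by apply: emeasurable_funD => //; exact: mE.
have mS3 : measurable_fun setT (fun w => (U1 w)%:E + ((U3 w)%:E + ((U0 w)%:E + B w)))%E.
  by apply: emeasurable_funD => //; exact: mE.
have mS : measurable_fun setT S by exact: emeasurable_funD.
have S1 w : (0 <= (U0 w)%:E + B w)%E by rewrite adde_ge0// lee_fin.
have S2 w : (0 <= (U3 w)%:E + ((U0 w)%:E + B w))%E by rewrite adde_ge0// lee_fin.
have S3 w : (0 <= (U1 w)%:E + ((U3 w)%:E + ((U0 w)%:E + B w)))%E by rewrite adde_ge0// lee_fin.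
have S0 w : (0 <= S w)%E by rewrite adde_ge0.
have SE : (\int[P]_w S w <= (52%:R)%:E)%E.
  rewrite (_ : 52%:R = 1 + (1 + (1 + (1 + 48))) :> R); last by lra.
  apply: integral_add_le => //; first by rewrite integral_cst_prob.
  do 3 (apply: integral_add_le => //; try exact: mE).
have ilr := integrable_ln_residual mnC.
have iN : P.-integrable setT (fun w => (- ln (Res m n w))%:E).
  by under eq_fun do rewrite EFinN; exact: integrableN.
have main : (\int[P]_w (- ln (Res m n w))%:E <= (- ln a + e * K * 52)%:E)%E.
  apply: (@integral_le_cst_add _ _ _ _ _ F) => //.
  - by apply: emeasurable_funM.
  - by move=> w; rewrite mule_ge0// lee_fin ltW.
  - move=> w; rewrite /F /S; have := HB w.
    case EB : (B w) => [mu| |]; last by have := B0 w; rewrite EB.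
      move=> /(_ mu (lexx _))[mu0 hmu]; have rp := Res_pos mu0 hmu.
      rewrite -!EFinD lee_fin.
      have [h1 h2] := H1 w; have := H3 w; rewrite ler_norml => /andP[h3 _].
      have L1 := ln1D_ge0 (U10 w).
      have L1p : ln (1 + U1 w) / p%:R <= ln (1 + U1 w) by rewrite ler_pdivrMr// ler_peMr.
      have hx : a * (1 - e * (c * (2 + ln (1 + U1 w) / p%:R + ln (1 + U3 w)))) <= Res m n w.
        have -> : a * (1 - e * (c * (2 + ln (1 + U1 w) / p%:R + ln (1 + U3 w)))) =
          a - c * scale * (1 + ln (1 + U1 w) / p%:R) - c * scale * (1 + ln (1 + U3 w)).
          by rewrite /e; field; rewrite !gt_eqF.
        rewrite /a /level; move: h1 h3; set t1 := c * scale * _; set t2 := c * scale * _.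
        lra.
      have hg : G + l2 ^+ 2 <= 2 * Res m n w + 2 * (sigma ^+ 2 * (1 + c * (1 + ln (1 + U0 w)))).
        by apply: le_trans h2 _; rewrite lerD2l ler_pM2l.
      have := @log_residual_le _ c a (Res m n w) e (sigma ^+ 2) (G + l2 ^+ 2)
         (U1 w) (U3 w) (U0 w) (ln (1 + U1 w) / p%:R) mu c0 aa rp (ltW e0) (ltW s2)
         (U10 w) (U30 w) (U00 w) (ltW mu0) (divr_ge0 L1 (ltW p0)) L1p hx a3 hg hmu.
      rewrite -/K => hh; have -> : e * K * (1 + (U1 w + (U3 w + (U0 w + mu)))) =
         e * (K * (1 + U1 w + U3 w + U0 w + mu)) by ring.
      lra.
    by rewrite !addey// gt0_muley ?lte_fin// addey// leey.
  - by apply: integral_scale_le => //; exact: ltW.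
have fin : (\int[P]_w (ln (Res m n w))%:E)%E \is a fin_num by exact: integrable_fin_num.
have lowE : ((ln a - e * K * 52)%:E <= \int[P]_w (ln (Res m n w))%:E)%E.
  move: main; under eq_integral do rewrite EFinN.
  rewrite integralN//; last exact: integrable_add_def.
  by rewrite leeNl -EFinN opprD opprK.
apply: le_trans lowE; rewrite lee_fin.
have pd : (p %| 2 ^ (M + N))%N by rewrite -qp dvdn_mull.
have := ln_level p1 pd; rewrite -/a.
have : e * K * 52 <= 2 * log_constant * (scale / (G + b)).
  have -> : 2 * log_constant * (scale / (G + b)) = (2 * scale / (G + b)) * K * 52.
    by rewrite /log_constant -/K; ring.
  rewrite ler_pM2r// ler_pM2r// /e ler_pdivrMr//.
  have := ler_wpM2l (_ : 0 <= 2 * scale / (G + b)) a2.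
  rewrite (_ : 2 * scale / (G + b) * ((G + b) / 2) = scale); last by field; rewrite gt_eqF.
  by apply; rewrite divr_ge0 ?mulr_ge0// ltW.
lra.
Qed.

Definition criterion m n w : R := T0 * ln (Res m n w) + kappa * dims m n.

Lemma integral_criterion m n : inC M N m n ->
  (\int[P]_w (criterion m n w)%:E =
   T0%:E * \int[P]_w (ln (Res m n w))%:E + (kappa * dims m n)%:E)%E.
Proof.
move=> mnC; have i1 := integrable_ln_residual mnC.
rewrite /criterion; under eq_integral do rewrite EFinD EFinM.
rewrite integralD//.
- by rewrite integralZl// integral_cst_prob.
- exact: integrableZl.
- exact: finite_measure_integrable_cst.
Qed.

Lemma expected_gap m n : inW M N m0 n0 m n ->
  ((T0 * (ln ((G + b) / b) - 2 * log_constant * (scale / (G + b)) - (4 * c + 48) / rt)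
      - kappa * dims m0 n0)%:E <=
   \int[P]_w (criterion m n w)%:E - \int[P]_w (criterion m0 n0 w)%:E)%E.
Proof.
move=> mnW; have mnC : inC M N m n by case/andP: mnW.
have [q [p [p1 qp pqs h1]]] := wrong_log_residual_ge mnW.
have h2 := true_log_residual_le.
rewrite !integral_criterion//.
have f1 : (\int[P]_w (ln (Res m n w))%:E)%E \is a fin_num.
  by apply: integrable_fin_num => //; exact: integrable_ln_residual.
have f2 : (\int[P]_w (ln (Res m0 n0 w))%:E)%E \is a fin_num.
  by apply: integrable_fin_num => //; exact: integrable_ln_residual.
move: h1 h2; rewrite -(fineK f1) -(fineK f2) -!EFinM -!EFinD !lee_fin.
move: (fine _) (fine _) => I1 I2 h1 h2.
have T00 : 0 <= T0 by move: T01; lra.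
have p0 : 0 < p%:R :> R by rewrite ltr0n ltnW.
have l2p : 0 <= 2 * ln 2 :> R by rewrite mulr_ge0// ln_ge0//; lra.
(* The loss 2 ln 2 / p, multiplied by T0 = q p, is 2 ln 2 q, which the penalty kappa (p + q) of the
   wrong configuration covers. *)
have ks : 2 * ln 2 * q%:R <= kappa * dims m n.
  have -> : dims m n = p%:R + q%:R by rewrite -!natrD pqs.
  apply: (@le_trans _ _ (kappa * q%:R)); first by rewrite ler_wpM2r.
  by rewrite ler_wpM2l ?lerDr//; apply: le_trans kappa_ge.
have Tp : T0 * (2 * ln 2 / p%:R) = 2 * ln 2 * q%:R.
  by rewrite -qp natrM; field; rewrite gt_eqF.
rewrite ln_div ?posrE//.
have := ler_wpM2l T00 h1; have := ler_wpM2l T00 h2.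
rewrite !(mulrDr, mulrN) Tp; lra.
Qed.

(** Stated for every pair, with the empty event outside [inW], so that [choice] selects all the
    events at once. The tail is expressed through both dimensions of the rearrangement, whose
    inverses are summable. *)
Lemma wrong_bad_event x m n : 0 < x -> exists F : set T,
  [/\ measurable F, (P F <= (2 / x * ((2 ^ (m + n))%:R^-1 + (2 ^ (M + N - m - n))%:R^-1))%:E)%E &
   inW M N m0 n0 m n -> exists p q : nat, [/\ (1 < p)%N, (q * p)%N = (2 ^ (M + N))%N,
     (p + q)%N = (2 ^ (m + n) + 2 ^ (M + N - m - n))%N &
     forall w, ~ F w -> energy w - (l1 ^+ 2 - G + sigma ^+ 2 / p%:R + c * scale * (1 + x))
        <= Res m n w]].
Proof.
move=> x0; have r0 : 0 <= 2 / x * ((2 ^ (m + n))%:R^-1 + (2 ^ (M + N - m - n))%:R^-1).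
  by rewrite mulr_ge0 ?divr_ge0 ?addr_ge0 ?invr_ge0// ltW.
have [mnW|mnW] := boolP (inW M N m0 n0 m n); last first.
  by exists set0; split => //; rewrite measure0 lee_fin.
have [q [p [U [p1 qp pqs [mU U0 UE] H]]]] := wrongH mnW.
have p0 : 0 < p%:R :> R by rewrite ltr0n ltnW.
exists [set w | x < ln (1 + U w) / p%:R]; split.
- rewrite (_ : [set w | _] = (fun w => ln (1 + U w) / p%:R) @^-1` `]x, +oo[).
    rewrite -[X in measurable X]setTI.
    apply: (measurable_funM _ (measurable_cst _)) => //.
    apply: (measurableT_comp (@measurable_ln R)); exact: measurable_funD.
  by apply/seteqP; split => w /=; rewrite in_itv/= andbT.
- apply: le_trans (prob_ln1D_gt_le mU U0 UE p0 x0) _.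
  rewrite lee_fin invfM mulrA ler_wpM2l ?divr_ge0 ?(ltW x0)//.
  have [/and4P[mM nN _ _] _] := andP mnW.
  apply: (inv_dims_le (ltnW p1) _ pqs).
  by rewrite qp -subnDA subnKC ?leq_add.
- move=> _; exists p, q; split => // w /negP; rewrite -leNgt => Ux.
  apply: le_trans (H w).1; rewrite lerD2l lerN2 lerD2l.
  by apply: ler_wpM2l; [rewrite mulr_ge0// ltW|rewrite lerD2l].
Qed.

(** Deterministic comparison off the bad events. The assumption on [scale] makes the relative error
    D / a at most 1/2, the range of [ln_1B_ge]; the assumption after it says that all losses
    together stay below the gap. *)
Lemma criterion_lt x w m n p q : 0 < x ->
  8 * c * (1 + x) * scale <= G + b ->
  T0 * (8 * c * (1 + x) * (scale / (G + b)) + 2 * c * (1 + x) / rt) + kappa * dims m0 n0 <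
    T0 * ln ((G + b) / b) ->
  (1 < p)%N -> (q * p)%N = (2 ^ (M + N))%N -> (p + q)%N = (2 ^ (m + n) + 2 ^ (M + N - m - n))%N ->
  0 < Res m0 n0 w -> Res m0 n0 w <= b * (1 + c * (2 / rt) * (1 + x)) ->
  sigma ^+ 2 + (l1 ^+ 2 + l2 ^+ 2) - c * scale * (1 + x) <= energy w ->
  energy w - (l1 ^+ 2 - G + sigma ^+ 2 / p%:R + c * scale * (1 + x)) <= Res m n w ->
  criterion m0 n0 w < criterion m n w.
Proof.
move=> x0 hs hT p1 qp pqs r0 r0x ew ewx.
have T00 : 0 <= T0 by move: T01; lra.
have p0 : 0 < p%:R :> R by rewrite ltr0n ltnW.
have l2p : 0 <= 2 * ln 2 :> R by rewrite mulr_ge0// ln_ge0//; lra.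
have ks : 2 * ln 2 * q%:R <= kappa * dims m n.
  have -> : dims m n = p%:R + q%:R by rewrite -!natrD pqs.
  apply: (@le_trans _ _ (kappa * q%:R)); first by rewrite ler_wpM2r.
  by rewrite ler_wpM2l ?lerDr//; apply: le_trans kappa_ge.
have Tp : T0 * (2 * ln 2 / p%:R) = 2 * ln 2 * q%:R.
  by rewrite -qp natrM; field; rewrite gt_eqF.
have [a1 [a2 a3]] := level_ge p1.
have pd : (p %| 2 ^ (M + N))%N by rewrite -qp dvdn_mull.
have la := ln_level p1 pd; set a := level p in a1 a2 a3 la.
have a0 : 0 < a by apply: lt_le_trans a2; rewrite divr_gt0.
pose D := 2 * c * (1 + x) * scale.
have D0 : 0 <= D by rewrite /D !mulr_ge0 ?addr_ge0 ?ltW.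
have Da : D / a <= 1 / 2 by rewrite ler_pdivrMr//; move: hs a2; rewrite /D; lra.
have aD : a * (1 - D / a) <= Res m n w.
  rewrite mulrBr mulr1 mulrCA divff ?mulr1 ?gt_eqF//.
  have -> : D = c * scale * (1 + x) + c * scale * (1 + x) by rewrite /D; ring.
  rewrite /a /level; lra.
have h : 0 < 1 - D / a by lra.
have lR : ln (G + b) - 2 * ln 2 / p%:R - 8 * c * (1 + x) * (scale / (G + b)) <= ln (Res m n w).
  apply: (@le_trans _ _ (ln (a * (1 - D / a)))); last first.
    by rewrite ler_ln ?posrE// ?mulr_gt0//; apply: lt_le_trans aD; rewrite mulr_gt0.
  rewrite lnM ?posrE//.
  have := ln_1B_ge (divr_ge0 D0 (ltW a0)) Da.
  have : D / a <= 2 * D / (G + b).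
    rewrite ler_pdivrMr// mulrAC ler_pdivlMr//.
    by have := ler_wpM2l D0 a2; lra.
  have -> : 8 * c * (1 + x) * (scale / (G + b)) = 2 * (2 * D / (G + b)) by rewrite /D; ring.
  lra.
have l0 : ln (Res m0 n0 w) <= ln b + 2 * c * (1 + x) / rt.
  have rb : 0 < Res m0 n0 w / b by rewrite divr_gt0.
  have := ln_le_sub1 rb; rewrite ln_div ?posrE// => h1.
  have : Res m0 n0 w / b <= 1 + c * (2 / rt) * (1 + x) by rewrite ler_pdivrMr// mulrC.
  have -> : 2 * c * (1 + x) / rt = c * (2 / rt) * (1 + x) by ring.
  lra.
rewrite /criterion; move: hT; rewrite ln_div ?posrE//.
have := ler_wpM2l T00 lR; have := ler_wpM2l T00 l0.
rewrite !(mulrDr, mulrN) Tp; lra.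
Qed.

Lemma selection_probability x : 0 < x ->
  8 * c * (1 + x) * scale <= G + b ->
  T0 * (8 * c * (1 + x) * (scale / (G + b)) + 2 * c * (1 + x) / rt) + kappa * dims m0 n0 <
    T0 * ln ((G + b) / b) ->
  let A := [set w | forall m n, inW M N m0 n0 m n -> criterion m0 n0 w < criterion m n w] in
  measurable A /\ ((1 - 68 / x)%:E <= P A)%E.
Proof.
move=> x0 hs hT A.
have mcrit m n : inC M N m n -> measurable_fun setT (criterion m n).
  move=> mnC; apply: measurable_funD => //; apply: measurable_funM => //.
  by apply: (measurableT_comp (@measurable_ln R)); exact: mRes.
have mA : measurable A.
  rewrite (_ : A = \bigcap_(i in [set: 'I_M.+1 * 'I_N.+1])
      [set w | inW M N m0 n0 i.1 i.2 -> criterion m0 n0 w < criterion i.1 i.2 w]).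
    apply: fin_bigcap_measurable; first exact: finite_finset.
    move=> i _; have [iW|iW] := boolP (inW M N m0 n0 i.1 i.2); last first.
      by rewrite (_ : [set w | _] = setT)//; apply/seteqP; split.
    rewrite (_ : [set w | _] = [set w | criterion m0 n0 w < criterion i.1 i.2 w]); last first.
      by apply/seteqP; split => w /=; [apply|move=> ? _].
    rewrite (_ : [set w | _] = (fun w => criterion m0 n0 w < criterion i.1 i.2 w) @^-1` [set true]).
      rewrite -[X in measurable X]setTI.
      by apply: measurable_fun_ltr => //; apply: mcrit => //; case/andP: iW.
    by apply/seteqP; split.
  apply/seteqP; split => [w Aw i _|w Aw m n mnW]; first exact: Aw.
  have [/and4P[mM nN _ _] _] := andP mnW.
  exact: Aw (Ordinal (mM : m < M.+1)%N, Ordinal (nN : n < N.+1)%N) I mnW.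
split => //; have tail (U : T -> R) : measurable_fun setT U -> (forall w, 0 <= U w) ->
    (\int[P]_w (U w)%:E <= 1)%E -> exists F : set T, [/\ measurable F, (P F <= (2 / x)%:E)%E &
    forall w, ~ F w -> ln (1 + U w) <= x].
  move=> mU U0 UE; exists [set w | x < ln (1 + U w) / 1]; split.
  - rewrite (_ : [set w | _] = (fun w => ln (1 + U w)) @^-1` `]x, +oo[).
      rewrite -[X in measurable X]setTI.
      by apply: (measurableT_comp (@measurable_ln R)) => //; exact: measurable_funD.
    by apply/seteqP; split => w /=; rewrite in_itv/= divr1 andbT.
  - by have := prob_ln1D_gt_le mU U0 UE ltr01 x0; rewrite mulr1.
  - by move=> w /negP; rewrite -leNgt divr1.
have [U3 [mU3 U30 U3E H3]] := energyH; have [F3 [mF3 PF3 HF3]] := tail _ mU3 U30 U3E.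
have [U2 [mU2 U20 U2E H2]] := trueH; have [F2 [mF2 PF2 HF2]] := tail _ mU2 U20 U2E.
have [B [mB B0 BE HB]] := ballH in0.
pose F1 := [set w | (x%:E < B w)%E].
have mF1 : measurable F1 by rewrite -[F1]setTI; exact: emeasurable_fun_o_infty.
have PF1 : (P F1 <= (48 / x)%:E)%E by exact: prob_gt_le.
have [F HF] := choice (fun mn : nat * nat => wrong_bad_event mn.1 mn.2 x0).
pose F0 := \big[setU/set0]_(i : 'I_M.+1 * 'I_N.+1) F (val i.1, val i.2).
have mF0 : measurable F0 by apply: bigsetU_measurable => i _; have [] := HF (val i.1, val i.2).
have PF0 : (P F0 <= (16 / x)%:E)%E.
  pose a (i : 'I_M.+1 * 'I_N.+1) : R :=
    2 / x * ((2 ^ (i.1 + i.2))%:R^-1 + (2 ^ (M + N - i.1 - i.2))%:R^-1).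
  apply: (@le_trans _ _ (\sum_i a i)%:E).
    by apply: prob_bigsetU_le => i; have [] := HF (val i.1, val i.2).
  rewrite lee_fin -mulr_sumr; have := ler_wpM2l (divr_ge0 (ler0n R 2) (ltW x0)) (sum_inv_dims_le M N).
  by move/le_trans; apply; rewrite mulrAC -natrM.
have sub : ~` A `<=` F0 `|` (F1 `|` (F2 `|` F3)).
  move=> w; apply: contra_notP => /not_orP[nF0 /not_orP[nF1 /not_orP[nF2 nF3]]] m n mnW.
  have [/and4P[mM nN _ _] _] := andP mnW.
  have [_ _ /(_ mnW)[p [q [p1 qp pqs Hw]]]] := HF (m, n).
  have Bx : (B w <= x%:E)%E by rewrite leNgt; exact/negP.
  have [_ sR] := HB w x Bx.
  have x1 : 0 <= c * scale by rewrite mulr_ge0// ltW.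
  apply: (criterion_lt x0 hs hT p1 qp pqs).
  - exact: Res_pos x0 sR.
  - apply: le_trans (H2 w) _; rewrite ler_pM2l// lerD2l; apply: ler_wpM2l.
      by rewrite mulr_ge0 ?divr_ge0// ltW.
    by rewrite lerD2l HF2.
  - have := H3 w; rewrite ler_norml => /andP[+ _].
    have : c * scale * (1 + ln (1 + U3 w)) <= c * scale * (1 + x).
      by apply: ler_wpM2l => //; rewrite lerD2l HF3.
    lra.
  - apply: Hw => Fw; apply: nF0; rewrite /F0 -bigcup_seq.
    exists (Ordinal (mM : m < M.+1)%N, Ordinal (nN : n < N.+1)%N) => //=.
    exact: mem_index_enum.
have PAc : (P (~` A) <= (68 / x)%:E)%E.
  apply: le_trans (_ : P (F0 `|` (F1 `|` (F2 `|` F3))) <= _)%E.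
    apply: le_measure => //; rewrite inE; first exact: measurableC.
    by apply: measurableU => //; apply: measurableU => //; exact: measurableU.
  (* 16 = 2 * 8 for the wrong configurations, by [sum_inv_dims_le]; 48 for the small ball at the
     true one; 2 each for the true residual and the energy. *)
  rewrite (_ : 68 / x = 16 / x + (48 / x + (2 / x + 2 / x))); last by field; rewrite gt_eqF.
  rewrite EFinD; apply: le_trans (measureU2 _ _ _) _ => //.
    by apply: measurableU => //; exact: measurableU.
  apply: leeD => //; rewrite EFinD; apply: le_trans (measureU2 _ _ _) _ => //.
    exact: measurableU.
  apply: leeD => //; rewrite EFinD; apply: le_trans (measureU2 _ _ _) _ => //.
  exact: leeD.
have := probability_setC P mA; have PA : P A \is a fin_num by exact: fin_num_measure.
move: PAc => /[swap] ->; rewrite -(fineK PA) -EFinB !lee_fin; lra.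
Qed.

End CriterionComparison.

(** * Finite-sample bounds for the information criterion *)

Section ModelSelection.
Context {R : realType} {d} {T : measurableType d} (P : probability T R).
Variables (M N m0 n0 : nat) (l1 l2 sigma xi kappa : R).
Variables (A1 A2 : 'M[R]_(2 ^ m0, 2 ^ n0)) (B1 B2 : 'M[R]_(2 ^ (M - m0), 2 ^ (N - n0))).
Variable E : T -> 'M[R]_(2 ^ M, 2 ^ N).
Hypotheses (iidE : iid_gauss_mx P E) (m0M : (m0 <= M)%N) (n0N : (n0 <= N)%N).
Hypotheses (l21 : l2 <= l1) (l20 : 0 < l2) (sigma0 : 0 < sigma) (xi0 : 0 < xi).
Hypotheses (trA : [/\ \tr (A1 *m A1^T) = 1, \tr (A2 *m A2^T) = 1,
                 \tr (A1 *m A2^T) = 0 & \tr (A2 *m A1^T) = 0])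
           (trB : [/\ \tr (B1 *m B1^T) = 1, \tr (B2 *m B2^T) = 1,
                 \tr (B1 *m B2^T) = 0 & \tr (B2 *m B1^T) = 0]).

Local Notation X1 := (kron (2 ^ M) (2 ^ N) A1 B1).
Local Notation X2 := (kron (2 ^ M) (2 ^ N) A2 B2).
Local Notation X := (l1 *: X1 + l2 *: X2).
Local Notation T0 := ((2 ^ (M + N))%:R : R).
Local Notation rt := (Num.sqrt T0).
Local Notation Y w := (X + (sigma / rt) *: E w).
Local Notation c0 := (@concentration_const R).
Local Notation G := (signal_gap l1 l2 xi A1 A2 B1 B2).
Local Notation b := (sigma ^+ 2 + l2 ^+ 2).
Local Notation scale := (model_scale M N l1 l2 sigma).
Local Notation dims m n := ((2 ^ (m + n))%:R + (2 ^ (M + N - m - n))%:R : R).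

Hypothesis cosA : forall m n, inWA M N m0 n0 m n ->
     cosTheta (rearr m n X1) (rearr m n X2) <= xi.
Hypothesis cosB : forall m n, inWB M N m0 n0 m n ->
     cosTheta (rearrT m n X1) (rearrT m n X2) <= xi.
Hypotheses (G0 : 0 < G) (kappa_ge : 2 * ln 2 <= kappa) (in0 : inC M N m0 n0).

Let mRes m n : inC M N m n -> measurable_fun setT (residual E sigma X m n).
Proof. by move=> /and4P[mM nN _ _]; exact: (measurable_residual sigma iidE X mM nN). Qed.

Let Res_energy m n w : inC M N m n -> residual E sigma X m n w <= frob2 (Y w).
Proof. by move=> /and4P[mM nN _ _]; rewrite residualE// gerBl sqr_ge0. Qed.

Lemma expected_IC_gap m n : inW M N m0 n0 m n ->
  ((T0 * (ln ((G + b) / b) - 2 * log_constant c0 * (scale / (G + b)) - (4 * c0 + 48) / rt)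
      - kappa * dims m0 n0)%:E <=
   \int[P]_w (IC kappa m n (Y w))%:E - \int[P]_w (IC kappa m0 n0 (Y w))%:E)%E.
Proof.
move=> mnW; exact: (expected_gap concentration_const_gt0 (scale_gt0 _ _ l21 l20 sigma0) sigma0 G0
  kappa_ge in0  mRes (residual_ge0 E sigma X) Res_energy
  (energy_event iidE m0M n0N l21 l20 sigma0 trA trB)
  (true_residual_event l1 iidE m0M n0N l20 sigma0 trA trB)
  (noise_event iidE sigma0)
  (wrong_configuration_event iidE m0M n0N l21 l20 sigma0 xi0 trA trB cosA cosB)
  (residual_small_ball iidE sigma0 X) mnW).
Qed.

Lemma IC_selection_probability (x : R) : 0 < x ->
  8 * c0 * (1 + x) * scale <= G + b ->
  T0 * (8 * c0 * (1 + x) * (scale / (G + b)) + 2 * c0 * (1 + x) / rt) + kappa * dims m0 n0 <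
    T0 * ln ((G + b) / b) ->
  let A := [set w | forall m n, inW M N m0 n0 m n -> IC kappa m0 n0 (Y w) < IC kappa m n (Y w)] in
  measurable A /\ ((1 - 68 / x)%:E <= P A)%E.
Proof.
exact: (selection_probability concentration_const_gt0 (scale_gt0 _ _ l21 l20 sigma0) sigma0 G0
  kappa_ge in0 mRes (residual_ge0 E sigma X)
  (energy_event iidE m0M n0N l21 l20 sigma0 trA trB)
  (true_residual_event l1 iidE m0M n0N l20 sigma0 trA trB)
  (wrong_configuration_event iidE m0M n0N l21 l20 sigma0 xi0 trA trB cosA cosB)
  (residual_small_ball iidE sigma0 X)).
Qed.

End ModelSelection.

(** * Error scales relative to the gap *)

Section SignalToNoise.
Context {R : realType}.
Variables (T0 p q G b l1 l2 sigma : R).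
Hypotheses (p0 : 0 < p) (q0 : 0 < q) (pq : p * q = T0) (G0 : 0 < G).
Hypotheses (b0 : sigma ^+ 2 <= b) (l10 : 0 < l1 + l2) (sigma0 : 0 < sigma).
Local Notation rt := (Num.sqrt T0).

(** This is - ln (1 - y) >= y at y = G / (G + b). It turns errors relative to G + b into multiples
    of the logarithmic gap, whether G / b is small or large. *)
Lemma ln1D_div_ge : 0 < b -> G / (G + b) <= ln (1 + G / b).
Proof.
move=> b1; have Gb : 0 < G + b by exact: addr_gt0.
have h : 0 < b / (G + b) by exact: divr_gt0.
have -> : 1 + G / b = (b / (G + b))^-1 by field; rewrite !gt_eqF.
have := ln_le_sub1 h; rewrite lnV ?posrE// => h1.
have -> : G / (G + b) = 1 - b / (G + b) by field; rewrite gt_eqF.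
lra.
Qed.

(* AM-GM: [p + q >= 2 sqrt (p q)]. *)
Lemma noise_to_gap_le : 0 < b -> b / rt <= G / (T0 / (p + q) * (G / b)).
Proof.
move=> b1; have T00 : 0 < T0 by rewrite -pq mulr_gt0.
have rt0 : 0 < rt by rewrite sqrtr_gt0.
have rt2 : rt ^+ 2 = T0 by rewrite sqr_sqrtr// ltW.
have -> : G / (T0 / (p + q) * (G / b)) = b * (p + q) / T0.
  by field; rewrite !gt_eqF//= addr_gt0.
rewrite -mulrA ler_pM2l// ler_pdivlMr// -[X in _ * X]rt2 expr2 mulKf ?gt_eqF//.
rewrite -(@ler_sqr _ rt) ?nnegrE ?addr_ge0 ?ltW//.
by rewrite rt2 -pq; have := mulr_gt0 p0 q0; nra.
Qed.

Local Notation F1 := (T0 / (p + q) * (G / b)).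
Local Notation F2 := (Num.sqrt rt * (G / ((l1 + l2) * sigma))).

Lemma scale_le_gap :
  sigma ^+ 2 / rt + (l1 + l2) * sigma / Num.sqrt rt <= (F1^-1 + F2^-1) * G.
Proof.
have b1 : 0 < b by apply: lt_le_trans b0; exact: exprn_gt0.
have T00 : 0 < T0 by rewrite -pq mulr_gt0.
have rt0 : 0 < rt by rewrite sqrtr_gt0.
rewrite [leRHS]mulrDl; apply: lerD.
  rewrite [leRHS]mulrC; apply: le_trans (noise_to_gap_le b1).
  by rewrite ler_wpM2r// invr_ge0 ltW.
have rr : Num.sqrt rt != 0 by rewrite gt_eqF// sqrtr_gt0.
by rewrite le_eqVlt; apply/orP; left; apply/eqP; field; rewrite rr !gt_eqF.
Qed.

(** Write 1 = b / (G + b) + G / (G + b): [noise_to_gap_le] handles the first part of 1 / rt, and the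
    second is already a multiple of G / (G + b). *)
Lemma inv_sqrt_le_ln_gap : rt^-1 <= (F1^-1 + rt^-1) * ln (1 + G / b).
Proof.
have b1 : 0 < b by apply: lt_le_trans b0; exact: exprn_gt0.
have T00 : 0 < T0 by rewrite -pq mulr_gt0.
have rt0 : 0 < rt by rewrite sqrtr_gt0.
have f0 : 0 <= F1^-1 + rt^-1.
  by rewrite addr_ge0// invr_ge0 ltW// !(mulr_gt0, invr_gt0, addr_gt0).
apply: le_trans (ler_wpM2l f0 (ln1D_div_ge b1)).
have Gb : 0 < G + b by exact: addr_gt0.
have := noise_to_gap_le b1; set F := _ * (G / b) => h.
rewrite [leRHS]mulrA ler_pdivlMr// mulrDr [leRHS]mulrDl [leLHS]addrC.
by apply: lerD => //; rewrite ![_^-1 * _]mulrC.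
Qed.

End SignalToNoise.

Theorem theorem5 (R : realType) (d : measure_display)
  (Omega : nat -> measurableType d) (P : forall t, probability (Omega t) R)
  (M N m0 n0 : nat -> nat) (lam1 lam2 sigma kappa : nat -> R)
  (A1 A2 : forall t, 'M[R]_(2 ^ m0 t, 2 ^ n0 t))
  (B1 B2 : forall t, 'M[R]_(2 ^ (M t - m0 t), 2 ^ (N t - n0 t)))
  (E : forall t, Omega t -> 'M[R]_(2 ^ M t, 2 ^ N t)) (xi : R) :
  let X1 t : 'M[R]_(2 ^ M t, 2 ^ N t) := kron (2 ^ M t) (2 ^ N t) (A1 t) (B1 t) in
  let X2 t : 'M[R]_(2 ^ M t, 2 ^ N t) := kron (2 ^ M t) (2 ^ N t) (A2 t) (B2 t) in
  let Y t (w : Omega t) : 'M[R]_(2 ^ M t, 2 ^ N t) :=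
    lam1 t *: X1 t + lam2 t *: X2 t
    + (sigma t / Num.sqrt (2 ^ (M t + N t))%:R) *: E t w in
  let phi1 t := phiW (m0 t) (n0 t) (X1 t) in
  let phi2 t := phiW (m0 t) (n0 t) (X2 t) in
  let G t := lam1 t ^+ 2 * (1 - phi1 t ^+ 2) - lam2 t ^+ 2 * phi2 t ^+ 2
             - 2 * lam1 t * lam2 t * phi1 t * phi2 t * xi in
  let alpha t := ln (1 + G t / (sigma t ^+ 2 + lam2 t ^+ 2)) in
  (* model structure *)
  (forall t, (m0 t <= M t)%N /\ (n0 t <= N t)%N) ->
  (forall t, lam2 t <= lam1 t /\ 0 < lam2 t /\ 0 < sigma t) ->
  (forall t, [/\ \tr (A1 t *m (A1 t)^T) = 1, \tr (A2 t *m (A2 t)^T) = 1,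
                 \tr (A1 t *m (A2 t)^T) = 0 & \tr (A2 t *m (A1 t)^T) = 0]) ->
  (forall t, [/\ \tr (B1 t *m (B1 t)^T) = 1, \tr (B2 t *m (B2 t)^T) = 1,
                 \tr (B1 t *m (B2 t)^T) = 0 & \tr (B2 t *m (B1 t)^T) = 0]) ->
  (* sequence with M + N -> oo *)
  ((fun t => (M t + N t)%:R : R) @ \oo --> +oo) ->
  (* (A1) *)
  ((fun t => (m0 t + n0 t)%:R / ln (ln (M t * N t)%:R) : R) @ \oo --> +oo) ->
  ((fun t => ((M t - m0 t) + (N t - n0 t))%:R / ln (ln (M t * N t)%:R) : R)
     @ \oo --> +oo) ->
  (* (A2) *)
  (forall t, iid_std_normal (P t) (E t)) ->
  (* (A4) *)
  0 < xi -> xi < 1 ->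
  (forall t m n, inWA (M t) (N t) (m0 t) (n0 t) m n ->
     cosTheta (rearr m n (X1 t)) (rearr m n (X2 t)) <= xi) ->
  (forall t m n, inWB (M t) (N t) (m0 t) (n0 t) m n ->
     cosTheta (rearrT m n (X1 t)) (rearrT m n (X2 t)) <= xi) ->
  (* (A6) *)
  ((fun t => (2 ^ (M t + N t))%:R
              / ((2 ^ (m0 t + n0 t))%:R + (2 ^ ((M t - m0 t) + (N t - n0 t)))%:R)
              * (G t / (sigma t ^+ 2 + lam2 t ^+ 2)) : R) @ \oo --> +oo) ->
  ((fun t => Num.sqrt (Num.sqrt (2 ^ (M t + N t))%:R)
              * (G t / ((lam1 t + lam2 t) * sigma t)) : R) @ \oo --> +oo) ->
  (* conditions on kappa *)
  (forall t, 2 * ln 2 <= kappa t) ->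
  (forall e : R, 0 < e -> \forall t \near \oo,
     `|kappa t| <= e * `|(2 ^ (M t + N t))%:R * alpha t
                         / ((2 ^ (m0 t + n0 t))%:R + (2 ^ (M t + N t - m0 t - n0 t))%:R)|) ->
  (* conclusions *)
  (exists eps : nat -> R, eps @ \oo --> 0 /\
     \forall t \near \oo, forall m n, inW (M t) (N t) (m0 t) (n0 t) m n ->
       (((2 ^ (M t + N t))%:R * alpha t * (1 + eps t))%:E <=
        \int[P t]_w (IC (kappa t) m n (Y t w))%:E
        - \int[P t]_w (IC (kappa t) (m0 t) (n0 t) (Y t w))%:E)%E)
  /\
  ((fun t => P t [set w | forall m n, inW (M t) (N t) (m0 t) (n0 t) m n ->
                     IC (kappa t) (m0 t) (n0 t) (Y t w) < IC (kappa t) m n (Y t w)])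
     @ \oo --> 1%E).
Proof.
move=> X1 X2 Y phi1 phi2 G alpha mn0 lam trA trB MNoo A1a A1b iidE xi0 xi1 cosA cosB A6a A6b kap2 kapo.
pose T t : R := (2 ^ (M t + N t))%:R.
pose b t := sigma t ^+ 2 + lam2 t ^+ 2.
pose dims t : R := (2 ^ (m0 t + n0 t))%:R + (2 ^ (M t + N t - m0 t - n0 t))%:R.
pose F1 t := T t / dims t * (G t / b t).
pose F2 t := Num.sqrt (Num.sqrt (T t)) * (G t / ((lam1 t + lam2 t) * sigma t)).
have dimsE t : (2 ^ ((M t - m0 t) + (N t - n0 t)))%:R = (2 ^ (M t + N t - m0 t - n0 t))%:R :> R.
  by have [mM nN] := mn0 t; congr (2 ^ _)%:R; lia.
have F1oo : F1 @ \oo --> +oo.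
  move: A6a; rewrite (_ : (fun t => _) = F1)//; apply/funext => t.
  by rewrite /F1 /T /dims /b dimsE.
have F2oo : F2 @ \oo --> +oo by exact: A6b.
have T0 t : 0 < T t by rewrite ltr0n expn_gt0.
have rt0 t : 0 < Num.sqrt (T t) by rewrite sqrtr_gt0.
have rtoo : (fun t => Num.sqrt (T t)) @ \oo --> +oo.
  apply/cvgryPge => A; move/cvgryPge: MNoo => /(_ (A ^+ 2)); apply: filterS => t At.
  apply: le_trans (ler_norm A) _; rewrite -sqrtr_sqr ler_wsqrtr//; apply: le_trans At _.
  by rewrite ler_nat ltnW// ltn_expl.
have b0 t : 0 < b t.
  by have [_ [l20 s0]] := lam t; rewrite addr_gt0// exprn_gt0.
have p0 t : 0 < (2 ^ (m0 t + n0 t))%:R :> R by rewrite ltr0n expn_gt0.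
have q0 t : 0 < (2 ^ (M t + N t - m0 t - n0 t))%:R :> R by rewrite ltr0n expn_gt0.
have dims0 t : 0 < dims t by exact: addr_gt0.
have pq t : (2 ^ (m0 t + n0 t))%:R * (2 ^ (M t + N t - m0 t - n0 t))%:R = T t.
  by have [mM nN] := mn0 t; rewrite -natrM -expnD /T -subnDA subnKC// leq_add.
have Gpos : \forall t \near \oo, 0 < G t.
  move/cvgryPgt: (F1oo) => /(_ 0); apply: filterS => t.
  rewrite /F1 pmulr_rgt0; last by rewrite divr_gt0.
  by rewrite pmulr_lgt0// invr_gt0.
have alpha_pos t : 0 < G t -> 0 < alpha t.
  move=> Gt; have bt := b0 t; apply: lt_le_trans (_ : G t / (G t + b t) <= _).
    by rewrite divr_gt0// addr_gt0.
  exact: ln1D_div_ge.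
(* At an excluded corner one of the numerators in (A1) is 0, while both quotients are eventually
   positive. *)
have corner : \forall t \near \oo, inC (M t) (N t) (m0 t) (n0 t).
  move/cvgryPgt: A1a => /(_ 0); move/cvgryPgt: A1b => /(_ 0); apply: filterS2 => t hb ha.
  have [mM nN] := mn0 t; apply/and4P; split => //; apply/negP => /andP[/eqP e1 /eqP e2].
    by move: ha; rewrite e1 e2 mul0r ltxx.
  by move: hb; rewrite e1 e2 !subnn mul0r ltxx.
(* A common vanishing rate: [model_scale] is at most eta G, and the inverse square root of T is at
   most eta alpha. *)
pose eta t := (F1 t)^-1 + (F2 t)^-1 + (Num.sqrt (T t))^-1.
have inv0 (u : nat -> R) : u @ \oo --> +oo -> (fun t => (u t)^-1) @ \oo --> (0 : R).
  move=> uoo; apply/gtr0_cvgV0 => //; by move/cvgryPgt: uoo => /(_ 0).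
have eta0 : eta @ \oo --> (0 : R).
  rewrite (_ : 0 = 0 + 0 + 0); last by rewrite !addr0.
  by apply: cvgD; [apply: cvgD|]; exact: inv0.
(* Penalty of the true configuration relative to the gap; the upper condition on kappa makes it
   vanish. *)
pose rho t := kappa t * dims t / (T t * alpha t).
have rho0 : rho @ \oo --> (0 : R).
  apply/cvgr0Pnorm_le => e e0; near=> t.
  have Gt : 0 < G t by near: t.
  have at0 := alpha_pos t Gt.
  have : `|kappa t| <= e * `|T t * alpha t / dims t| by near: t; exact: kapo.
  rewrite (ger0_norm (_ : 0 <= T t * alpha t / dims t)); last by rewrite !mulr_ge0 ?invr_ge0 ?ltW.
  rewrite mulrA ler_pdivlMr// => h.
  have Ta : 0 < T t * alpha t by exact: mulr_gt0.
  by rewrite /rho normrM normfV normrM (gtr0_norm (dims0 t)) (gtr0_norm Ta) ler_pdivrMr.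
pose c : R := concentration_const.
have c0 : 0 < c := concentration_const_gt0.
have SN t : 0 < G t -> model_scale (M t) (N t) (lam1 t) (lam2 t) (sigma t) <= eta t * G t /\
    (Num.sqrt (T t))^-1 <= eta t * alpha t /\ 0 < eta t.
  move=> Gt; have [l21 [l20 s0]] := lam t.
  have l12 : 0 < lam1 t + lam2 t by move: l21 l20; lra.
  have sb : sigma t ^+ 2 <= b t by rewrite lerDl sqr_ge0.
  have f1 : 0 < F1 t by rewrite /F1 mulr_gt0 ?divr_gt0.
  have f2 : 0 < F2 t by rewrite /F2 mulr_gt0 ?divr_gt0 ?mulr_gt0 ?sqrtr_gt0.
  have i1 : 0 < (F1 t)^-1 by rewrite invr_gt0.
  have i2 : 0 < (F2 t)^-1 by rewrite invr_gt0.
  have i3 : 0 < (Num.sqrt (T t))^-1 by rewrite invr_gt0.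
  have at0 := alpha_pos t Gt.
  split; [|split].
  - apply: le_trans (scale_le_gap (p0 t) (q0 t) (pq t) Gt sb l12 s0) _.
    by rewrite ler_pM2r// lerDl ltW.
  - apply: le_trans (inv_sqrt_le_ln_gap (p0 t) (q0 t) (pq t) Gt sb s0) _.
    by rewrite ler_pM2r// -/(F1 t) /eta; lra.
  - by rewrite !addr_gt0.
have alphaE t : 0 < G t -> ln ((G t + b t) / b t) = alpha t.
  by move=> Gt; rewrite /alpha -/(b t); congr ln; field; rewrite gt_eqF.
have scaleG t : 0 < G t ->
    model_scale (M t) (N t) (lam1 t) (lam2 t) (sigma t) / (G t + b t) <= eta t * alpha t.
  move=> Gt; have [h1 [_ eta_t]] := SN t Gt.
  have Gb : 0 < G t + b t by exact: addr_gt0.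
  apply: le_trans (_ : eta t * (G t / (G t + b t)) <= _).
    by rewrite mulrA ler_pM2r ?invr_gt0.
  by rewrite ler_pM2l// ln1D_div_ge.
split.
  pose K := 2 * log_constant c + (4 * c + 48).
  (* This witness does not depend on (m, n), so the bound holds for the minimum over wrong
     configurations. *)
  exists (fun t => - (K * eta t + rho t)); split.
    rewrite (_ : 0 = - (K * 0 + 0)); last by rewrite mulr0 addr0 oppr0.
    by apply: cvgN; apply: cvgD => //; apply: cvgMr.
  near=> t => m n mnW.
  have Gt : 0 < G t by near: t.
  have inCt : inC (M t) (N t) (m0 t) (n0 t) by near: t.
  have [mM nN] := mn0 t; have [l21 [l20 s0]] := lam t.
  have at0 := alpha_pos t Gt; have [_ [h2 _]] := SN t Gt; have h1 := scaleG t Gt.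
  have := expected_IC_gap (iid_std_normal_gauss (iidE t)) mM nN l21 l20 s0 xi0 (trA t) (trB t)
    (cosA t) (cosB t) Gt (kap2 t) inCt mnW.
  apply: le_trans; rewrite lee_fin -/(G t) -/(b t) -/c -/(T t) -/(dims t) alphaE//.
  have rhoE : kappa t * dims t = rho t * (T t * alpha t).
    by rewrite /rho divfK// gt_eqF// mulr_gt0.
  rewrite rhoE -mulrA [rho t * _]mulrCA -mulrBr ler_pM2l// [alpha t * _]mulrC.
  have LC : 0 <= 2 * log_constant c.
    by rewrite /log_constant; have := sqr_ge0 c; have := sqr_ge0 (3 + c); lra.
  have := ler_wpM2l LC h1.
  have : (4 * c + 48) / Num.sqrt (T t) <= (4 * c + 48) * (eta t * alpha t).
    by apply: ler_wpM2l => //; move: c0; lra.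
  by rewrite /K; lra.
have prob (e : R) : 0 < e -> \forall t \near \oo,
    let A := [set w | forall m n, inW (M t) (N t) (m0 t) (n0 t) m n ->
       IC (kappa t) (m0 t) (n0 t) (Y t w) < IC (kappa t) m n (Y t w)] in
    measurable A /\ ((1 - e)%:E <= P t A)%E.
  move=> e0; pose x := 68 / e; have x0 : 0 < x by exact: divr_gt0.
  (* The losses add up to (8 + 2) c (1 + x) eta alpha. For eta <= k this is at most alpha / 4, and
     together with rho <= 1/4 it stays below alpha. *)
  pose k := (10 * c * (1 + x) * 4)^-1.
  have cx : 0 < c * (1 + x) by rewrite mulr_gt0// addr_gt0.
  have k0 : 0 < k by rewrite invr_gt0; have := cx; lra.
  near=> t.
  have Gt : 0 < G t by near: t.
  have inCt : inC (M t) (N t) (m0 t) (n0 t) by near: t.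
  have [mM nN] := mn0 t; have [l21 [l20 s0]] := lam t.
  have at0 := alpha_pos t Gt; have [h3 [h2 et0]] := SN t Gt; have h1 := scaleG t Gt.
  have etk : eta t <= k.
    apply: le_trans (ler_norm _) _; near: t.
    by move/cvgr0Pnorm_le: eta0 => /(_ k k0).
  have rk : rho t <= 1 / 4.
    apply: le_trans (ler_norm _) _; near: t.
    by move/cvgr0Pnorm_le: rho0 => /(_ (1 / 4)); apply; lra.
  have ek : 10 * (c * (1 + x)) * eta t <= 1 / 4.
    have : 10 * (c * (1 + x)) * eta t <= 10 * (c * (1 + x)) * k.
      by apply: ler_wpM2l => //; have := cx; lra.
    move/le_trans; apply; rewrite /k le_eqVlt; apply/orP; left; apply/eqP.
    by field; rewrite !gt_eqF// addr_gt0.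
  have -> : e = 68 / x by rewrite /x; field; rewrite gt_eqF.
  apply: (IC_selection_probability (iid_std_normal_gauss (iidE t)) mM nN l21 l20 s0 xi0
    (trA t) (trB t) (cosA t) (cosB t) Gt (kap2 t) inCt x0).
  - change (8 * c * (1 + x) * model_scale (M t) (N t) (lam1 t) (lam2 t) (sigma t) <= G t + b t).
    have : 8 * c * (1 + x) * model_scale (M t) (N t) (lam1 t) (lam2 t) (sigma t) <=
        8 * c * (1 + x) * (eta t * G t).
      by apply: ler_wpM2l => //; have := cx; lra.
    have : 10 * (c * (1 + x)) * eta t * G t <= 1 / 4 * G t by rewrite ler_pM2r.
    have : 0 <= c * (1 + x) * (eta t * G t) by rewrite ltW// mulr_gt0// mulr_gt0.
    by have := b0 t; have := Gt; lra.
  - rewrite -/(G t) -/(b t) -/c -/(T t) -/(dims t) alphaE//.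
    have -> : kappa t * dims t = T t * (rho t * alpha t).
      by rewrite mulrCA /rho divfK// gt_eqF// mulr_gt0.
    rewrite -mulrDr ltr_pM2l//.
    have : 8 * c * (1 + x) * (model_scale (M t) (N t) (lam1 t) (lam2 t) (sigma t) / (G t + b t))
        <= 8 * c * (1 + x) * (eta t * alpha t).
      by apply: ler_wpM2l => //; have := cx; lra.
    have : 2 * c * (1 + x) / Num.sqrt (T t) <= 2 * c * (1 + x) * (eta t * alpha t).
      by apply: ler_wpM2l => //; have := cx; lra.
    have : 10 * (c * (1 + x)) * eta t * alpha t <= 1 / 4 * alpha t by rewrite ler_pM2r.
    have : rho t * alpha t <= 1 / 4 * alpha t by rewrite ler_pM2r.
    by have := at0; lra.
apply/fine_cvgP; split.
  by apply: filterS (prob 1 ltr01) => t [mA _]; exact: fin_num_measure.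
apply/cvgrPdist_le => e e0; apply: filterS (prob e e0) => t [mA].
set p := P t _ => pe; have pf : p \is a fin_num by exact: fin_num_measure.
have p1 : (p <= 1)%E by exact: probability_le1.
move: pe p1; rewrite /= -/p -(fineK pf) !lee_fin /= => pe p1.
by rewrite ler_norml; apply/andP; split; lra.
Unshelve. all: by end_near.
Qed.
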